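(* In the algorithm setup, assume Property (P2). Then for every $1\le\ell\le L$, every pseudo-Lipschitz $\psi:\mathbb R^\ell\to\mathbb R$, every variable $i$ and factor $a\in\partial i$, $$\mathbb E\big[\psi(u^1_{i\to a},\dots,u^\ell_{i\to a})\big]=\mathbb E[\psi(U_1,\dots,U_\ell)]+o_d(1),\qquad \mathbb E\big[\psi(u^1_{i},\dots,u^\ell_{i})\big]=\mathbb E[\psi(U_1,\dots,U_\ell)]+o_d(1),$$ where $U_1,\dots,U_\ell$ are independent with $U_s\sim\mathcal N(0,\nu_s)$.
   Context: Algorithm setup. Fix $r\ge2$ and a predicate $f:\{\pm1\}^r\to\{0,1\}$, identified with its multilinear extension $f(x)=\sum_{S\subseteq[r]}\hat f(S)\prod_{\iota\in S}x_\iota$ on $\mathbb R^r$, and assume $\hat f(S)=0$ whenever $|S|=1$. Let $\xi(s)=\sum_{j=1}^r\big(\sum_{|S|=j}\hat f(S)^2\big)s^j$. Fix $\delta>0$, let $L=\lfloor1/\delta\rfloor$, and for $\ell\ge1$ let $\nu_\ell=\big(\xi'(\ell\delta)-\xi'((\ell-1)\delta)\big)/r$. Let $G=(V,E)$ be a hypergraph whose hyperedges (factors) $a$ are ordered $r$-tuples $\partial a=(v_{a,1},\dots,v_{a,r})$ of distinct vertices (variables), which is $d$-index-regular: every variable lies in exactly $d$ factors, and for each $\iota\in[r]$ it is the $\iota$-th entry of exactly $d/r$ factors. Write $\partial i$ for the set of factors containing $i$. Assume the bipartite variable–factor incidence graph (factor graph) of $G$ has no cycle of length less than $4L+4$. For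 a factor $a$ and $j\in\partial a$, $\mathsf D_{j;a}f$ is the partial derivative of (multilinear) $f$ in the coordinate $\iota$ with $v_{a,\iota}=j$ (it does not depend on that coordinate). Fix $K>0$ and functions $F_{\to,\ell},F_\ell:\mathbb R^\ell\to[-K,K]$ for $0\le\ell\le L-1$ (constants when $\ell=0$). Randomness: $z_i^0$, $i\in V$, i.i.d. $\mathcal N(0,\delta)$; set $z^0_{i\to a}=z_i^0$, $w_i^0=w^0_{i\to a}=0$. For $\ell=0,\dots,L-1$: $A^\ell_{i\to a}=F_{\to,\ell}(u^1_{i\to a},\dots,u^\ell_{i\to a})$, $A^\ell_i=F_\ell(u^1_i,\dots,u^\ell_i)$; with $\mathbf z^\ell_{\partial b\to b}=(z^\ell_{v_{b,1}\to b},\dots,z^\ell_{v_{b,r}\to b})$, $w^{\ell+1}_{i\to a}=(d-1)^{-1/2}\sum_{b\in\partial i\setminus a}\mathsf D_{i;b}f(\mathbf z^\ell_{\partial b\to b})$, $u^{\ell+1}_{i\to a}=w^{\ell+1}_{i\to a}-w^\ell_{i\to a}$, $z^{\ell+1}_{i\to a}=z_i^0+\sum_{s=1}^{\ell+1}A^{s-1}_{i\to a}u^s_{i\to a}$; $w^{\ell+1}_i=d^{-1/2}\sum_{b\in\partial i}\mathsf D_{i;b}f(\mathbf z^\ell_{\partial b\to b})$, $u^{\ell+1}_i=w^{\ell+1}_i-w^\ell_i$, $z^{\ell+1}_i=z_i^0+\sum_{s=1}^{\ell+1}A^{s-1}_iu^s_i$. Also $\mathbf z^\ell_{\partial a}=(z^\ell_{v_{a,1}},\dots,z^\ell_{v_{a,r}})$.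 Asymptotics: $r,f,\delta,L,K$ are fixed and $d\to\infty$ along such hypergraphs (nonlinearities may depend on $d$); $O_d(g(d))$ denotes a quantity bounded in absolute value by $C g(d)$ with $C$ independent of $d$, of the hypergraph and of the chosen variables/factors; $o_d(1)$ denotes a quantity tending to $0$ as $d\to\infty$ in the same uniform sense; $\mathrm{plim}$ is limit in probability. Property (P1): for all $0\le\ell\le L-1$, variables $i$, factors $a\in\partial i$, $m\in\mathbb N$: $\mathbb E|A^\ell_i-A^\ell_{i\to a}|^m=O_d(d^{-m/2})$. Property (P2): for all such $\ell,i,a$: $\mathbb E[(A^\ell_i)^2]=\mathbb E[(A^\ell_{i\to a})^2]=\delta/\nu_{\ell+1}$. A function $\psi:\mathbb R^s\to\mathbb R$ is pseudo-Lipschitz if there is $C>0$ with $|\psi(x)-\psi(y)|\le C(1+\|x\|+\|y\|)\|x-y\|$ for all $x,y\in\mathbb R^s$. *)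

(* Defs.v *)
From HB Require Import structures.
From mathcomp Require Import all_boot all_order all_algebra.
From mathcomp Require Import all_classical all_reals all_analysis.

Set Implicit Arguments.
Unset Strict Implicit.
Unset Printing Implicit Defensive.
Import Order.TTheory GRing.Theory Num.Theory.
Import numFieldNormedType.Exports.
Local Open Scope ring_scope.

Section Gauss.
Variable R : realType.

Definition gauss_exp (h : R -> R) : R :=
  \int[lebesgue_measure]_t (h t * (expR (- (t ^+ 2) / 2) / Num.sqrt (2 * pi))).

(* Iterated Gaussian expectation: E[g(X)] where X_v = sd v * G_v and the
   G_v (v in s) are i.i.d. standard Gaussians; coordinates outside s keep x. *)
Fixpoint iexp_seq (T : eqType) (sd : T -> R) (s : seq T) (g : (T -> R) -> R)
  (x : T -> R) : R :=
  match s with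
  | [::] => g x
  | v :: s' => gauss_exp (fun t =>
      iexp_seq sd s' g (fun w => if w == v then sd v * t else x w))
  end.

Definition gexp (T : finType) (sd : T -> R) (g : (T -> R) -> R) : R :=
  iexp_seq sd (enum T) g (fun _ => 0).

Definition tdist n (x y : n.-tuple R) : R :=
  Num.sqrt (\sum_(k < n) (tnth x k - tnth y k) ^+ 2).
Definition tnorm n (x : n.-tuple R) : R :=
  Num.sqrt (\sum_(k < n) tnth x k ^+ 2).

Definition pseudo_lipschitz n (psi : n.-tuple R -> R) : Prop :=
  exists C : R, 0 < C /\ forall x y : n.-tuple R,
    `|psi x - psi y| <= C * (1 + tnorm x + tnorm y) * tdist x y.
End Gauss.

Section Predicate.
Variable R : realType.
Variable r : nat.
(* f : {+-1}^r -> {0,1}; a point of {+-1}^r is encoded by x : {ffun 'I_r -> bool},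
   true <-> +1, false <-> -1. *)
Variable f : {ffun 'I_r -> bool} -> bool.

Definition pm (b : bool) : R := if b then 1 else -1.

Definition fhat (S : {set 'I_r}) : R :=
  ((2 : R) ^+ r)^-1 * \sum_(x : {ffun 'I_r -> bool}) (f x)%:R * \prod_(k in S) pm (x k).

Definition fml (y : 'I_r -> R) : R :=
  \sum_(S : {set 'I_r}) fhat S * \prod_(k in S) y k.

Definition dfml (k : 'I_r) (y : 'I_r -> R) : R :=
  derive1 (fun t : R => fml (fun j => if j == k then t else y j)) (y k).

Definition xi : {poly R} :=
  \sum_(1 <= j < r.+1) (\sum_(S : {set 'I_r} | #|S| == j) fhat S ^+ 2) *: 'X^j.

Definition nu (delta : R) (l : nat) : R :=
  ((xi^`()).[l%:R * delta] - (xi^`()).[l.-1%:R * delta]) / r%:R.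
End Predicate.

Section Hypergraph.
Variable r : nat.
Variables (V E : finType) (edge : E -> 'I_r -> V).

Definition inb (i : V) (a : E) : bool := [exists k, edge a k == i].

Definition index_regular (d : nat) : Prop :=
  (r %| d)%N /\
  (forall i : V, #|[set a | inb i a]| = d) /\
  (forall (i : V) (k : 'I_r), #|[set a | edge a k == i]| = (d %/ r)%N).

Definition incid (x y : V + E) : bool :=
  match x, y with
  | inl i, inr a => inb i a
  | inr a, inl i => inb i a
  | _, _ => false
  end.

Definition no_short_cycle (g : nat) : Prop :=
  forall s : seq (V + E), (3 <= size s)%N -> cycle incid s -> uniq s ->
    (g <= size s)%N.
End Hypergraph.

Section Algorithm.
Variable R : realType.
Variable r : nat.
Variable f : {ffun 'I_r -> bool} -> bool.
Variables (V E : finType) (edge : E -> 'I_r -> V).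
Variable d : nat.
Variables Fto Fnd : forall l : nat, l.-tuple R -> R.
Variable x : V -> R.

(* D_{i;b} f : derivative in the coordinate of b occupied by i *)
Definition Dif (i : V) (b : E) (y : 'I_r -> R) : R :=
  \sum_(k | edge b k == i) dfml f k y.

(* a history H : nat -> V -> E -> R stores s |-> w^s_{i->a} *)
Definition umsg (H : nat -> V -> E -> R) (s : nat) (i : V) (a : E) : R :=
  H s i a - H s.-1 i a.

Definition zmsg (H : nat -> V -> E -> R) (l : nat) (j : V) (b : E) : R :=
  x j + \sum_(0 <= s < l)
          Fto [tuple umsg H k.+1 j b | k < s] * umsg H s.+1 j b.

Definition wnew (H : nat -> V -> E -> R) (l : nat) (i : V) (a : E) : R :=
  (Num.sqrt (d.-1)%:R)^-1 *
    \sum_(b | inb edge i b && (b != a))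
       Dif i b (fun k => zmsg H l (edge b k) b).

(* W l s i a = w^s_{i->a} for s <= l *)
Fixpoint W (l : nat) : nat -> V -> E -> R :=
  match l with
  | 0 => fun _ _ _ => 0
  | l'.+1 => fun s i a =>
      if (s <= l')%N then W l' s i a else wnew (W l') l' i a
  end.

Definition u_msg (l s : nat) (i : V) (a : E) : R := umsg (W l) s i a.

Definition w_node (l s : nat) (i : V) : R :=
  if s == 0%N then 0 else
  (Num.sqrt d%:R)^-1 *
    \sum_(b | inb edge i b) Dif i b (fun k => zmsg (W l) s.-1 (edge b k) b).

Definition u_node (l s : nat) (i : V) : R := w_node l s i - w_node l s.-1 i.

Definition A_msg (l : nat) (i : V) (a : E) : R :=
  Fto [tuple u_msg l k.+1 i a | k < l].
Definition A_node (l : nat) (i : V) : R :=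
  Fnd [tuple u_node l k.+1 i | k < l].
End Algorithm.

Arguments fhat {R r} f S.

(* Main.v *)
Require Import Defs.
From HB Require Import structures.
From mathcomp Require Import all_boot all_order all_algebra.
From mathcomp Require Import all_classical all_reals all_analysis measurable_realfun.
From mathcomp Require Import ring lra zify.
Set Implicit Arguments.
Unset Strict Implicit.
Unset Printing Implicit Defensive.
Import Order.TTheory GRing.Theory Num.Theory.
Import numFieldNormedType.Exports.
Local Open Scope classical_set_scope.
Local Open Scope ring_scope.

(* Since the factor graph has no short cycle, the messages entering a vertex from
   distinct factors are functions of disjoint sets of the initial Gaussians, hence
   independent; moreover an increment of z^l, or of D_i f(z^l), is orthogonal to
   every variable that, within the ball it depends on, only sees the previous ball.
   So u^1, ..., u^l is a normalised sum over the factors at i of independent centred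
   vectors with uncorrelated entries. The variance of such an entry is a polynomial
   in the second moments of z^s and z^(s-1), and by (P2) and a law of large numbers
   for the squares, E[(z^s)^2] = (s + 1) delta + O(d^(-1/2)) by induction on s;
   averaging over the position of i in its factors gives nu_s.
   A quantitative Lindeberg argument concludes: psi is smoothed by a small Gaussian
   noise, and each summand is replaced in turn by an increase of the variance of that
   noise. Both replacements are compared through a Taylor expansion of the smoothed
   psi, which comes from the Gaussian shift formula, so psi needs no derivative. *)

(** The claim is uniform over hypergraphs whose vertex set grows with [d], so every estimate is an
    inequality with a constant computed from [r], [f], [delta], [K] and the level. Fourth moments,
    bounded along the recursion, supply these constants for the law of large numbers and for the
    third-order error of the replacement. The law of large numbers is forced by the factor [A^l]: it
    is a function of earlier messages, hence correlated with the squared contributions that it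
    multiplies, whereas (P2) fixes only its own second moment. Once the average of these squares is
    replaced by its mean, at a cost controlled by [|A^l| <= K], the value [delta / nu] cancels the
    variance and each step adds [delta] up to that cost. Since degree-one coefficients vanish,
    [D_i f(0) = 0], and the first increment has the same form as the later ones. The entries of a
    summand are only uncorrelated. The limit has independent coordinates because the second-order
    term sees only covariances, and the noise that absorbs them has independent coordinates. *)

(** * Affine changes of variables and Fubini for Lebesgue measure on the line *)

Section Lebesgue.
Variable R : realType.
Notation mu := (@lebesgue_measure R).
Implicit Types (h : R -> R) (k b : R).

Lemma measurable_affine k b : measurable_fun setT (fun x : R => k * x + b).
Proof. by apply: measurable_funD => //; apply: measurable_funM. Qed.

Let aff k b : measurableTypeR R -> measurableTypeR R := fun x => k * x + b.

(** Lebesgue measure is determined by half-open intervals; the preimage of []x, y]] under the affine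
    map has length [(y - x) / k], which the factor [k] restores. *)
Lemma lebesgue_affine k b (k0 : 0 < k) (A : set R) : measurable A ->
  mu A = mscale (NngNum (ltW k0)) (measure_function_pushforward__canonical__measure_function_Measure mu (measurable_affine k b : measurable_fun setT (aff k b))) A.
Proof.
apply: lebesgue_measure_unique => _ [[x y]] _ <-.
change (mu `]x, y] = k%:E * mu (aff k b @^-1` `]x, y]))%E.
rewrite (_ : aff k b @^-1` _ = [set` `](x - b) / k, (y - b) / k]]); last first.
  by apply/seteqP; split => z /=; rewrite !in_itv /= /aff ltr_pdivrMr // ler_pdivlMr // ltrBlDr lerBrDr (mulrC k) //.
rewrite !lebesgue_measure_itv /= !lte_fin ltr_pM2r ?invr_gt0 // ltrD2r.
case: ifP => _; rewrite ?mule0 // -!EFinB -EFinM; congr EFin; field.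
by rewrite gt_eqF.
Qed.

Lemma ge0_integral_affine (f : R -> \bar R) k b : 0 < k ->
  measurable_fun setT f -> (forall x, (0 <= f x)%E) ->
  (\int[mu]_x f x = k%:E * \int[mu]_x f (k * x + b)%R)%E.
Proof.
move=> k0 mf f0.
rewrite (@eq_measure_integral _ _ _ setT (mscale (NngNum (ltW k0)) (measure_function_pushforward__canonical__measure_function_Measure mu (measurable_affine k b : measurable_fun setT (aff k b)))) mu f); last first.
  by move=> A mA _; exact: lebesgue_affine.
rewrite ge0_integral_mscale //.
congr (_ * _)%E.
by rewrite ge0_integral_pushforward //; exact: measurable_affine.
Qed.

Lemma Rintegral_affine h k b : 0 < k -> measurable_fun setT h ->
  \int[mu]_x h x = \int[mu]_x (k * h (k * x + b)).
Proof.
move=> k0 mh; congr fine.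
have ma : measurable_fun setT (fun x : R => k * h (k * x + b)).
  by apply: measurable_funM => //; apply: measurableT_comp => //; exact: measurable_affine.
rewrite [LHS]integralE [RHS]integralE; congr (_ - _)%E.
  rewrite (ge0_integral_affine b k0) //; last first.
    exact/measurable_funepos/measurable_EFinP.
  rewrite -ge0_integralZl //; last 2 first.
  - apply: (measurableT_comp (f := (EFin \o h)^\+)%E).
      exact/measurable_funepos/measurable_EFinP.
    exact: measurable_affine.
  - by rewrite lee_fin ltW.
  by apply: eq_integral => x _; rewrite !funeposE /= EFinM maxeMr ?mule0 // ltW.
rewrite (ge0_integral_affine b k0) //; last first.
  exact/measurable_funeneg/measurable_EFinP.
rewrite -ge0_integralZl //; last 2 first.
- apply: (measurableT_comp (f := (EFin \o h)^\-)%E).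
      exact/measurable_funeneg/measurable_EFinP.
    exact: measurable_affine.
- by rewrite lee_fin ltW.
by apply: eq_integral => x _; rewrite !funenegE /= maxeMr ?mule0 ?lee_fin ?ltW // -EFinM mulrN.
Qed.

Lemma Rintegral_swap (F : R -> R -> R) :
  measurable_fun setT (fun p : R * R => F p.1 p.2) ->
  (\int[mu]_t \int[mu]_u `|F t u|%:E < +oo)%E ->
  (forall t, mu.-integrable setT (fun u => (F t u)%:E)) ->
  (forall u, mu.-integrable setT (fun t => (F t u)%:E)) ->
  \int[mu]_t \int[mu]_u F t u = \int[mu]_u \int[mu]_t F t u.
Proof.
move=> mF ltF i1 i2; congr fine.
have mE : measurable_fun setT (fun p : R * R => (F p.1 p.2)%:E) by exact/measurable_EFinP.
have E := Fubini ((@integrable12ltyP _ _ _ _ R mu mu _ mE).2 ltF).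
under eq_integral do rewrite /Rintegral fineK ?integrable_fin_num //.
under [RHS]eq_integral do rewrite /Rintegral fineK ?integrable_fin_num //.
exact: E.
Qed.

Lemma measurable_Rintegral d (Om : measurableType d) (F : Om * R -> R) :
  measurable_fun setT F -> measurable_fun setT (fun w => \int[mu]_t F (w, t)).
Proof.
move=> mF; apply: (measurableT_comp (f := fine)); first exact: fine_measurable.
have mE : measurable_fun setT (EFin \o F) by exact/measurable_EFinP.
rewrite (_ : (fun w => _) = (fun w => \int[mu]_t (EFin \o F)^\+ (w, t) - \int[mu]_t (EFin \o F)^\- (w, t))%E).
  apply: emeasurable_funB.
    by apply: (@measurable_fun_fubini_tonelli_F _ _ Om (measurableTypeR R) R mu (EFin \o F)^\+%E) => //; exact: measurable_funepos.
  by apply: (@measurable_fun_fubini_tonelli_F _ _ Om (measurableTypeR R) R mu (EFin \o F)^\-%E) => //; exact: measurable_funeneg.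
apply/funext => w; rewrite integralE; congr (_ - _)%E; apply: eq_integral => t _;
  by rewrite !(funeposE, funenegE).
Qed.

End Lebesgue.

(** * One-dimensional Gaussian expectations *)

Section Gauss1D.
Variable R : realType.
Notation mu := (@lebesgue_measure R).
Implicit Types (h : R -> R) (k b a t : R).

Definition gpdf t : R := expR (- (t ^+ 2) / 2) / Num.sqrt (2 * pi).

Let sqrt2pi_gt0 : 0 < Num.sqrt (2 * pi) :> R.
Proof. by rewrite sqrtr_gt0 mulr_gt0 // pi_gt0. Qed.

Lemma gpdf_gt0 t : 0 < gpdf t.
Proof. by rewrite divr_gt0 // expR_gt0. Qed.

Lemma gpdfB_normal a t : gpdf (t - a) = normal_pdf a 1 t.
Proof.
rewrite normal_pdfE ?oner_eq0 // /gpdf mulrC /normal_peak /normal_fun.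
by rewrite expr1n mul1r !mulr_natl.
Qed.

(** One-dimensional Cameron--Martin formula: a shift of the argument becomes an exponential weight,
    and weights can be expanded where the integrand cannot. *)
Lemma gpdfB_exp a t : gpdf (t - a) = expR (a * t - a ^+ 2 / 2) * gpdf t.
Proof. by rewrite /gpdf mulrA -expRD; congr (expR _ / _); field. Qed.

Lemma measurable_gpdf : measurable_fun setT gpdf.
Proof.
rewrite (_ : gpdf = normal_pdf 0 1); first exact: measurable_normal_pdf.
by apply/funext => t; rewrite -gpdfB_normal subr0.
Qed.

Lemma integrable_gpdfB a : mu.-integrable setT (fun t => (gpdf (t - a))%:E).
Proof.
have := @integrable_normal_pdf R a 1.
by under [X in _ -> integrable _ _ X]eq_fun do rewrite gpdfB_normal.
Qed.

Lemma Rintegral_gpdfB a : \int[mu]_t gpdf (t - a) = 1.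
Proof.
under eq_Rintegral do rewrite gpdfB_normal.
by rewrite /Rintegral integral_normal_pdf.
Qed.

(** Exponential growth is the right class: it contains the weights of the shift formula, is closed
    under products and affine substitutions, and is still integrable against the Gaussian
    density. *)
Definition tame1 h := measurable_fun setT h /\
  exists C m : R, [/\ 0 <= C, 0 <= m & forall t, `|h t| <= C * expR (m * `|t|)].

(** [expR (m * |t|)] is at most [expR (m * t) + expR (- m * t)], and each of these times [gpdf t] is
    [expR (m ^+ 2 / 2)] times a translated Gaussian density. *)
Lemma tame1_integrable h : tame1 h ->
  mu.-integrable setT (fun t => (h t * gpdf t)%:E).
Proof.
move=> [mh [C [m [C0 m0 hC]]]].
have mhg : measurable_fun setT (fun t => (h t * gpdf t)%:E).
  by apply/measurable_EFinP; apply: measurable_funM => //; exact: measurable_gpdf.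
have ig : mu.-integrable setT (fun t => (C * expR (m ^+ 2 / 2) * (gpdf (t - m) + gpdf (t - - m)))%:E).
  under [X in integrable _ _ X]eq_fun do rewrite EFinM EFinD.
  apply: integrableZl => //.
  by apply: integrableD => //; exact: integrable_gpdfB.
apply: (le_integrable _ _ _ ig) => //.
move=> t _; rewrite /= lee_fin normrM (ger0_norm (ltW (gpdf_gt0 t))) [leRHS]ger0_norm; last first.
  by rewrite !mulr_ge0 ?expR_ge0 ?addr_ge0 // ltW // gpdf_gt0.
apply: (@le_trans _ _ (C * expR (m * `|t|) * gpdf t)).
  by rewrite ler_pM2r ?gpdf_gt0.
rewrite -!mulrA ler_wpM2l // !gpdfB_exp -mulrDl mulrA ler_pM2r ?gpdf_gt0 //.
rewrite mulrDr -!expRD sqrrN.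
have -> : m * (m / 2) + (m * t - m ^+ 2 / 2) = m * t by ring.
have -> : m * (m / 2) + (- m * t - m ^+ 2 / 2) = - m * t by ring.
case: ger0P => _; first by rewrite lerDl expR_ge0.
by rewrite mulrN -mulNr lerDr expR_ge0.
Qed.

Lemma tame1_cst k : tame1 (fun=> k).
Proof.
split; first exact: measurable_cst.
exists `|k|, 0; split => // t; by rewrite mul0r expR0 mulr1.
Qed.

Lemma tame1_id : tame1 id.
Proof.
split => //; exists 1, 1; split => // t; rewrite !mul1r.
by rewrite (le_trans _ (expR_ge1Dx _)) // lerDr.
Qed.

Lemma tame1D h1 h2 : tame1 h1 -> tame1 h2 -> tame1 (fun t => h1 t + h2 t).
Proof.
move=> [mh [C [m [C0 m0 hC]]]] [mh' [C' [m' [C0' m0' hC']]]]; split.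
  exact: measurable_funD.
exists (C + C'), (m + m'); split; rewrite ?addr_ge0 // => t.
rewrite (le_trans (ler_normD _ _)) // mulrDl lerD //.
  by rewrite (le_trans (hC t)) // ler_wpM2l // ler_expR ler_wpM2r // lerDl.
by rewrite (le_trans (hC' t)) // ler_wpM2l // ler_expR ler_wpM2r // lerDr.
Qed.

Lemma tame1M h1 h2 : tame1 h1 -> tame1 h2 -> tame1 (fun t => h1 t * h2 t).
Proof.
move=> [mh [C [m [C0 m0 hC]]]] [mh' [C' [m' [C0' m0' hC']]]]; split.
  exact: measurable_funM.
exists (C * C'), (m + m'); split; rewrite ?mulr_ge0 ?addr_ge0 // => t.
by rewrite normrM mulrDl expRD mulrACA ler_pM.
Qed.

Lemma tame1_expR k : tame1 (fun t => expR (k * `|t|)).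
Proof.
split.
  by apply: measurableT_comp => //; apply: measurable_funM.
exists 1, `|k|; split => // t; rewrite mul1r ger0_norm ?expR_ge0 // ler_expR.
by rewrite ler_wpM2r // ler_norm.
Qed.

Lemma tame1_affine h k b : tame1 h -> tame1 (fun t => h (k * t + b)).
Proof.
move=> [mh [C [m [C0 m0 hC]]]]; split.
  by apply: measurableT_comp => //; exact: measurable_affine.
exists (C * expR (m * `|b|)), (m * `|k|); split; rewrite ?mulr_ge0 ?expR_ge0 // => t.
rewrite (le_trans (hC _)) // -mulrA -expRD ler_wpM2l // ler_expR.
by rewrite -mulrA -mulrDr ler_wpM2l // addrC (le_trans (ler_normD _ _)) // normrM.
Qed.

Lemma gauss_expE h : gauss_exp h = \int[mu]_t (h t * gpdf t).
Proof. by []. Qed.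

Lemma gauss_expD h1 h2 : tame1 h1 -> tame1 h2 ->
  gauss_exp (fun t => h1 t + h2 t) = gauss_exp h1 + gauss_exp h2.
Proof.
move=> t1 t2; rewrite !gauss_expE; under eq_Rintegral do rewrite mulrDl.
by rewrite RintegralD //; exact: tame1_integrable.
Qed.

Lemma gauss_expZ k h : tame1 h ->
  gauss_exp (fun t => k * h t) = k * gauss_exp h.
Proof.
move=> t1; rewrite !gauss_expE; under eq_Rintegral do rewrite -mulrA.
by rewrite RintegralZl //; exact: tame1_integrable.
Qed.

Lemma gauss_exp_cst k : gauss_exp (fun=> k) = k.
Proof.
have -> : gauss_exp (fun=> k) = k * gauss_exp (fun=> 1).
  rewrite -gauss_expZ; last exact: tame1_cst.
  by congr gauss_exp; apply/funext => t; rewrite mulr1.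
rewrite -[RHS]mulr1; congr (_ * _); rewrite gauss_expE -[RHS](Rintegral_gpdfB 0).
by apply: eq_Rintegral => t _; rewrite mul1r subr0.
Qed.

Lemma le_gauss_exp h1 h2 : tame1 h1 -> tame1 h2 ->
  (forall t, h1 t <= h2 t) -> gauss_exp h1 <= gauss_exp h2.
Proof.
move=> t1 t2 h12; rewrite !gauss_expE; apply: le_Rintegral => //.
- exact: tame1_integrable.
- exact: tame1_integrable.
- by move=> t _; rewrite ler_pM2r ?gpdf_gt0.
Qed.

Lemma gauss_exp_shift h a : measurable_fun setT h ->
  gauss_exp (fun t => h (t + a)) = gauss_exp (fun t => h t * expR (a * t - a ^+ 2 / 2)).
Proof.
move=> mh; rewrite !gauss_expE.
rewrite [RHS](Rintegral_affine a ltr01); last first.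
  apply: measurable_funM; last exact: measurable_gpdf.
  apply: measurable_funM => //; apply: measurableT_comp => //.
  by apply: measurable_funB => //; apply: measurable_funM.
by apply: eq_Rintegral => t _; rewrite mul1r mul1r -mulrA -gpdfB_exp addrK.
Qed.

Lemma measurable_gauss_exp d (Om : measurableType d) (h : Om * R -> R) :
  measurable_fun setT h ->
  measurable_fun setT (fun w => gauss_exp (fun t => h (w, t))).
Proof.
move=> mh; rewrite /gauss_exp.
apply: (measurable_Rintegral (F := fun p => h p * gpdf p.2)).
apply: measurable_funM => //; apply: measurableT_comp => //.
exact: measurable_gpdf.
Qed.

Lemma gauss_exp_swap (h : R -> R -> R) C m : 0 <= C -> 0 <= m ->
  measurable_fun setT (fun p : R * R => h p.1 p.2) ->
  (forall t u, `|h t u| <= C * expR (m * `|t|) * expR (m * `|u|)) ->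
  gauss_exp (fun t => gauss_exp (h t)) = gauss_exp (fun u => gauss_exp (h ^~ u)).
Proof.
move=> C0 m0 mh hC.
have th1 t : tame1 (h t).
  split; first exact: (measurable_fun_pair2 t mh).
  by exists (C * expR (m * `|t|)), m; rewrite mulr_ge0 ?expR_ge0.
have th2 u : tame1 (h ^~ u).
  split; first exact: (measurable_fun_pair1 u mh).
  exists (C * expR (m * `|u|)), m; split => // [|t]; first by rewrite mulr_ge0 ?expR_ge0.
  by rewrite mulrAC.
have iE t : mu.-integrable setT (fun u => (h t u * gpdf u * gpdf t)%:E).
  have := integrableZl measurableT (gpdf t) (tame1_integrable (th1 t)).
  by under [X in _ -> integrable _ _ X]eq_fun do rewrite mulrC EFinM.
have iE2 u : mu.-integrable setT (fun t => (h t u * gpdf u * gpdf t)%:E).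
  have := integrableZl measurableT (gpdf u) (tame1_integrable (th2 u)).
  by under [X in _ -> integrable _ _ X]eq_fun do rewrite -mulrA mulrCA EFinM.
transitivity (\int[mu]_t \int[mu]_u (h t u * gpdf u * gpdf t)).
  apply: eq_Rintegral => t _; rewrite gauss_expE -RintegralZr //.
  exact: tame1_integrable.
transitivity (\int[mu]_u \int[mu]_t (h t u * gpdf u * gpdf t)); last first.
  apply: eq_Rintegral => t _; rewrite gauss_expE -RintegralZr //; last first.
    exact: tame1_integrable.
  by apply: eq_Rintegral => u _; rewrite mulrAC.
apply: Rintegral_swap => //.
  apply: measurable_funM; last by apply: measurableT_comp => //; exact: measurable_gpdf.
  apply: measurable_funM => //; apply: measurableT_comp => //; exact: measurable_gpdf.
pose e (u : R) := expR (m * `|u|).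
have te : tame1 e by exact: tame1_expR.
apply: (@le_lt_trans _ _ (\int[mu]_t (C * gauss_exp e * (e t * gpdf t))%:E)%E).
  apply: ge0_le_integral => //.
  - by move=> t _; apply: integral_ge0.
  - apply: (@measurable_fun_fubini_tonelli_F _ _ (measurableTypeR R) (measurableTypeR R) R mu (fun p => `|h p.1 p.2 * gpdf p.2 * gpdf p.1|%:E)%E) => //.
    apply/measurable_EFinP; apply: measurableT_comp => //.
    apply: measurable_funM; last by apply: measurableT_comp => //; exact: measurable_gpdf.
    apply: measurable_funM => //; apply: measurableT_comp => //; exact: measurable_gpdf.
  - apply/measurable_EFinP; apply: measurable_funM => //.
    by apply: measurable_funM; [exact: te.1|exact: measurable_gpdf].
  move=> t _.
  have -> : (C * gauss_exp e * (e t * gpdf t))%:E = (\int[mu]_u (C * (e t * gpdf t) * (e u * gpdf u))%:E)%E.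
    rewrite mulrAC EFinM gauss_expE /Rintegral fineK; last first.
      by apply: integrable_fin_num => //; exact: tame1_integrable.
    rewrite -integralZl //; exact: tame1_integrable.
  apply: ge0_le_integral => //.
  - by apply/measurable_EFinP; apply: measurableT_comp => //; apply/measurable_EFinP; exact: measurable_int (iE t).
  - apply/measurable_EFinP; apply: measurable_funM => //.
    by apply: measurable_funM; [exact: te.1|exact: measurable_gpdf].
  move=> u _; rewrite lee_fin 2!normrM !(ger0_norm (ltW (gpdf_gt0 _))).
  rewrite (_ : C * _ * _ = C * e t * e u * gpdf u * gpdf t); last by ring.
  by rewrite !ler_pM2r ?gpdf_gt0.
apply: integrable_lty => //.
have := integrableZl measurableT (C * gauss_exp e) (tame1_integrable te).
by [].
Qed.

Lemma integral_gpdf_affine k b : 0 < k ->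
  (\int[mu]_t (k * gpdf (k * t - b))%:E = 1)%E.
Proof.
move=> k0; have := ge0_integral_affine (f := fun t => (gpdf t)%:E) (- b) k0.
have mg : measurable_fun setT (fun t => (gpdf t)%:E).
  by apply/measurable_EFinP; exact: measurable_gpdf.
move=> /(_ mg (fun t => ltW (gpdf_gt0 t))) E.
under eq_integral do rewrite EFinM.
rewrite ge0_integralZl_EFin ?ltW //.
- rewrite -E; have := @integral_normal_pdf R 0 1.
  by under eq_integral do rewrite -gpdfB_normal subr0.
- by move=> t _; rewrite lee_fin ltW // gpdf_gt0.
- by apply: (measurableT_comp mg); exact: measurable_affine.
Qed.

Lemma integrable_gpdf_affine k b : 0 < k ->
  mu.-integrable setT (fun t => (k * gpdf (k * t - b))%:E).
Proof.
move=> k0; apply/integrableP; split.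
  apply/measurable_EFinP; apply: measurable_funM => //.
  by apply: measurableT_comp; [exact: measurable_gpdf|exact: measurable_affine].
under eq_integral => t _.
  rewrite /= ger0_norm; last by rewrite mulr_ge0 // ltW // gpdf_gt0.
  over.
by rewrite integral_gpdf_affine // ltry.
Qed.

(* Density form of the rotation invariance of the standard Gaussian on the plane. *)
Lemma gpdf_rot t u s s' c : 0 < s -> 0 < s' -> c ^+ 2 = s ^+ 2 + s' ^+ 2 ->
  gpdf (c / s' * u - s / s' * t) * gpdf t = gpdf u * gpdf (c / s' * t - s / s' * u).
Proof.
move=> s0 s'0 cE; rewrite /gpdf mulrACA [RHS]mulrACA; congr (_ * _).
rewrite -!expRD; congr expR.
have -> : (c / s' * u - s / s' * t) ^+ 2 = (c ^+ 2 * u ^+ 2 - 2 * c * s * u * t + s ^+ 2 * t ^+ 2) / s' ^+ 2.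
  by field; rewrite gt_eqF.
have -> : (c / s' * t - s / s' * u) ^+ 2 = (c ^+ 2 * t ^+ 2 - 2 * c * s * u * t + s ^+ 2 * u ^+ 2) / s' ^+ 2.
  by field; rewrite gt_eqF.
by rewrite cE; field; rewrite gt_eqF.
Qed.

Lemma gauss_exp_conv h s s' c : 0 < s -> 0 < s' -> 0 < c ->
  c ^+ 2 = s ^+ 2 + s' ^+ 2 -> tame1 h ->
  gauss_exp (fun t => gauss_exp (fun u => h (s * t + s' * u))) =
  gauss_exp (fun u => h (c * u)).
Proof.
move=> s0 s'0 c0 cE th; have mh := th.1.
have thc : tame1 (fun u => h (c * u)).
  have := tame1_affine c 0 th; congr tame1; apply/funext => u; by rewrite addr0.
pose k := c / s'; have k0 : 0 < k by rewrite divr_gt0.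
(* Substituting [k * u - s / s' * t] for the inner variable turns [s * t + s' * _] into [c * u]. The
   rotation identity rewrites the joint density as [F], in which [t] occurs only through a density
   of total mass one. *)
pose F u t := k * (h (c * u) * gpdf u) * gpdf (k * t - s / s' * u).
have FE u t : F u t = k * h (c * u) * gpdf (k * u - s / s' * t) * gpdf t.
  rewrite -[RHS]mulrA (gpdf_rot t u s0 s'0 cE) /F -/k; ring.
have ma (x y : R) : measurable_fun setT (fun p : R * R => x * p.2 - y * p.1).
  by apply: measurable_funB; apply: measurable_funM.
have mF : measurable_fun setT (fun p : R * R => F p.1 p.2).
  apply: measurable_funM; last by apply: measurableT_comp; [exact: measurable_gpdf|exact: ma].
  apply: measurable_funM => //; apply: measurable_funM.
    by apply: (measurableT_comp mh); apply: measurable_funM.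
  by apply: measurableT_comp => //; exact: measurable_gpdf.
have gle x : gpdf x <= gpdf 0.
  rewrite /gpdf ler_pM2r ?invr_gt0 // ler_expR ler_pM2r // expr0n /= oppr0.
  by rewrite oppr_le0 sqr_ge0.
have iFt u : mu.-integrable setT (fun t => (F u t)%:E).
  have i1 := integrableZl measurableT (`|k * h (c * u)| * gpdf 0) (tame1_integrable (tame1_cst 1)).
  apply: (le_integrable _ _ _ i1) => //.
    by apply/measurable_EFinP; exact: (measurable_fun_pair2 u mF).
  move=> t _; rewrite FE /= lee_fin 2!normrM !(ger0_norm (ltW (gpdf_gt0 _))) mul1r.
  rewrite [leRHS]ger0_norm; last by rewrite mulr_ge0 // ?mulr_ge0 // ltW // gpdf_gt0.
  by rewrite ler_pM2r ?gpdf_gt0 // ler_wpM2l.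
have iFu t : mu.-integrable setT (fun u => (F u t)%:E).
  have i1 := integrableZl measurableT (k * gpdf 0) (tame1_integrable thc).
  apply: (le_integrable _ _ _ i1) => //.
    by apply/measurable_EFinP; exact: (measurable_fun_pair1 t mF).
  move=> u _; have -> : F u t = k * gpdf (k * t - s / s' * u) * (h (c * u) * gpdf u).
    by rewrite /F; ring.
  rewrite /= lee_fin [leLHS]normrM [leRHS]normrM ler_wpM2r //.
  rewrite !ger0_norm ?(mulr_ge0 (ltW k0) (ltW (gpdf_gt0 _))) //.
  by rewrite ler_wpM2l // ltW.
have ltF : (\int[mu]_u \int[mu]_t `|F u t|%:E < +oo)%E.
  have E u : (\int[mu]_t `|F u t|%:E = `|h (c * u) * gpdf u|%:E)%E.
    rewrite -[RHS]mule1 -(integral_gpdf_affine (s / s' * u) k0) -ge0_integralZl_EFin //.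
    - apply: eq_integral => t _; rewrite -EFinM; congr EFin.
      rewrite /F normrM (ger0_norm (ltW (gpdf_gt0 _))) normrM (gtr0_norm k0).
      by rewrite [RHS]mulrA (mulrC k).
    - by move=> t _; rewrite lee_fin mulr_ge0 // ltW // gpdf_gt0.
    - by have /integrableP[] := integrable_gpdf_affine (s / s' * u) k0.
  under eq_integral do rewrite E.
  by have /integrableP[] := tame1_integrable thc.
transitivity (\int[mu]_t \int[mu]_u F u t).
  apply: eq_Rintegral => t _; rewrite gauss_expE -RintegralZr //; last first.
    have := tame1_integrable (tame1_affine s' (s * t) th).
    by under eq_fun do rewrite addrC.
  rewrite (Rintegral_affine (- (s / s' * t)) k0); last first.
    apply: measurable_funM => //; apply: measurable_funM; last exact: measurable_gpdf.
    apply: (measurableT_comp mh); apply: measurable_funD => //.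
  apply: eq_Rintegral => u _; rewrite FE -/(gpdf t).
  have -> : s * t + s' * (k * u + - (s / s' * t)) = c * u.
    by rewrite /k; field; rewrite gt_eqF.
  by rewrite !mulrA.
rewrite -(Rintegral_swap mF) //.
apply: eq_Rintegral => u _; rewrite /F.
transitivity (h (c * u) * gpdf u * \int[mu]_t (k * gpdf (k * t - s / s' * u))).
  rewrite -RintegralZl //; first by apply: eq_Rintegral => t _; ring.
  exact: integrable_gpdf_affine.
by rewrite /Rintegral integral_gpdf_affine /= ?mulr1.
Qed.
End Gauss1D.

(** * Taylor estimates for the exponential; mean and variance of the standard Gaussian *)

Section GaussMoments.
Variable R : realType.
Implicit Types (x t a : R).

(** From index 3 on, each term of the series is at most [|x| ^+ 3] times a term of the series of
    [expR |x|], since [(i + 3)!] is at least [i!]. *)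
Lemma expR_taylor2 x :
  `|expR x - (1 + x + x ^+ 2 / 2)| <= `|x| ^+ 3 * expR `|x|.
Proof.
have c := is_cvg_series_exp_coeff x; rewrite -/(expR x) in c.
have c' : (fun N => `|series (exp_coeff x) (N + 3)%N - (1 + x + x ^+ 2 / 2)|) @ \oo
    --> `|expR x - (1 + x + x ^+ 2 / 2)|.
  by apply: cvg_norm; apply: cvgB; [rewrite cvg_shiftn; exact: c|exact: cvg_cst].
apply: (cvgr_to_le c'); apply: nearW => N.
have E3 (y : R) : series (exp_coeff y) (N + 3)%N = 1 + y + y ^+ 2 / 2 + \sum_(0 <= i < N) exp_coeff y (i + 3)%N.
  rewrite /series /= addnC (@big_cat_nat _ _ _ 3) //= ?leq_addr //.
  rewrite 3?big_nat_recr //= big_geq //= /exp_coeff /= add0r expr0 expr1 !divr1.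
  congr (_ + _ + _); rewrite [in LHS](_ : 3%N = (0 + 3)%N) // big_addn addnC addnK.
  by apply: eq_bigr => i _; rewrite addnC.
rewrite E3 addrC addKr.
apply: (le_trans (ler_norm_sum _ _ _)).
apply: (@le_trans _ _ (`|x| ^+ 3 * series (exp_coeff `|x|) N)); last first.
  rewrite ler_wpM2l ?exprn_ge0 //; apply: nondecreasing_cvgn_le.
    by apply: nondecreasing_series => i _ _; exact: exp_coeff_ge0.
  exact: is_cvg_series_exp_coeff.
rewrite /series /= mulr_sumr; apply: ler_sum => i _.
rewrite /exp_coeff /= normrM normrX exprD (mulrC (`|x| ^+ i)).
rewrite -!mulrA !ler_wpM2l ?exprn_ge0 //.
rewrite ger0_norm ?invr_ge0 // lef_pV2 ?posrE ?ltr0n ?fact_gt0 // ler_nat.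
by rewrite leq_fact // leq_addr.
Qed.

Lemma gauss_exp_mgf a : gauss_exp (fun t => expR (a * t - a ^+ 2 / 2)) = 1.
Proof.
have := gauss_exp_shift a (@measurable_cst _ _ R R setT 1).
rewrite gauss_exp_cst => E; rewrite [RHS]E; congr gauss_exp; apply/funext => t.
by rewrite mul1r.
Qed.

(** The small parameter is [th]: [l] is of first order and [q] of second order. The quadratic part
    is therefore [l ^+ 2 / 2 - q], and [q ^+ 2 / 2 - l * q] joins the remainder of order
    [th ^+ 3]. *)
Lemma expR_expand (l q th b : R) : 0 <= th <= 1 -> 0 <= b -> `|l| <= th * b ->
  0 <= q <= th ^+ 2 / 2 ->
  `|expR (l - q) - (1 + l + (l ^+ 2 / 2 - q))| <= th ^+ 3 * (2 * (1 + b) ^+ 3 * expR (1 + b)).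
Proof.
move=> /andP[th0 th1] b0 lb /andP[q0 qb].
have th2 : th ^+ 2 <= th by rewrite expr2 ler_piMr.
have th3 : 0 <= th ^+ 3 by rewrite exprn_ge0.
have qb' : `|q| <= th ^+ 2 / 2 by rewrite ger0_norm.
have Qb : `|l - q| <= th * (1 + b).
  rewrite (le_trans (ler_normB _ _)) // mulrDr mulr1 addrC lerD //.
  rewrite (le_trans qb') //; lra.
have e1 : 1 <= expR (1 + b).
  by rewrite (le_trans _ (expR_ge1Dx _)) // lerDl addr_ge0.
have -> : expR (l - q) - (1 + l + (l ^+ 2 / 2 - q)) =
  (expR (l - q) - (1 + (l - q) + (l - q) ^+ 2 / 2)) + (q ^+ 2 / 2 - l * q) by field.
rewrite (le_trans (ler_normD _ _)) //.
have -> : th ^+ 3 * (2 * (1 + b) ^+ 3 * expR (1 + b)) =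
  (th * (1 + b)) ^+ 3 * expR (1 + b) + th ^+ 3 * (1 + b) ^+ 3 * expR (1 + b) by ring.
apply: lerD.
  rewrite (le_trans (expR_taylor2 _)) // ler_pM ?exprn_ge0 ?expR_ge0 //.
    by rewrite ler_pXn2r // nnegrE mulr_ge0 // addr_ge0.
  by rewrite ler_expR (le_trans Qb) // ler_piMl // addr_ge0.
apply: (@le_trans _ _ (th ^+ 3 * (1 + b))); last first.
  rewrite -mulrA ler_wpM2l // -[leLHS]mulr1 ler_pM ?addr_ge0 //.
  by rewrite -[leLHS]expr1 ler_weXn2l // lerDl.
rewrite (le_trans (ler_normB _ _)) // mulrDr mulr1 lerD //.
  rewrite normrM normrX (@ger0_norm _ (2^-1)) //.
  have : `|q| ^+ 2 <= (th ^+ 2 / 2) ^+ 2.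
    by rewrite ler_pXn2r // nnegrE // (le_trans (normr_ge0 q)).
  have : th ^+ 2 * th ^+ 2 <= th ^+ 2 * th by rewrite ler_wpM2l // exprn_ge0.
  rewrite (_ : (th ^+ 2 / 2) ^+ 2 = th ^+ 2 * th ^+ 2 / 4); last by field.
  rewrite (_ : th ^+ 3 = th ^+ 2 * th); last by ring.
  have : 0 <= th ^+ 2 * th by rewrite mulr_ge0 // exprn_ge0.
  move: (th ^+ 2 * th) (th ^+ 2 * th ^+ 2) => A B *; lra.
rewrite normrM (le_trans (ler_pM _ _ lb qb')) //.
have : 0 <= th ^+ 3 * b by rewrite mulr_ge0.
rewrite (_ : th * b * (th ^+ 2 / 2) = th ^+ 3 * b / 2); last by field.
move: (th ^+ 3 * b) => A *; lra.
Qed.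

Lemma tame1X h n : tame1 h -> tame1 (fun t : R => h t ^+ n).
Proof.
move=> th; elim: n => [|n IH]; first exact: tame1_cst.
have := tame1M th IH; congr tame1; apply/funext => t; by rewrite exprS.
Qed.

Lemma tame1_norm h : tame1 h -> tame1 (fun t : R => `|h t|).
Proof.
move=> [mh [C [m [C0 m0 hC]]]]; split; first exact: measurableT_comp.
by exists C, m; split => // t; rewrite normr_id.
Qed.

Lemma tame1_expRaff (a b : R) : tame1 (fun t => expR (a * t - b)).
Proof.
split.
  by apply: measurableT_comp => //; apply: measurable_funB => //; apply: measurable_funM.
exists (expR (- b)), `|a|; split; rewrite ?expR_ge0 // => t.
rewrite ger0_norm ?expR_ge0 // -expRD ler_expR addrC lerD2l -normrM ler_norm //.
Qed.

(* [X + Y] and [sqrt 2 * X] have the same law, so [2 m = sqrt 2 * m]. *)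
Lemma gauss_exp_mean : gauss_exp (fun t : R => t) = 0.
Proof.
have t0 := @tame1_id R; set m := gauss_exp _.
have s20 : 0 < Num.sqrt 2 :> R by rewrite sqrtr_gt0.
have e : gauss_exp (fun t => gauss_exp (fun u : R => 1 * t + 1 * u)) = m + m.
  transitivity (gauss_exp (fun t => t + m)); last first.
    by rewrite gauss_expD ?gauss_exp_cst //; exact: tame1_cst.
  congr gauss_exp; apply/funext => t; transitivity (gauss_exp (fun u => t + u)).
    by congr gauss_exp; apply/funext => u; rewrite !mul1r.
  by rewrite gauss_expD ?gauss_exp_cst //; exact: tame1_cst.
have s2 : Num.sqrt 2 < 2 :> R.
  by rewrite -[ltRHS]gtr0_norm // -sqrtr_sqr ltr_sqrt ?exprn_gt0 // expr2; lra.
move: e; rewrite (gauss_exp_conv (c := Num.sqrt 2) ltr01 ltr01 s20 _ t0); last first.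
  by rewrite sqr_sqrtr // expr1n.
rewrite gauss_expZ // -/m => E; apply/eqP.
have /eqP : (2 - Num.sqrt 2) * m = 0 by rewrite mulrBl E; ring.
by rewrite mulf_eq0 subr_eq0 gt_eqF.
Qed.

(* Second order comparison of the moment generating function with its value [1]
   at [a * t - a ^+ 2 / 2], as [a] tends to [0]. *)
Lemma gauss_exp_sqr : gauss_exp (fun t : R => t ^+ 2) = 1.
Proof.
set V := gauss_exp _.
pose k t : R := 2 * (1 + `|t|) ^+ 3 * expR (1 + `|t|).
pose c : R := gauss_exp k.
have tk : tame1 k.
  have t1 : tame1 (fun t : R => 1 + `|t|).
    by apply: tame1D; [exact: tame1_cst|exact: tame1_norm (@tame1_id R)].
  apply: tame1M; first by apply: tame1M; [exact: tame1_cst|exact: tame1X].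
  have := tame1M (tame1_cst (expR 1 : R)) (tame1_expR (1 : R)); congr tame1.
  by apply/funext => t; rewrite mul1r expRD.
have tsq : tame1 (fun t : R => t ^+ 2) := tame1X 2 (@tame1_id R).
have bnd a : 0 < a <= 1 -> `|V - 1| <= a * (2 * c).
  move=> /andP[a0 a1].
  pose P t := 1 - a ^+ 2 / 2 + (a * t + a ^+ 2 / 2 * t ^+ 2).
  have tZ b h : tame1 h -> tame1 (fun t => b * h t) by apply: tame1M; exact: tame1_cst.
  have tL : tame1 (fun t => a * t + a ^+ 2 / 2 * t ^+ 2).
    by apply: tame1D; apply: tZ => //; exact: tame1_id.
  have tP : tame1 P by apply: tame1D => //; exact: tame1_cst.
  (* The linear term vanishes with the mean, so [V - 1] appears at order [a ^+ 2] against an error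
     of order [a ^+ 3]; dividing leaves [2 * c * a]. *)
  have EP : gauss_exp P = 1 + a ^+ 2 / 2 * (V - 1).
    rewrite gauss_expD //; last exact: tame1_cst.
    rewrite gauss_exp_cst gauss_expD; [|by apply: tZ; exact: tame1_id|exact: tZ].
    rewrite gauss_expZ; last exact: tame1_id.
    rewrite gauss_expZ // gauss_exp_mean -/V; ring.
  have tc : tame1 (fun t => a ^+ 3 * k t) by exact: tZ.
  have ta : tame1 (fun t => expR (a * t - a ^+ 2 / 2)) by exact: tame1_expRaff.
  have key t : `|expR (a * t - a ^+ 2 / 2) - P t| <= a ^+ 3 * k t.
    have := @expR_expand (a * t) (a ^+ 2 / 2) a `|t|.
    rewrite (ltW a0) a1 normrM (gtr0_norm a0) !lexx andbT => /(_ isT (normr_ge0 t) isT).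
    rewrite divr_ge0 ?sqr_ge0 // => /(_ isT); congr (`|_ - _| <= _).
    by rewrite /P; field.
  have le1 : gauss_exp P - a ^+ 3 * c <= 1.
    rewrite -(gauss_exp_mgf a) lerBlDr /c -gauss_expZ // -gauss_expD //.
    apply: le_gauss_exp => //; first exact: tame1D.
    by move=> t; have := key t; rewrite ler_distlC => /andP[? ?]; lra.
  have le2 : 1 <= gauss_exp P + a ^+ 3 * c.
    rewrite -(gauss_exp_mgf a) /c -gauss_expZ // -gauss_expD //.
    apply: le_gauss_exp => //; first exact: tame1D.
    by move=> t; have := key t; rewrite ler_distlC => /andP[? ?]; lra.
  rewrite -(@ler_pM2l _ (a ^+ 2 / 2)) ?divr_gt0 ?exprn_gt0 //.
  rewrite -[X in X * `|_|]ger0_norm ?divr_ge0 ?sqr_ge0 // -normrM.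
  rewrite (_ : a ^+ 2 / 2 * (a * (2 * c)) = a ^+ 3 * c); last by field.
  by rewrite ler_norml; move: le1 le2; rewrite EP => ? ?; apply/andP; split; lra.
have c0 : 0 <= c.
  by have := bnd 1; rewrite ltr01 lexx mul1r => /(_ isT) /(le_trans (normr_ge0 _)); lra.
apply/eqP; rewrite -subr_eq0 -normr_le0; apply/ler_addgt0Pl => e e0; rewrite addr0.
pose a := Num.min 1 (e / (2 * c + 1)).
have a0 : 0 < a by rewrite lt_min ltr01 divr_gt0 // ltr_wpDl // mulr_ge0.
apply: (le_trans (bnd a _)); first by rewrite a0 ge_min lexx.
apply: (@le_trans _ _ (e / (2 * c + 1) * (2 * c))).
  by rewrite ler_wpM2r ?mulr_ge0 // ge_min lexx orbT.
by rewrite mulrAC ler_pdivrMr ?ltr_wpDl ?mulr_ge0 // ler_pM2l // lerDl.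
Qed.
End GaussMoments.

(** * Tame functions of finitely many variables and iterated Gaussian expectations *)

Section Tame.
Variables (R : realType) (T : finType).
Implicit Types (g h : (T -> R) -> R) (x y : T -> R) (v w : T).

(* [T -> R] carries no sigma-algebra here, so measurability of [g] is expressed by
   composition with random vectors. *)
Definition mble g := forall d (Om : measurableType d) (X : Om -> T -> R),
  (forall v, measurable_fun setT (X ^~ v)) ->
  measurable_fun setT (fun o => g (X o)).

Definition tame g := mble g /\ exists C m : R,
  [/\ 0 <= C, 0 <= m & forall x, `|g x| <= C * expR (m * \sum_v `|x v|)].

Lemma mble_comp (I : finType) (g : (I -> R) -> R) (X : I -> (T -> R) -> R) :
  (forall d (Om : measurableType d) (Y : Om -> I -> R),
    (forall i, measurable_fun setT (Y ^~ i)) ->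
    measurable_fun setT (fun o => g (Y o))) ->
  (forall i, mble (X i)) -> mble (fun x => g (fun i => X i x)).
Proof. by move=> mg mX d Om Y mY; apply: mg => i; exact: mX. Qed.

Lemma mble_var v : mble (fun x => x v).
Proof. by move=> d Om X; exact. Qed.

Lemma mble_comp1 (f : R -> R) g : measurable_fun setT f -> mble g ->
  mble (fun x => f (g x)).
Proof. by move=> mf mg d Om X mX; apply: (measurableT_comp mf); exact: mg. Qed.

Lemma mbleD g h : mble g -> mble h -> mble (fun x => g x + h x).
Proof. by move=> mg mh d Om X mX; apply: measurable_funD; [exact: mg|exact: mh]. Qed.

Lemma tame_dom g h : mble g -> tame h -> (forall x, `|g x| <= h x) -> tame g.
Proof.
move=> mg [_ [C [m [C0 m0 hC]]]] gh; split => //; exists C, m; split => // x.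
by rewrite (le_trans (gh x)) // (le_trans (ler_norm _)).
Qed.

Lemma tame_cst (k : R) : tame (fun=> k).
Proof.
split; first by move=> *; exact: measurable_cst.
by exists `|k|, 0; split => // x; rewrite mul0r expR0 mulr1.
Qed.

Lemma tame_var v : tame (fun x => x v).
Proof.
split; first exact: mble_var.
exists 1, 1; split => // x; rewrite !mul1r (bigD1 v) //=.
rewrite (le_trans _ (expR_ge1Dx _)) // addrCA lerDl addr_ge0 //.
exact: sumr_ge0.
Qed.

Lemma tameD g h : tame g -> tame h -> tame (fun x => g x + h x).
Proof.
move=> [mg [C [m [C0 m0 hC]]]] [mh [C' [m' [C0' m0' hC']]]]; split.
  exact: mbleD.
exists (C + C'), (m + m'); split; rewrite ?addr_ge0 // => x.
have s0 : 0 <= \sum_v `|x v| by exact: sumr_ge0.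
rewrite (le_trans (ler_normD _ _)) // mulrDl lerD //.
  by rewrite (le_trans (hC x)) // ler_wpM2l // ler_expR ler_wpM2r // lerDl.
by rewrite (le_trans (hC' x)) // ler_wpM2l // ler_expR ler_wpM2r // lerDr.
Qed.

Lemma tameM g h : tame g -> tame h -> tame (fun x => g x * h x).
Proof.
move=> [mg [C [m [C0 m0 hC]]]] [mh [C' [m' [C0' m0' hC']]]]; split.
  by move=> d Om X mX; apply: measurable_funM; [exact: mg|exact: mh].
exists (C * C'), (m + m'); split; rewrite ?mulr_ge0 ?addr_ge0 // => x.
by rewrite normrM mulrDl expRD mulrACA ler_pM.
Qed.

Lemma tameZ k g : tame g -> tame (fun x => k * g x).
Proof. by apply: tameM; exact: tame_cst. Qed.

Lemma tameN g : tame g -> tame (fun x => - g x).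
Proof. by move=> /(tameZ (-1)); congr tame; apply/funext => x; rewrite mulN1r. Qed.

Lemma tameB g h : tame g -> tame h -> tame (fun x => g x - h x).
Proof. by move=> tg th; apply: tameD => //; exact: tameN. Qed.

Lemma tameX g n : tame g -> tame (fun x => g x ^+ n).
Proof.
move=> tg; elim: n => [|n IH]; first exact: tame_cst.
by have := tameM tg IH; congr tame; apply/funext => x; rewrite exprS.
Qed.

Lemma tame_norm g : tame g -> tame (fun x => `|g x|).
Proof.
move=> [mg [C [m [C0 m0 hC]]]]; split; first by apply: mble_comp1.
by exists C, m; split => // x; rewrite normr_id.
Qed.

Lemma tame_sum (I : Type) (s : seq I) (P : pred I) (G : I -> (T -> R) -> R) :
  (forall i, tame (G i)) -> tame (fun x => \sum_(i <- s | P i) G i x).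
Proof.
move=> tG; elim: s => [|i s IH].
  by have := tame_cst 0; congr tame; apply/funext => x; rewrite big_nil.
have := tameD (tG i) IH; case Pi : (P i) => t1.
  by move: t1; congr tame; apply/funext => x; rewrite big_cons Pi.
by move: IH; congr tame; apply/funext => x; rewrite big_cons Pi.
Qed.

Lemma tame_prod (I : Type) (s : seq I) (P : pred I) (G : I -> (T -> R) -> R) :
  (forall i, tame (G i)) -> tame (fun x => \prod_(i <- s | P i) G i x).
Proof.
move=> tG; elim: s => [|i s IH].
  by have := tame_cst 1; congr tame; apply/funext => x; rewrite big_nil.
have := tameM (tG i) IH; case Pi : (P i) => t1.
  by move: t1; congr tame; apply/funext => x; rewrite big_cons Pi.
by move: IH; congr tame; apply/funext => x; rewrite big_cons Pi.
Qed.

Definition upd x v (t : R) : T -> R := fun w => if w == v then t else x w.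

Lemma upd_same x v t t' : upd (upd x v t) v t' = upd x v t'.
Proof. by apply/funext => w; rewrite /upd; case: eqP. Qed.

Lemma upd_comm x v w t t' : v != w -> upd (upd x v t) w t' = upd (upd x w t') v t.
Proof.
move=> vw; apply/funext => u; rewrite /upd; case: eqVneq => [->|//].
by rewrite eq_sym (negbTE vw).
Qed.

Lemma sum_upd x v t : \sum_w `|upd x v t w| <= \sum_w `|x w| + `|t|.
Proof.
rewrite (bigD1 v) //= [in leRHS](bigD1 v) //= /upd eqxx addrC lerD2r.
rewrite [leRHS]addrC -[leLHS]addr0 lerD //.
by apply: ler_sum => w /negbTE ->.
Qed.

Lemma tame1_upd g x v (k : R) : tame g -> tame1 (fun t => g (upd x v (k * t))).
Proof.
move=> [mg [C [m [C0 m0 hC]]]]; split.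
  apply: mg => w; rewrite /upd; case: (_ == _); last exact: measurable_cst.
  exact: measurable_funM.
exists (C * expR (m * \sum_w `|x w|)), (m * `|k|); split.
- by rewrite mulr_ge0 ?expR_ge0.
- by rewrite mulr_ge0.
move=> t; rewrite (le_trans (hC _)) // -mulrA -expRD ler_wpM2l // ler_expR.
by rewrite -mulrA -mulrDr ler_wpM2l // -normrM sum_upd.
Qed.

Lemma tame_gauss g v (k : R) : tame g ->
  tame (fun x => gauss_exp (fun t => g (upd x v (k * t)))).
Proof.
move=> tg; have [mg [C [m [C0 m0 hC]]]] := tg; split.
  move=> d Om X mX.
  apply: (measurable_gauss_exp (h := fun p => g (upd (X p.1) v (k * p.2)))).
  apply: mg => w; rewrite /upd; case: (_ == _).
    exact: measurable_funM.
  by apply: (measurableT_comp (mX w)).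
pose e (t : R) := expR (m * `|k| * `|t|).
have te : tame1 e by exact: tame1_expR.
have e0 : 0 <= gauss_exp e.
  rewrite -(gauss_exp_cst 0); apply: le_gauss_exp => //; first exact: tame1_cst.
  by move=> t; exact: expR_ge0.
exists (C * gauss_exp e), m; split => //; first by rewrite mulr_ge0.
move=> x; have t1 := tame1_upd x v k tg.
pose D := C * expR (m * \sum_v `|x v|).
have tD : tame1 (fun t => D * e t) by apply: tame1M => //; exact: tame1_cst.
have key t : `|g (upd x v (k * t))| <= D * e t.
  rewrite (le_trans (hC _)) // -mulrA -expRD ler_wpM2l // ler_expR.
  by rewrite -mulrA -mulrDr ler_wpM2l // -normrM sum_upd.
rewrite mulrAC -/D -gauss_expZ // ler_norml; apply/andP; split.
  rewrite -mulN1r -gauss_expZ //; apply: le_gauss_exp => //.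
    by apply: tame1M => //; exact: tame1_cst.
  by move=> t; rewrite mulN1r lerNl; have := key t; rewrite ler_norml => /andP[]; rewrite lerNl.
apply: le_gauss_exp => // t; exact: le_trans (ler_norm _) (key t).
Qed.

Variable sd : T -> R.

Lemma iexp_cons v s g x :
  iexp_seq sd (v :: s) g x = gauss_exp (fun t => iexp_seq sd s g (upd x v (sd v * t))).
Proof. by []. Qed.

Lemma tame_iexp s g : tame g -> tame (iexp_seq sd s g).
Proof. by move=> tg; elim: s => [//|v s IH]; exact: tame_gauss. Qed.

Lemma iexpD s g h x : tame g -> tame h ->
  iexp_seq sd s (fun y => g y + h y) x = iexp_seq sd s g x + iexp_seq sd s h x.
Proof.
move=> tg th; elim: s x => [//|v s IH] x; rewrite !iexp_cons.
rewrite -gauss_expD; try by apply: tame1_upd; exact: tame_iexp.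
by congr gauss_exp; apply/funext => t; rewrite IH.
Qed.

Lemma iexpZ s k g x : tame g ->
  iexp_seq sd s (fun y => k * g y) x = k * iexp_seq sd s g x.
Proof.
move=> tg; elim: s x => [//|v s IH] x; rewrite !iexp_cons.
rewrite -gauss_expZ; try by apply: tame1_upd; exact: tame_iexp.
by congr gauss_exp; apply/funext => t; rewrite IH.
Qed.

Lemma le_iexp s g h x : tame g -> tame h -> (forall y, g y <= h y) ->
  iexp_seq sd s g x <= iexp_seq sd s h x.
Proof.
move=> tg th gh; elim: s x => [//|v s IH] x; rewrite !iexp_cons.
by apply: le_gauss_exp => [||t]; try by apply: tame1_upd; exact: tame_iexp.
Qed.

Definition nodep v g := forall x t, g (upd x v t) = g x.

Lemma nodep_iexp v s g : nodep v g -> nodep v (iexp_seq sd s g).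
Proof.
move=> ng; elim: s => [//|w s IH] x t; rewrite !iexp_cons.
congr gauss_exp; apply/funext => t'; have [->|vw] := eqVneq w v.
  by rewrite upd_same.
by rewrite upd_comm 1?eq_sym // IH.
Qed.

Lemma iexp_nodep s g x : (forall v, v \in s -> nodep v g) -> iexp_seq sd s g x = g x.
Proof.
elim: s x => [//|v s IH] x ng; rewrite iexp_cons.
have {}IH y : iexp_seq sd s g y = g y.
  by apply: IH => w ws; apply: ng; rewrite inE ws orbT.
under eq_fun do rewrite IH.
by under eq_fun do rewrite ng ?mem_head //; rewrite gauss_exp_cst.
Qed.

(** Independence, proved one coordinate at a time: at each integrated coordinate one of the two
    factors is constant and leaves the one-dimensional integral. *)
Lemma iexpM s g h x : tame g -> tame h ->
  (forall v, v \in s -> nodep v g \/ nodep v h) ->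
  iexp_seq sd s (fun y => g y * h y) x = iexp_seq sd s g x * iexp_seq sd s h x.
Proof.
move=> tg th; elim: s x => [//|v s IH] x ngh; rewrite !iexp_cons.
have {}IH y : iexp_seq sd s (fun y => g y * h y) y = iexp_seq sd s g y * iexp_seq sd s h y.
  by apply: IH => w ws; apply: ngh; rewrite inE ws orbT.
under eq_fun do rewrite IH.
have [ng|nh] := ngh v (mem_head _ _).
  under eq_fun do rewrite (nodep_iexp s ng).
  rewrite gauss_expZ; last by apply: tame1_upd; exact: tame_iexp.
  under [X in _ = gauss_exp X * _]eq_fun do rewrite (nodep_iexp s ng).
  by rewrite gauss_exp_cst.
under eq_fun do rewrite (nodep_iexp s nh) mulrC.
rewrite gauss_expZ; last by apply: tame1_upd; exact: tame_iexp.
under [X in _ = _ * gauss_exp X]eq_fun do rewrite (nodep_iexp s nh).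
by rewrite gauss_exp_cst mulrC.
Qed.

End Tame.

(** * Reindexing and substitution of coordinates *)

Section Embedding.
Variables (R : realType) (T U : finType) (f : T -> U) (p : U -> option T).
Hypothesis pP : forall u v, p u = Some v <-> u = f v.

(** [p] is the partial inverse of [f], and coordinates outside the image stay frozen at [z]. In this
    way a parameter is treated as a further coordinate over which no integral is taken, and tameness
    of parametrised integrals follows from [tame_iexp]. *)
Lemma iexp_emb (sd : U -> R) s (G : (U -> R) -> R) (z : U -> R) :
  iexp_seq sd (map f s) G z =
  iexp_seq (fun v => sd (f v)) s (fun y => G (fun u => oapp y (z u) (p u))) (fun v => z (f v)).
Proof.
elim: s z => [|v s IH] z.
  congr G; apply/funext => u; case pu : (p u) => [v|] //=.
  by move/pP : pu => ->.
rewrite map_cons !iexp_cons; congr gauss_exp; apply/funext => t; rewrite IH.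
congr iexp_seq.
  apply/funext => y; congr G; apply/funext => u; case pu : (p u) => [w|] //=.
  by rewrite /upd; case: eqP => // uE; move/pP: uE; rewrite pu.
apply/funext => w; rewrite /upd; congr (if _ then _ else _).
apply/eqP/eqP => [|->//] fE; have /pP : f w = f v by [].
by have /pP -> : f w = f w by []; case.
Qed.

(** Affine growth of the substituted coordinates only rescales the exponent of an exponential
    bound. *)
Lemma tame_subst (g : (U -> R) -> R) (X : U -> (T -> R) -> R) (a : R) :
  tame g -> (forall u, mble (X u)) -> 0 <= a ->
  (forall u x, `|X u x| <= a + a * \sum_v `|x v|) -> tame (fun x => g (X ^~ x)).
Proof.
move=> [mg [C [m [C0 m0 hC]]]] mX a0 Xa; split.
  by apply: mble_comp => // d Om Y mY; exact: mg.
exists (C * expR (m * (a *+ #|U|))), (m * (a *+ #|U|)); split.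
- by rewrite mulr_ge0 ?expR_ge0.
- by rewrite mulr_ge0 // mulrn_wge0.
move=> x; rewrite (le_trans (hC _)) // -mulrA -expRD ler_wpM2l // ler_expR.
rewrite -mulrA -mulrDr ler_wpM2l // (le_trans (ler_sum _ (fun u _ => Xa u x))) //.
by rewrite sumr_const mulrnDl mulrnAl.
Qed.
End Embedding.

(** * Exchanging a one-dimensional Gaussian integral with an iterated one *)

Section Swap.
Variables (R : realType) (T : finType).

Lemma sum_option (F : option T -> R) : \sum_w F w = F None + \sum_v F (Some v).
Proof.
rewrite -big_enum (perm_big (None :: map Some (enum T))); last first.
  apply: uniq_perm; first exact: enum_uniq.
    rewrite /= map_inj_uniq ?enum_uniq ?andbT; last by move=> u v [].
    by apply/mapP => -[].
  move=> [w|]; rewrite mem_enum !inE //=.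
  by rewrite mem_map ?mem_enum //; move=> u v [].
by rewrite big_cons big_map big_enum.
Qed.

(* The parameter of the family [H] is encoded as the extra coordinate [None]. *)
Definition tame2 (H : R -> (T -> R) -> R) :=
  tame (fun z : option T -> R => H (z None) (fun v => z (Some v))).

Lemma iexp_option (sd : T -> R) s (H : R -> (T -> R) -> R) (z : option T -> R) :
  iexp_seq (oapp sd 0) (map Some s) (fun z => H (z None) (fun v => z (Some v))) z =
  iexp_seq sd s (H (z None)) (fun v => z (Some v)).
Proof. by rewrite (iexp_emb (p := id)). Qed.

Lemma tame2_iexp (sd : T -> R) s H : tame2 H -> tame2 (fun t => iexp_seq sd s (H t)).
Proof.
move=> tH; have := tame_iexp (oapp sd 0) (map Some s) tH; congr tame.
by apply/funext => z; rewrite iexp_option.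
Qed.

Lemma iexp_gauss_swap (sd : T -> R) s (H : R -> (T -> R) -> R) x : tame2 H ->
  iexp_seq sd s (fun y => gauss_exp (fun t => H t y)) x =
  gauss_exp (fun t => iexp_seq sd s (H t) x).
Proof.
move=> tH; elim: s x => [//|v s IH] x; rewrite iexp_cons.
under eq_fun do rewrite IH.
have [mG [C [m [C0 m0 hC]]]] := tame2_iexp sd s tH.
pose z (t u : R) (w : option T) : R := oapp (upd x v (sd v * u)) t w.
pose m' := m * (1 + `|sd v|).
apply: (@gauss_exp_swap _ (fun u t => iexp_seq sd s (H t) (upd x v (sd v * u)))
  (C * expR (m * \sum_w `|x w|)) m').
- by rewrite mulr_ge0 ?expR_ge0.
- by rewrite mulr_ge0 // addr_ge0.
- apply: (mG _ _ (fun p : R * R => z p.2 p.1)) => -[w|] //=.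
  rewrite /upd; case: (_ == _); last exact: measurable_cst.
  exact: measurable_funM.
  exact: measurable_snd.
move=> u t; have := hC (z t u); rewrite /z /= => /le_trans; apply.
rewrite -!mulrA -!expRD ler_wpM2l // ler_expR.
rewrite -!mulrDr ler_wpM2l // sum_option /=.
have := sum_upd x v (sd v * u); rewrite normrM.
have := normr_ge0 u; have := normr_ge0 t; have := mulr_ge0 (normr_ge0 (sd v)) (normr_ge0 t).
rewrite !mulrDl !mul1r; lra.
Qed.
End Swap.

(** * Convolution, independence and shifts of Gaussian vectors *)

Section Gexp.
Variables (R : realType) (T : finType).
Implicit Types (g h : (T -> R) -> R) (x y : T -> R) (v w : T) (A B : T -> Prop).

Lemma tame_add h : tame h -> tame (fun z : T + T -> R => h (fun v => z (inl v) + z (inr v))).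
Proof.
move=> th; apply: (tame_subst (a := 1) (X := fun v (z : T + T -> R) => z (inl v) + z (inr v))) => //.
  by move=> u; apply: mbleD; exact: mble_var.
move=> u z; rewrite mul1r (bigD1 (inl u)) //= (bigD1 (inr u)) //=.
have := ler_normD (z (inl u)) (z (inr u)).
have : 0 <= \sum_(i | (i != inl u) && (i != inr u)) `|z i| by exact: sumr_ge0.
by move: (\sum_(i | _) _) => S *; lra.
Qed.

Lemma iexp_conv (sg ta c : T -> R) s h x x' : (forall v, 0 < sg v) -> (forall v, 0 <= ta v) ->
  (forall v, 0 < c v) -> (forall v, c v ^+ 2 = sg v ^+ 2 + ta v ^+ 2) -> tame h ->
  iexp_seq ta s (fun y' => iexp_seq sg s (fun y => h (fun v => y v + y' v)) x) x' =
  iexp_seq c s h (fun v => x v + x' v).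
Proof.
move=> sg0 ta0 c0 cE th.
elim: s x x' => [//|v s IH] x x'; rewrite !iexp_cons.
have tG := tame_iexp c s th.
(* The inner Gaussian at [v] has to pass all remaining [ta]-integrals before it stands next to the
   outer one and can be merged with it in dimension one. *)
transitivity (gauss_exp (fun t' => gauss_exp (fun t =>
    iexp_seq c s h (upd (fun v => x v + x' v) v (ta v * t' + sg v * t))))).
  congr gauss_exp; apply/funext => t'.
  rewrite (@iexp_gauss_swap _ _ ta s (fun t y' => iexp_seq sg s (fun y => h (fun v => y v + y' v)) (upd x v (sg v * t)))).
    congr gauss_exp; apply/funext => t; rewrite IH; congr iexp_seq.
    by apply/funext => w; rewrite /upd; case: eqP => // _; rewrite addrC.
  have tS := tame_add th.
  pose p (u : T + T) := if u is inl v then Some v else None.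
  have pP u v0 : p u = Some v0 <-> u = inl v0 by case: u => u /=; split => // -[->].
  have tI := tame_iexp (fun u => if u is inl v then sg v else 0) (map inl s) tS.
  pose X (u : T + T) (z : option T -> R) := match u with
    | inl w => upd x v (sg v * z None) w | inr w => z (Some w) end.
  have := @tame_subst _ _ _ _ X (1 + \sum_v `|x v| + `|sg v|) tI.
  rewrite /tame2 => tX; apply: (eq_ind _ _ (tX _ _ _)).
  - move=> [w|w] /=; last exact: mble_var.
    have -> : X (inl w) = fun z => if w == v then sg v * z None else x w by [].
    by case: (w == v); [exact: (tameZ (sg v) (tame_var _ None)).1|exact: (tame_cst _ (x w)).1].
  - by rewrite !addr_ge0 // sumr_ge0.
  - have sx0 : 0 <= \sum_v `|x v| by exact: sumr_ge0.
    move=> u z; have sz0 : 0 <= \sum_v `|z v| by exact: sumr_ge0.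
    have szw (w : option T) : `|z w| <= \sum_v `|z v| by rewrite (bigD1 w) //= lerDl sumr_ge0.
    have sxw w : `|x w| <= \sum_v `|x v| by rewrite (bigD1 w) //= lerDl sumr_ge0.
    have a1 : 0 <= (1 + \sum_v `|x v|) * \sum_v `|z v| by rewrite mulr_ge0 // addr_ge0.
    have a2 : 0 <= (\sum_v `|x v|) * \sum_v `|z v| by rewrite mulr_ge0.
    have a3 : 0 <= `|sg v| * \sum_v `|z v| by rewrite mulr_ge0.
    have a4 := normr_ge0 (sg v).
    case: u => w /=; last first.
      by have := szw (Some w); rewrite !mulrDl mul1r; lra.
    rewrite /upd; case: eqP => _.
      rewrite normrM; have := ler_wpM2l a4 (szw None).
      by rewrite !mulrDl mul1r; lra.
    have := sxw w; rewrite !mulrDl mul1r; lra.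
  by apply/funext => z; rewrite (iexp_emb pP).
(* The one-dimensional convolution requires positive deviations, while an added variance may be
   zero. *)
have [ta00|ta1] := eqVneq (ta v) 0.
  have -> : c v = sg v.
    apply/eqP; rewrite -(@eqrXn2 _ 2) ?ltW //; by rewrite cE ta00 expr0n addr0.
  under eq_fun do under eq_fun do rewrite ta00 mul0r add0r.
  exact: gauss_exp_cst.
apply: (gauss_exp_conv (h := fun t => iexp_seq c s h (upd (fun w => x w + x' w) v t))) => //.
- by rewrite lt_neqAle eq_sym ta1 ta0.
- by rewrite cE addrC.
have := tame1_upd (fun w => x w + x' w) v 1 tG.
by under eq_fun do rewrite mul1r.
Qed.

Lemma tameT h (a : T -> R) : tame h -> tame (fun y => h (fun v => y v + a v)).
Proof.
move=> [mh [C [m [C0 m0 hC]]]]; split.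
  by move=> d Om X mX; apply: mh => v; exact: measurable_funD.
exists (C * expR (m * \sum_v `|a v|)), m; split; rewrite ?mulr_ge0 ?expR_ge0 // => y.
rewrite (le_trans (hC _)) // -mulrA -expRD ler_wpM2l // ler_expR -mulrDr ler_wpM2l //.
by rewrite addrC -big_split /=; apply: ler_sum => v _; exact: ler_normD.
Qed.

Definition depends A g := forall x y, (forall v, A v -> x v = y v) -> g x = g y.

Lemma depends_sub A B g : (forall v, A v -> B v) -> depends A g -> depends B g.
Proof. by move=> AB gA x y xy; apply: gA => v /AB; exact: xy. Qed.

Lemma depends_nodep A g v : depends A g -> ~ A v -> nodep v g.
Proof.
move=> gA nA x t; apply: gA => w Aw; rewrite /upd; case: eqP => // wv.
by move: Aw; rewrite wv.
Qed.

Lemma dependsM A g h : depends A g -> depends A h -> depends A (fun x => g x * h x).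
Proof. by move=> gA hA x y xy; rewrite (gA _ _ xy) (hA _ _ xy). Qed.

Lemma dependsB A g h : depends A g -> depends A h -> depends A (fun x => g x - h x).
Proof. by move=> gA hA x y xy; rewrite (gA _ _ xy) (hA _ _ xy). Qed.

Lemma depends_cst A (k : R) : depends A (fun=> k).
Proof. by []. Qed.

Lemma depends_var A v : A v -> depends A (fun x => x v).
Proof. by move=> Av x y; exact. Qed.

Lemma depends_comp A (phi : R -> R) g : depends A g -> depends A (fun x => phi (g x)).
Proof. by move=> gA x y xy; rewrite (gA _ _ xy). Qed.

Variable sd : T -> R.
Notation E := (gexp sd).

Lemma gexpD g h : tame g -> tame h -> E (fun y => g y + h y) = E g + E h.
Proof. exact: iexpD. Qed.

Lemma gexpZ k g : tame g -> E (fun y => k * g y) = k * E g.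
Proof. exact: iexpZ. Qed.

Lemma le_gexp g h : tame g -> tame h -> (forall y, g y <= h y) -> E g <= E h.
Proof. exact: le_iexp. Qed.

Lemma gexp_cst k : E (fun=> k) = k.
Proof. exact: iexp_nodep. Qed.

Lemma gexpN g : tame g -> E (fun y => - g y) = - E g.
Proof.
by move=> tg; rewrite -mulN1r -gexpZ //; congr gexp; apply/funext => y; rewrite mulN1r.
Qed.

Lemma gexpB g h : tame g -> tame h -> E (fun y => g y - h y) = E g - E h.
Proof. by move=> tg th; rewrite gexpD ?gexpN //; exact: tameN. Qed.

Lemma gexp_ge0 g : tame g -> (forall y, 0 <= g y) -> 0 <= E g.
Proof. by move=> tg g0; rewrite -(gexp_cst 0); apply: le_gexp => //; exact: tame_cst. Qed.

Lemma gexp_norm g : tame g -> `|E g| <= E (fun y => `|g y|).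
Proof.
move=> tg; rewrite ler_norml; apply/andP; split.
  rewrite -gexpN; last exact: tame_norm.
  apply: le_gexp => // [|y]; first exact/tameN/tame_norm.
  by rewrite lerNl -normrN ler_norm.
by apply: le_gexp => // [|y]; [exact: tame_norm|exact: ler_norm].
Qed.

Lemma gexp_norm_le g h : tame g -> tame h -> (forall y, `|g y| <= h y) -> `|E g| <= E h.
Proof.
move=> tg th gh; rewrite (le_trans (gexp_norm tg)) //.
by apply: le_gexp => //; exact: tame_norm.
Qed.

Lemma gexp_sum (I : Type) (s : seq I) (P : pred I) (G : I -> (T -> R) -> R) :
  (forall i, tame (G i)) ->
  E (fun y => \sum_(i <- s | P i) G i y) = \sum_(i <- s | P i) E (G i).
Proof.
move=> tG; elim: s => [|i s IH].
  by rewrite big_nil; under eq_fun do rewrite big_nil; rewrite gexp_cst.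
rewrite big_cons; under eq_fun do rewrite big_cons.
by case: ifP => _ //; rewrite gexpD // ?IH //; exact: tame_sum.
Qed.

Lemma gexpM A B g h : tame g -> tame h -> depends A g -> depends B h ->
  (forall v, A v -> ~ B v) -> E (fun y => g y * h y) = E g * E h.
Proof.
move=> tg th gA hB AB; apply: iexpM => // v _.
have [Av|nA] := pselect (A v); last by left; exact: depends_nodep nA.
by right; apply: (depends_nodep hB); exact: AB.
Qed.

Lemma gexp_var v (f : R -> R) : E (fun y => f (y v)) = gauss_exp (fun t => f (sd v * t)).
Proof.
rewrite /gexp; have := mem_enum T v; have := enum_uniq T.
move: (fun=> 0) (enum T) => x s; rewrite [RHS](_ : _ = true) //.
elim: s x => [//|w s IH] x /= /andP[ws us]; rewrite inE.
have [vw _|vw /= vs] := eqVneq v w.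
  subst w.
  congr gauss_exp; apply/funext => t; rewrite iexp_nodep ?eqxx //.
  move=> u us' y t'; rewrite /upd; case: eqP => // vu.
  by move: us'; rewrite -vu (negbTE ws).
by under eq_fun do rewrite IH //; rewrite gauss_exp_cst.
Qed.

Lemma gexp_var_mean v : E (fun y => y v) = 0.
Proof.
rewrite (gexp_var v id) gauss_expZ; last exact: tame1_id.
by rewrite gauss_exp_mean mulr0.
Qed.

Lemma gexp_var_pow v n : E (fun y => y v ^+ n) = sd v ^+ n * gauss_exp (fun t : R => t ^+ n).
Proof.
rewrite (gexp_var v (fun t => t ^+ n)).
under eq_fun do rewrite exprMn.
rewrite gauss_expZ //; exact: tame1X (@tame1_id R).
Qed.

Lemma gexp_var_sqr v : E (fun y => y v ^+ 2) = sd v ^+ 2.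
Proof. by rewrite gexp_var_pow gauss_exp_sqr mulr1. Qed.

(** Likelihood ratio, at coordinate [v], of the Gaussian translated by [a v] to the original one of
    deviation [sd v]. *)
Let ew (a : T -> R) v y := expR (a v / sd v * (y v / sd v) - (a v / sd v) ^+ 2 / 2).

Lemma tame_ew (k b : R) v : tame (fun y => expR (k * y v - b)).
Proof.
split.
  move=> d Om X mX; apply: measurableT_comp => //; apply: measurable_funB => //.
  exact: measurable_funM.
exists (expR (- b)), `|k|; split; rewrite ?expR_ge0 // => y.
rewrite ger0_norm ?expR_ge0 // -expRD ler_expR addrC lerD2l.
rewrite (le_trans (ler_norm _)) // normrM ler_wpM2l // (bigD1 v) //= lerDl.
exact: sumr_ge0.
Qed.

Lemma iexp_agree s h x y : (forall v, v \notin s -> x v = y v) ->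
  iexp_seq sd s h x = iexp_seq sd s h y.
Proof.
elim: s x y => [|v s IH] x y xy; first by congr h; apply/funext => v; exact: xy.
rewrite !iexp_cons; congr gauss_exp; apply/funext => t; apply: IH => w ws.
by rewrite /upd; case: eqVneq => // wv; apply: xy; rewrite inE negb_or wv.
Qed.

(** Cameron--Martin formula in several coordinates. The induction needs a general base point,
    because the coordinates outside the list are translated as well. *)
Lemma gexp_shift (a : T -> R) h : (forall v, sd v != 0) -> tame h ->
  E (fun y => h (fun v => y v + a v)) = E (fun y => h y * \prod_v ew a v y).
Proof.
move=> sd0 th.
have te v : tame (ew a v).
  have := tame_ew (a v / sd v / sd v) ((a v / sd v) ^+ 2 / 2) v; congr tame.
  by apply/funext => y; rewrite /ew mulrAC -mulrA.
have gen s x : uniq s -> iexp_seq sd s (fun y => h (fun v => y v + a v)) x =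
    iexp_seq sd s (fun y => h y * \prod_(v <- s) ew a v y) (fun v => x v + a v).
  elim: s x => [|v s IH] x /=; first by rewrite big_nil mulr1.
  move=> /andP[vs us].
  pose G := iexp_seq sd s (fun y => h y * \prod_(w <- s) ew a w y).
  have tG : tame G by apply: tame_iexp; apply: tameM => //; exact: tame_prod.
  pose K t := G (upd (fun v => x v + a v) v (sd v * t)).
  have tK : tame1 K by exact: tame1_upd.
  transitivity (gauss_exp (fun t => K (t + a v / sd v))).
    congr gauss_exp; apply/funext => t; rewrite IH // /K /G; congr iexp_seq.
    apply/funext => w; rewrite /upd; case: eqP => // ->.
    by rewrite mulrDr mulrCA divff ?mulr1.
  rewrite gauss_exp_shift; last exact: tK.1.
  congr gauss_exp; apply/funext => t.
  transitivity (iexp_seq sd s (fun y => ew a v y * (h y * \prod_(w <- s) ew a w y))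
     (upd (fun v => x v + a v) v (sd v * t))).
    rewrite iexpM //; last 2 first.
    - by apply: tameM => //; exact: tame_prod.
    - move=> w ws; left=> y t'; rewrite /ew /upd; case: eqP => // vw.
      by move: vs; rewrite vw ws.
    rewrite mulrC; congr (_ * _); rewrite iexp_nodep.
      by rewrite /ew /upd eqxx (mulrC (sd v)) mulfK.
    move=> w ws y t'; rewrite /ew /upd; case: eqP => // vw.
    by move: vs; rewrite vw ws.
  by congr iexp_seq; apply/funext => y; rewrite big_cons mulrCA.
rewrite /gexp gen ?enum_uniq //; under eq_fun do rewrite big_enum.
set H := fun y => _.
by apply: iexp_agree => v; rewrite mem_enum.
Qed.

End Gexp.

Lemma gexp_conv (R : realType) (T : finType) (sg ta c : T -> R) h :
  (forall v, 0 < sg v) -> (forall v, 0 <= ta v) ->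
  (forall v, 0 < c v) -> (forall v, c v ^+ 2 = sg v ^+ 2 + ta v ^+ 2) -> tame h ->
  gexp ta (fun y' => gexp sg (fun y => h (fun v => y v + y' v))) = gexp c h.
Proof.
move=> sg0 ta0 c0 cE th; rewrite /gexp (iexp_conv _ _ _ sg0 ta0 c0 cE th).
by congr iexp_seq; apply/funext => v; rewrite addr0.
Qed.

(** * Pseudo-Lipschitz functions for the sum norm *)

Section PseudoLipschitz.
Variables (R : realType) (I : finType).
Implicit Types (x y w : I -> R).

Definition N1 x := \sum_s `|x s|.

Lemma N1_ge0 x : 0 <= N1 x.
Proof. exact: sumr_ge0. Qed.

Lemma N1D x y : N1 (fun s => x s + y s) <= N1 x + N1 y.
Proof. by rewrite -big_split; apply: ler_sum => s _; exact: ler_normD. Qed.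

Lemma le_N1 x s : `|x s| <= N1 x.
Proof. by rewrite /N1 (bigD1 s) //= lerDl sumr_ge0. Qed.

Lemma N1Z (a : R) x : 0 <= a -> N1 (fun s => a * x s) = a * N1 x.
Proof. by move=> a0; rewrite mulr_sumr; apply: eq_bigr => s _; rewrite normrM ger0_norm. Qed.

(** The sum norm dominates the Euclidean one, so a pseudo-Lipschitz function keeps its constant, and
    it splits over the coordinates in moment estimates. *)
Definition plip (C : R) (psi : (I -> R) -> R) := 0 <= C /\
  forall x y, `|psi x - psi y| <= C * (1 + N1 x + N1 y) * N1 (fun s => x s - y s).

Variables (C : R) (psi : (I -> R) -> R).
Hypothesis psiP : plip C psi.

Let fl (n : nat) (t : R) : R := (Num.floor (t * n.+1%:R))%:~R / n.+1%:R.

Let fl_dist n t : `|fl n t - t| <= n.+1%:R^-1.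
Proof.
have /andP[l1 l2] := floor_itv (t * n.+1%:R).
have n0 : (0 : R) < n.+1%:R by rewrite ltr0n.
rewrite distrC ger0_norm; last by rewrite subr_ge0 ler_pdivrMr.
rewrite lerBlDr -(ler_pM2r n0) mulrDl mulVf ?gt_eqF // divfK ?gt_eqF //.
by rewrite addrC; move: l2; rewrite intrD => /ltW.
Qed.

(** By continuity [psi] is the pointwise limit of its values at points rounded to the grid of mesh
    [1 / (n + 1)]. Each rounded function takes one value per cell, and there are countably many
    cells. *)
Lemma plip_mble : mble psi.
Proof.
move=> d Om X mX.
have [C0 hC] := psiP.
apply: (@measurable_fun_cvg _ _ _ _ (fun n o => psi (fun s => fl n (X o s)))).
  move=> n; have n0 : (0 : R) < n.+1%:R by rewrite ltr0n.
  move=> _ B mB; rewrite setTI.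
  pose F (k : {ffun I -> int}) : set Om := [set o | B (psi (fun s => (k s)%:~R / n.+1%:R))] `&`
    \bigcap_(s in [set: I]) [set o | (k s)%:~R <= X o s * n.+1%:R < (k s + 1)%:~R].
  rewrite (_ : _ @^-1` B = \bigcup_k F k); last first.
    apply/seteqP; split => o /=.
      move=> Bo; exists [ffun s => Num.floor (X o s * n.+1%:R)] => //; split => /=.
        by under eq_fun do rewrite ffunE.
      by move=> s _ /=; rewrite ffunE floor_itv.
    move=> [k _ [/= Bk Fk]]; rewrite (_ : (fun s => fl n (X o s)) = (fun s => (k s)%:~R / n.+1%:R)) //.
    by apply/funext => s; rewrite /fl (floor_def (Fk s Logic.I)).
  apply: countable_bigcupT_measurable; first exact: countableP.
  move=> k; apply: measurableI.
    by have [Bk|nBk] := pselect (B (psi (fun s => (k s)%:~R / n.+1%:R)));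
      [rewrite (_ : [set o | _] = setT)|rewrite (_ : [set o | _] = set0)] => //;
      apply/seteqP; split.
  apply: fin_bigcap_measurable => // s _.
  have mXn : measurable_fun setT (fun o => X o s * n.+1%:R) by exact: measurable_funM.
  have := mXn measurableT `[(k s)%:~R, (k s + 1)%:~R[%classic (measurable_itv _).
  by rewrite setTI; congr measurable; apply/seteqP; split => o /=; rewrite in_itv.
move=> o _; set x := X o; apply/cvgrPdist_le => e e0.
pose c := C * (1 + (N1 x + #|I|%:R) + N1 x) * #|I|%:R.
have c0 : 0 <= c by rewrite !mulr_ge0 ?addr_ge0 ?N1_ge0.
have ec : 0 < e / (c + 1) by rewrite divr_gt0 // ltr_wpDl.
near=> n.
have nb : n.+1%:R^-1 < e / (c + 1) by near: n; exact: (near_infty_natSinv_lt (PosNum ec)).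
have d1 : N1 (fun s => fl n (x s) - x s) <= #|I|%:R * n.+1%:R^-1.
  rewrite /N1 (le_trans (ler_sum _ (fun s _ => fl_dist n (x s)))) // sumr_const.
  by rewrite mulr_natl.
have d2 : N1 (fun s => fl n (x s) - x s) <= #|I|%:R.
  by rewrite (le_trans d1) // ler_piMr // invf_le1 ?ltr0n // ler1n.
have d3 : N1 (fun s => fl n (x s)) <= N1 x + #|I|%:R.
  apply: (le_trans _ (lerD (lexx _) d2)).
  by apply: (le_trans _ (N1D _ _)); rewrite le_eqVlt; apply/orP; left; apply/eqP;
    apply: eq_bigr => s _; rewrite addrC subrK.
rewrite distrC (le_trans (hC _ _)) //.
apply: (@le_trans _ _ (c * n.+1%:R^-1)).
  rewrite /c -mulrA -[leRHS]mulrA -[leRHS]mulrA ler_wpM2l // ler_pM ?N1_ge0 //.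
    by rewrite !addr_ge0 ?N1_ge0.
  by rewrite !lerD.
apply: (@le_trans _ _ (c * (e / (c + 1)))); first by rewrite ler_wpM2l // ltW.
by rewrite mulrA ler_pdivrMr ?ltr_wpDl // mulrC ler_pM2l // lerDl.
Unshelve. all: by end_near.
Qed.

Definition growth_cst := `|psi (fun=> 0)| + C.

Lemma growth_cst_ge0 : 0 <= growth_cst.
Proof. by rewrite addr_ge0 //; case: psiP. Qed.

Lemma plip_growth x : `|psi x| <= growth_cst * (1 + N1 x) ^+ 2.
Proof.
have [c0 hC] := psiP; have := hC x (fun=> 0).
have -> : N1 (fun=> 0 : R) = 0 by rewrite /N1 big1 // => s _; rewrite normr0.
have -> : (fun s => x s - 0) = x by apply/funext => s; rewrite subr0.
rewrite addr0 => h; have n0 := N1_ge0 x.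
have -> : psi x = psi (fun=> 0) + (psi x - psi (fun=> 0)) by rewrite addrC subrK.
rewrite (le_trans (ler_normD _ _)) // /growth_cst mulrDl lerD //.
  by rewrite ler_peMr // exprn_ege1 // lerDl.
by rewrite (le_trans h) // expr2 mulrA ler_wpM2l ?mulr_ge0 ?addr_ge0 // lerDr.
Qed.

Lemma tame_N1 : tame N1.
Proof. by apply: tame_sum => s; apply: tame_norm; exact: tame_var. Qed.

Lemma plip_tame : tame psi.
Proof.
apply: (tame_dom plip_mble _ plip_growth); apply: tameZ; apply: tameX.
by apply: tameD; [exact: tame_cst|exact: tame_N1].
Qed.

End PseudoLipschitz.

(** * Scaling and monotonicity in the standard deviations *)

Section Gexp2.
Variables (R : realType) (I : finType).
Implicit Types (x y w : I -> R) (sd : I -> R).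

(** Both expectations are read with the same standard Gaussians, so larger deviations give larger
    arguments in every coordinate. *)
Lemma le_gexp_sd sd (B : I -> R) h : tame h ->
  (forall x y, (forall v, `|x v| <= `|y v|) -> h x <= h y) ->
  (forall v, `|sd v| <= `|B v|) -> gexp sd h <= gexp B h.
Proof.
move=> th mono sB; rewrite /gexp.
suff gen s x y : (forall v, `|x v| <= `|y v|) -> iexp_seq sd s h x <= iexp_seq B s h y.
  exact: gen.
elim: s x y => [|v s IH] x y xy; first exact: mono.
rewrite !iexp_cons; apply: le_gauss_exp; try by apply: tame1_upd; exact: tame_iexp.
move=> t; apply: IH => w; rewrite /upd; case: eqP => // _.
by rewrite !normrM ler_wpM2r.
Qed.

Lemma gexp_scale (a : I -> R) sd h :
  gexp (fun v => a v * sd v) h = gexp sd (fun y => h (fun v => a v * y v)).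
Proof.
rewrite /gexp.
have gen s x : iexp_seq (fun v => a v * sd v) s h (fun v => a v * x v) =
    iexp_seq sd s (fun y => h (fun v => a v * y v)) x.
  elim: s x => [//|v s IH] x; rewrite !iexp_cons; congr gauss_exp; apply/funext => t.
  rewrite -IH; congr iexp_seq; apply/funext => w.
  by rewrite /upd; case: eqP => // ->; rewrite mulrA.
rewrite -gen; congr iexp_seq; apply/funext => v; by rewrite mulr0.
Qed.

Lemma tame_param sd (G : (I -> R) -> (I -> R) -> R) :
  tame (fun z : I + I -> R => G (fun s => z (inl s)) (fun s => z (inr s))) ->
  tame (fun w => gexp sd (fun y => G y w)).
Proof.
move=> tG; pose p (u : I + I) := if u is inl v then Some v else None.
have pP u v : p u = Some v <-> u = inl v by case: u => u /=; split => // -[->].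
have tI := tame_iexp (fun u => if u is inl v then sd v else 0) (map inl (enum I)) tG.
pose X (u : I + I) w : R := if u is inr s then w s else 0.
have := @tame_subst _ _ _ _ X 1 tI.
move=> tX; apply: (eq_ind _ _ (tX _ _ _)) => //.
- by case=> s; [exact: (tame_cst _ _).1|exact: mble_var].
- case=> s w; rewrite mul1r /=; last by rewrite (le_trans (le_N1 w s)) // lerDr.
  by rewrite normr0 addr_ge0 // sumr_ge0.
by apply/funext => w; rewrite (iexp_emb pP).
Qed.

End Gexp2.

Ltac nneg := repeat first [ assumption | exact: N1_ge0 | exact: normr_ge0
  | exact: expR_ge0 | exact: ler01 | exact: ler0n | apply: ltW; assumption
  | apply: exprn_ge0 | apply: sqr_ge0 | apply: addr_ge0 | apply: mulr_ge0
  | rewrite invr_ge0 ].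

(** * Gaussian smoothing of [psi] and its third-order Taylor estimate *)

Section Smoothing.
Variables (R : realType) (I : finType) (C : R) (psi : (I -> R) -> R).
Hypothesis psiP : plip C psi.
Implicit Types (x y w a sg : I -> R).

Definition Phi sg w : R := gexp sg (fun y => psi (fun s => y s + w s)).

(** Partial derivative of [Phi], with the differentiation carried by the Gaussian density (first
    Hermite weight). *)
Definition Phi1 sg s w : R :=
  gexp sg (fun y => psi (fun s => y s + w s) * (y s / sg s ^+ 2)).

(** Half of a second partial derivative of [Phi], again by a Hermite weight; the Taylor factor
    [1 / 2] is included. *)
Definition Phi2 sg s t w : R := gexp sg (fun y => psi (fun s => y s + w s) *
  ((y s / sg s ^+ 2 * (y t / sg t ^+ 2) - (s == t)%:R / sg s ^+ 2) / 2)).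

Let tpsi := plip_tame psiP.
Let c0 := growth_cst_ge0 psiP.

Lemma tame_psiT w : tame (fun y => psi (fun s => y s + w s)).
Proof. exact: tameT. Qed.

Lemma tame_N1poly n : tame (fun y : I -> R => (1 + N1 y) ^+ n).
Proof. by apply: tameX; apply: tameD; [exact: tame_cst|exact: tame_N1]. Qed.

Lemma psiT_growth w y : `|psi (fun s => y s + w s)| <=
  growth_cst C psi * (1 + N1 w) ^+ 2 * (1 + N1 y) ^+ 2.
Proof.
rewrite (le_trans (plip_growth psiP _)) // -mulrA ler_wpM2l // -exprMn.
rewrite ler_pXn2r ?nnegrE ?mulr_ge0 ?addr_ge0 ?N1_ge0 //.
have := N1D y w; have := N1_ge0 y; have := N1_ge0 w; move=> h1 h2 h3.
have := mulr_ge0 h1 h2; rewrite mulrDr mulrDl !mul1r mulr1; lra.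
Qed.

Lemma tame_psi_mul (p : (I -> R) -> R) w : tame p ->
  tame (fun y => psi (fun s => y s + w s) * p y).
Proof. by apply: tameM; exact: tame_psiT. Qed.

Lemma tame_smooth sg (p : (I -> R) -> R) : tame p ->
  tame (fun w => gexp sg (fun y => psi (fun s => y s + w s) * p y)).
Proof.
move=> tp; apply: (tame_param sg (G := fun y w => psi (fun s => y s + w s) * p y)).
apply: tameM.
  exact: tame_add tpsi.
apply: (tame_subst (a := 1) (X := fun s (z : I + I -> R) => z (inl s))) => //.
  by move=> u; exact: mble_var.
by move=> u z; rewrite mul1r (le_trans (le_N1 z (inl u))) // lerDr.
Qed.

Lemma smooth_growth sg (p : (I -> R) -> R) w : tame p ->
  `|gexp sg (fun y => psi (fun s => y s + w s) * p y)| <=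
  growth_cst C psi * (1 + N1 w) ^+ 2 * gexp sg (fun y => (1 + N1 y) ^+ 2 * `|p y|).
Proof.
move=> tp; rewrite -gexpZ; last first.
  by apply: tameM; [exact: tame_N1poly|exact: tame_norm].
apply: gexp_norm_le; first exact: tame_psi_mul.
  by apply: tameZ; apply: tameM; [exact: tame_N1poly|exact: tame_norm].
by move=> y; rewrite normrM mulrA ler_wpM2r // psiT_growth.
Qed.

Lemma PhiE sg w : Phi sg w = gexp sg (fun y => psi (fun s => y s + w s) * 1).
Proof. by congr gexp; apply/funext => y; rewrite mulr1. Qed.

Lemma tame_Phi2p sg s t : tame (fun y : I -> R =>
  (y s / sg s ^+ 2 * (y t / sg t ^+ 2) - (s == t)%:R / sg s ^+ 2) / 2).
Proof.
have tv u : tame (fun y : I -> R => y u / sg u ^+ 2).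
  by apply: tameM; [exact: tame_var|exact: tame_cst].
by apply: tameM; [apply: tameB; [exact: tameM|exact: tame_cst]|exact: tame_cst].
Qed.

Lemma tame_Phi1p sg s : tame (fun y : I -> R => y s / sg s ^+ 2).
Proof. by apply: tameM; [exact: tame_var|exact: tame_cst]. Qed.

(* The Taylor polynomial at [w] in direction [a], as one Gaussian expectation:
   by the shift formula [Phi sg (w + a)] is the same with [exp (l - q)] as weight. *)
Let l sg a y := \sum_s a s * (y s / sg s ^+ 2).
Let q sg a := \sum_s (a s / sg s) ^+ 2 / 2.

Lemma tame_l sg a : tame (l sg a).
Proof. by apply: tame_sum => s; apply: tameZ; exact: tame_Phi1p. Qed.

Lemma Phi_polyE sg w a :
  gexp sg (fun y => psi (fun s => y s + w s) * (1 + l sg a y + (l sg a y ^+ 2 / 2 - q sg a))) =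
  Phi sg w + \sum_s a s * Phi1 sg s w + \sum_s \sum_t a s * a t * Phi2 sg s t w.
Proof.
pose P w y := psi (fun s => y s + w s).
have tP : tame (P w) by exact: tame_psiT.
transitivity (gexp sg (fun y => P w y + \sum_s a s * (P w y * (y s / sg s ^+ 2)) +
    \sum_s \sum_t a s * a t * (P w y *
    ((y s / sg s ^+ 2 * (y t / sg t ^+ 2) - (s == t)%:R / sg s ^+ 2) / 2)))).
  congr gexp; apply/funext => y; rewrite -/(P w y) mulrDr mulrDr mulr1; congr (_ + _ + _).
    by rewrite /l mulr_sumr; apply: eq_bigr => s _; rewrite mulrCA.
  transitivity (P w y * \sum_s \sum_t a s * a t * ((y s / sg s ^+ 2 * (y t / sg t ^+ 2) - (s == t)%:R / sg s ^+ 2) / 2)).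
    congr (_ * _); rewrite expr2 {1}/l -mulrA mulr_suml -sumrB.
    apply: eq_bigr => s _.
    transitivity (\sum_t (a s * (y s / sg s ^+ 2) * (a t * (y t / sg t ^+ 2)) / 2 -
        (if t == s then (a s / sg s) ^+ 2 / 2 else 0))).
      rewrite sumrB -big_mkcond big_pred1_eq; congr (_ - _).
      by rewrite mulrA -mulr_suml -mulr_sumr.
    apply: eq_bigr => t _; rewrite (eq_sym s t); case: eqP => [->|_].
      by rewrite mulr1n expr_div_n; move: (sg s ^- 2) => z; field.
    by rewrite mulr0n mul0r !subr0; move: (sg s ^- 2) (sg t ^- 2) => z z'; field.
  rewrite mulr_sumr; apply: eq_bigr => s _; rewrite mulr_sumr; apply: eq_bigr => t _.
  by rewrite mulrCA.
have t1 s : tame (fun y => a s * (P w y * (y s / sg s ^+ 2))).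
  by apply: tameZ; apply: tameM => //; exact: tame_Phi1p.
have t2 s t : tame (fun y => a s * a t * (P w y *
    ((y s / sg s ^+ 2 * (y t / sg t ^+ 2) - (s == t)%:R / sg s ^+ 2) / 2))).
  by apply: tameZ; apply: tameM => //; exact: tame_Phi2p.
rewrite gexpD; [|by apply: tameD => //; exact: tame_sum|by apply: tame_sum => s; exact: tame_sum].
rewrite gexpD //; last exact: tame_sum.
rewrite gexp_sum // gexp_sum; last by move=> s; exact: tame_sum.
congr (_ + _ + _); apply: eq_bigr => s _.
  by rewrite gexpZ //; apply: tameM => //; exact: tame_Phi1p.
rewrite gexp_sum //; apply: eq_bigr => t _.
by rewrite gexpZ //; apply: tameM => //; exact: tame_Phi2p.
Qed.

Variables (ep B : R).
Hypotheses (ep0 : 0 < ep).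

(** The last summand serves directions with [N1 a <= ep], where the exponential weight is expanded.
    The first two serve longer directions, where the shifted [psi] and the Taylor polynomial are
    bounded separately. *)
Definition taylor_weight y : R := (1 + N1 y) ^+ 2 *
  ((1 + ep) ^+ 2 + 2 * (1 + N1 y / ep) ^+ 2 + 2 * (1 + N1 y / ep) ^+ 3 * expR (1 + N1 y / ep)).

Lemma tame_taylor_weight : tame taylor_weight.
Proof.
have tb : tame (fun y : I -> R => 1 + N1 y / ep).
  by apply: tameD; [exact: tame_cst|apply: tameM; [exact: tame_N1|exact: tame_cst]].
apply: tameM; first exact: tame_N1poly.
apply: tameD; first apply: tameD; first exact: tame_cst.
  by apply: tameZ; exact: tameX.
apply: tameM; first by apply: tameZ; exact: tameX.
split; first by apply: mble_comp1 => //; exact: tb.1.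
exists (expR 1), (ep^-1); split; rewrite ?expR_ge0 ?invr_ge0 ?(ltW ep0) // => y.
by rewrite ger0_norm ?expR_ge0 // -expRD mulrC.
Qed.

Lemma taylor_weight_mono x y : (forall v, `|x v| <= `|y v|) ->
  taylor_weight x <= taylor_weight y.
Proof.
move=> xy; have n0 := N1_ge0 x; have n1 := N1_ge0 y.
have n01 : N1 x <= N1 y by apply: ler_sum.
have m0 : 0 <= N1 x / ep by rewrite divr_ge0 // ltW.
have m1 : 0 <= N1 y / ep by rewrite divr_ge0 // ltW.
have m01 : N1 x / ep <= N1 y / ep by rewrite ler_pM2r ?invr_gt0.
have p k u v : 0 <= u -> u <= v -> (1 + u) ^+ k <= (1 + v) ^+ k :> R.
  by move=> u0 uv; rewrite lerXn2r ?nnegrE ?addr_ge0 ?lerD2l // (le_trans u0).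
rewrite /taylor_weight ler_pM ?p //.
- by rewrite exprn_ge0 // addr_ge0.
- by rewrite !addr_ge0 ?mulr_ge0 ?expR_ge0 ?exprn_ge0 ?addr_ge0 // ltW.
rewrite !lerD //; first by rewrite ler_pM2l // p.
by rewrite ler_pM ?expR_ge0 ?mulr_ge0 ?exprn_ge0 ?addr_ge0 ?ler_expR ?lerD2l ?ler_pM2l ?p.
Qed.

Lemma norm_l_le sg a y : (forall s, ep <= sg s) -> `|l sg a y| <= N1 a / ep * (N1 y / ep).
Proof.
move=> sgP; rewrite (le_trans (ler_norm_sum _ _ _)) //.
rewrite /N1 -mulrA mulr_suml; apply: ler_sum => s _.
have sg0 : 0 < sg s by exact: lt_le_trans (sgP s).
rewrite normrM ler_wpM2l // normrM [leRHS]mulrCA ler_pM //; first exact: (le_N1 y s).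
rewrite -invfM ger0_norm ?invr_ge0 ?sqr_ge0 // lef_pV2 ?posrE ?mulr_gt0 ?exprn_gt0 //.
by rewrite expr2 ler_pM // ltW.
Qed.

Lemma q_le sg a : (forall s, ep <= sg s) -> 0 <= q sg a <= (N1 a / ep) ^+ 2 / 2.
Proof.
move=> sgP; apply/andP; split.
  by apply: sumr_ge0 => s _; rewrite divr_ge0 ?sqr_ge0.
rewrite /q -mulr_suml ler_pM2r ?invr_gt0 //.
have -> : (N1 a / ep) ^+ 2 = \sum_s `|a s| / ep * (N1 a / ep).
  by rewrite -mulr_suml -mulr_suml expr2.
apply: ler_sum => s _; rewrite -real_normK ?num_real // expr2 normrM.
have sg0 : 0 < sg s by exact: lt_le_trans (sgP s).
have le1 : `|(sg s)^-1| <= ep^-1.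
  by rewrite ger0_norm ?invr_ge0 ?(ltW sg0) // lef_pV2 ?posrE.
have le2 : `|a s| * `|(sg s)^-1| <= `|a s| / ep by rewrite ler_wpM2l.
rewrite ler_pM ?mulr_ge0 // (le_trans le2) // ler_pM2r ?invr_gt0 //; exact: (le_N1 a s).
Qed.

(** Taken at the largest deviation [B], so that one constant serves every [sg] with values in
    [[ep, B]]; [ep ^- 3] comes from [th ^+ 3] with [th = N1 a / ep]. *)
Definition taylor_cst : R := ep ^- 3 * growth_cst C psi * gexp (fun=> B) taylor_weight.

Lemma Phi_taylor sg w a : (forall s, ep <= sg s <= B) ->
  `|Phi sg (fun s => w s + a s) -
    (Phi sg w + \sum_s a s * Phi1 sg s w + \sum_s \sum_t a s * a t * Phi2 sg s t w)| <=
  taylor_cst * (1 + N1 w) ^+ 2 * N1 a ^+ 3.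
Proof.
move=> sgP; have sg0 s : 0 < sg s by have /andP[h _] := sgP s; exact: lt_le_trans h.
rewrite -Phi_polyE; set Q := fun y => 1 + l sg a y + (l sg a y ^+ 2 / 2 - q sg a).
have tQ : tame Q.
  apply: tameD; first by apply: tameD; [exact: tame_cst|exact: tame_l].
  apply: tameB; last exact: tame_cst.
  by apply: tameM; [apply: tameX; exact: tame_l|exact: tame_cst].
have tPw := tame_psiT w.
have [th thE] : exists th, th = N1 a / ep by exists (N1 a / ep).
have th0 : 0 <= th by rewrite thE divr_ge0 ?N1_ge0 ?ltW.
(* The shifted value is written as a Gaussian expectation in one of two ways: with the exponential
   weight if [th <= 1], by plain translation otherwise, since the expansion of the weight is only
   controlled for small [th]. *)
have key : exists F, [/\ tame F, Phi sg (fun s => w s + a s) = gexp sg F &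
   forall y, `|F y - psi (fun s => y s + w s) * Q y| <=
     th ^+ 3 * (growth_cst C psi * (1 + N1 w) ^+ 2) * taylor_weight y].
  have sgP' s : ep <= sg s by have /andP[] := sgP s.
  have b0 y : 0 <= N1 y / ep by rewrite divr_ge0 ?N1_ge0 // ltW.
  have nl y : `|l sg a y| <= th * (N1 y / ep) by rewrite thE; exact: norm_l_le.
  have /andP[q0 q1] := q_le a sgP'.
  rewrite -thE in q1.
  have tw0 y : 0 <= (1 + ep) ^+ 2 + 2 * (1 + N1 y / ep) ^+ 2.
    by rewrite addr_ge0 ?mulr_ge0 ?exprn_ge0 // addr_ge0 ?N1_ge0 // ltW.
  have te0 y : 0 <= 2 * (1 + N1 y / ep) ^+ 3 * expR (1 + N1 y / ep).
    by rewrite !mulr_ge0 ?expR_ge0 ?exprn_ge0 // addr_ge0.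
  have [th1|th1] := leP th 1.
    exists (fun y => psi (fun s => y s + w s) * \prod_s expR (a s / sg s * (y s / sg s) - (a s / sg s) ^+ 2 / 2)).
    split.
    - apply: tameM => //; apply: tame_prod => s.
      have := tame_ew (a s / sg s / sg s) ((a s / sg s) ^+ 2 / 2) s; congr tame.
      by apply/funext => y; rewrite mulrAC -mulrA.
    - rewrite -(gexp_shift (sd := sg) a (h := fun y => psi (fun s => y s + w s))) //.
        by congr gexp; apply/funext => y; congr psi; apply/funext => s; rewrite (addrC (w s)) addrA.
      by move=> s; rewrite gt_eqF.
    move=> y; rewrite -expR_sum -mulrBr.
    have -> : \sum_s (a s / sg s * (y s / sg s) - (a s / sg s) ^+ 2 / 2) = l sg a y - q sg a.
      rewrite sumrB; congr (_ - _); apply: eq_bigr => s _.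
      by rewrite expr2 invfM; ring.
    rewrite normrM /taylor_weight.
    have := @expR_expand R (l sg a y) (q sg a) th (N1 y / ep).
    rewrite th0 th1 q0 q1 => /(_ isT (b0 y) (nl y) isT) ee.
    apply: (le_trans (ler_pM (normr_ge0 _) (normr_ge0 _) (psiT_growth w y) ee)).
    have := tw0 y; move: ((1 + ep) ^+ 2 + 2 * (1 + N1 y / ep) ^+ 2) => A A0.
    have : 0 <= th ^+ 3 * (growth_cst C psi * (1 + N1 w) ^+ 2) * (1 + N1 y) ^+ 2 * A.
      by nneg.
    move: (_ * expR _) => D H; rewrite -subr_ge0.
    by rewrite [leRHS](_ : _ = th ^+ 3 * (growth_cst C psi * (1 + N1 w) ^+ 2) * (1 + N1 y) ^+ 2 * A) //; ring.
  exists (fun y => psi (fun s => y s + (w s + a s))); split => //; first exact: tame_psiT (fun s => w s + a s).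
  move=> y; rewrite (le_trans (ler_normB _ _)) // normrM.
  have th1' : 1 <= th by rewrite ltW.
  have th2 : th <= th ^+ 2 by rewrite expr2 ler_peMl.
  have th3 : th ^+ 2 <= th ^+ 3 by rewrite (exprS th 2) ler_peMl ?exprn_ge0.
  have wa : (1 + N1 (fun s => w s + a s)) ^+ 2 <= (1 + N1 w) ^+ 2 * ((1 + ep) ^+ 2 * th ^+ 3).
    apply: (@le_trans _ _ (((1 + N1 w) * ((1 + ep) * th)) ^+ 2)).
      rewrite lerXn2r ?nnegrE ?mulr_ge0 ?addr_ge0 ?N1_ge0 ?(ltW ep0) //.
      have aE : N1 a = th * ep by rewrite thE divfK // gt_eqF.
      have := N1D w a; rewrite aE; have := N1_ge0 w => w0.
      have : 0 <= N1 w * (th * ep) by nneg.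
      have : N1 w <= N1 w * th by rewrite ler_peMr.
      rewrite (_ : (1 + N1 w) * ((1 + ep) * th) = th + th * ep + N1 w * th + N1 w * (th * ep)); last by ring.
      by move: (N1 w * th) (N1 w * (th * ep)) (th * ep) => *; lra.
    rewrite exprMn ler_wpM2l ?exprn_ge0 ?addr_ge0 ?N1_ge0 // exprMn.
    by rewrite ler_wpM2l ?exprn_ge0 ?addr_ge0 // ltW.
  have Qb : `|Q y| <= 2 * (1 + N1 y / ep) ^+ 2 * th ^+ 3.
    have := nl y; have := b0 y; move: (N1 y / ep) => b' b'0 nly.
    rewrite /Q (le_trans (ler_normD _ _)) // (le_trans (lerD (ler_normD _ _) (ler_normB _ _))) //.
    rewrite normr1 (ger0_norm q0) normrM normrX (@ger0_norm _ (2^-1)) //.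
    have : `|l sg a y| ^+ 2 <= (th * b') ^+ 2 by rewrite lerXn2r ?nnegrE ?mulr_ge0.
    have : th * b' <= th ^+ 3 * b' by rewrite ler_wpM2r // (le_trans th2).
    have : th ^+ 2 * b' ^+ 2 <= th ^+ 3 * b' ^+ 2 by rewrite ler_wpM2r // exprn_ge0.
    have : 0 <= th ^+ 3 * b' by rewrite mulr_ge0 // exprn_ge0.
    have : 0 <= th ^+ 3 * b' ^+ 2 by rewrite mulr_ge0 // exprn_ge0.
    rewrite (_ : 2 * (1 + b') ^+ 2 * th ^+ 3 = 2 * th ^+ 3 + 4 * (th ^+ 3 * b') + 2 * (th ^+ 3 * b' ^+ 2)); last by ring.
    rewrite exprMn; move: q1; move: (q sg a) nly.
    move: (`|l sg a y| ^+ 2) (`|l sg a y|) => L2 L.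
    move: (th ^+ 3 * b') (th ^+ 3 * b' ^+ 2) (th ^+ 2 * b' ^+ 2) (th * b') => X1 X2 X3 X4.
    move: th2 th3; move: (th ^+ 3) (th ^+ 2) => T3 T2 *; lra.
  have g1 : `|psi (fun s => y s + (w s + a s))| <=
      growth_cst C psi * ((1 + N1 w) ^+ 2 * ((1 + ep) ^+ 2 * th ^+ 3)) * (1 + N1 y) ^+ 2.
    rewrite (le_trans (psiT_growth _ _)) // ler_wpM2r ?exprn_ge0 ?addr_ge0 ?N1_ge0 //.
    by rewrite ler_wpM2l.
  have g2 := ler_pM (normr_ge0 _) (normr_ge0 _) (psiT_growth w y) Qb.
  apply: (le_trans (lerD g1 g2)); rewrite /taylor_weight.
  have := te0 y; move: (2 * (1 + N1 y / ep) ^+ 3 * expR (1 + N1 y / ep)) => D D0.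
  have : 0 <= th ^+ 3 * (growth_cst C psi * (1 + N1 w) ^+ 2) * ((1 + N1 y) ^+ 2 * D).
    by nneg.
  rewrite -subr_ge0 => H; rewrite -subr_ge0.
  by rewrite [leRHS](_ : _ = th ^+ 3 * (growth_cst C psi * (1 + N1 w) ^+ 2) * ((1 + N1 y) ^+ 2 * D) - 0) //; ring.
have [F [tF -> FP]] := key.
rewrite -gexpB //; last exact: tameM.
apply: (@le_trans _ _ (gexp sg (fun y => th ^+ 3 * (growth_cst C psi * (1 + N1 w) ^+ 2) * taylor_weight y))).
  apply: gexp_norm_le => //; first by apply: tameB => //; exact: tameM.
  by apply: tameZ; exact: tame_taylor_weight.
rewrite gexpZ; last exact: tame_taylor_weight.
rewrite /taylor_cst thE expr_div_n.
have -> : ep ^- 3 * growth_cst C psi * gexp (fun=> B) taylor_weight * (1 + N1 w) ^+ 2 * N1 a ^+ 3 =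
  N1 a ^+ 3 / ep ^+ 3 * (growth_cst C psi * (1 + N1 w) ^+ 2) * gexp (fun=> B) taylor_weight by ring.
rewrite ler_wpM2l //.
  by nneg.
apply: le_gexp_sd; first exact: tame_taylor_weight.
  exact: taylor_weight_mono.
move=> s; have /andP[_ h] := sgP s; rewrite (gtr0_norm (sg0 s)) (le_trans h) // ler_norm //.
Qed.

End Smoothing.

(** * A single Lindeberg replacement *)

Section Lindeberg.
Variables (R : realType) (I : finType) (C : R) (psi : (I -> R) -> R).
Hypothesis psiP : plip C psi.
Implicit Types (w sg : I -> R).

(** Polynomial growth of the outer function is assumed because the inner ones may already grow
    exponentially, and an iterated exponential would leave the tame class. *)
Lemma tame_comp_poly (T : finType) (g : (I -> R) -> R) (K : R) n (W : I -> (T -> R) -> R) :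
  mble g -> (forall w, `|g w| <= K * (1 + N1 w) ^+ n) -> (forall s, tame (W s)) ->
  tame (fun x => g (W ^~ x)).
Proof.
move=> mg gK tW; apply: (tame_dom _ _ (fun x => gK (W ^~ x))).
  by apply: mble_comp => [d Om Y mY|i]; [exact: mg|exact: (tW i).1].
apply: tameZ; apply: tameX; apply: tameD; first exact: tame_cst.
by apply: tame_sum => s; exact: tame_norm.
Qed.

Lemma tame_N1comp (T : finType) (W : I -> (T -> R) -> R) : (forall s, tame (W s)) ->
  tame (fun x => N1 (W ^~ x)).
Proof. by move=> tW; apply: tame_sum => s; exact: tame_norm. Qed.

Lemma tame_N1poly_comp (T : finType) (W : I -> (T -> R) -> R) n : (forall s, tame (W s)) ->
  tame (fun x => (1 + N1 (W ^~ x)) ^+ n).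
Proof.
by move=> tW; apply: tameX; apply: tameD; [exact: tame_cst|exact: tame_N1comp].
Qed.

Lemma tame_smooth_comp (T : finType) sg (p : (I -> R) -> R) (W : I -> (T -> R) -> R) :
  tame p -> (forall s, tame (W s)) ->
  tame (fun x => gexp sg (fun y => psi (fun s => y s + W s x) * p y)).
Proof.
move=> tp tW; pose g w := gexp sg (fun y => psi (fun s => y s + w s) * p y).
apply: (@tame_comp_poly T g (growth_cst C psi * gexp sg (fun y => (1 + N1 y) ^+ 2 * `|p y|)) 2 W) => //.
  exact: (tame_smooth psiP sg tp).1.
by move=> w; rewrite mulrAC; exact: (smooth_growth psiP).
Qed.

Lemma tame_Phi_comp (T : finType) sg (W : I -> (T -> R) -> R) :
  (forall s, tame (W s)) -> tame (fun x => Phi psi sg (W ^~ x)).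
Proof.
move=> tW; under eq_fun do rewrite PhiE.
by apply: tame_smooth_comp => //; exact: tame_cst.
Qed.

Variables (ep B : R).
Hypothesis ep0 : 0 < ep.
Notation tc := (taylor_cst C psi ep B).

Lemma tc_ge0 : 0 <= tc.
Proof.
have c0 := growth_cst_ge0 psiP; have tw := tame_taylor_weight I ep0.
rewrite /taylor_cst; have : 0 <= gexp (fun=> B) (@taylor_weight R I ep).
  apply: gexp_ge0 => // y; rewrite /taylor_weight; nneg.
by move=> h; nneg.
Qed.

(** [X] is independent of [W]. Its zero mean removes the first-order Taylor term, and uncorrelated
    coordinates leave only the diagonal of the second-order one. *)
Lemma one_step (T : finType) (sd : T -> R) (W X : I -> (T -> R) -> R) (A S : T -> Prop)
    (v : I -> R) (a : R) sg : 0 <= a -> (forall s, ep <= sg s <= B) ->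
  (forall s, tame (W s)) -> (forall s, tame (X s)) ->
  (forall s, depends A (W s)) -> (forall s, depends S (X s)) -> (forall t, A t -> ~ S t) ->
  (forall s, gexp sd (X s) = 0) ->
  (forall s t, gexp sd (fun x => X s x * X t x) = (s == t)%:R * v s) ->
  `|gexp sd (fun x => Phi psi sg (fun s => W s x + a * X s x)) -
    (gexp sd (fun x => Phi psi sg (W ^~ x)) +
     a ^+ 2 * \sum_s v s * gexp sd (fun x => Phi2 psi sg s s (W ^~ x)))| <=
  tc * a ^+ 3 * gexp sd (fun x => (1 + N1 (W ^~ x)) ^+ 2) * gexp sd (fun x => N1 (X ^~ x) ^+ 3).
Proof.
move=> a0 sgP tW tX WA XS AS EX EXX.
have t1 s : tame (fun x => Phi1 psi sg s (W ^~ x)).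
  by apply: tame_smooth_comp => //; exact: tame_Phi1p.
have t2 s t : tame (fun x => Phi2 psi sg s t (W ^~ x)).
  by apply: tame_smooth_comp => //; exact: tame_Phi2p.
have t0 : tame (fun x => Phi psi sg (W ^~ x)) by exact: tame_Phi_comp.
have tl : tame (fun x => Phi psi sg (fun s => W s x + a * X s x)).
  apply: (tame_Phi_comp sg (W := fun s x => W s x + a * X s x)) => s.
  by apply: tameD => //; exact: tameZ.
have dW g : depends A (fun x => g (W ^~ x)).
  by move=> x y xy; congr g; apply/funext => s; exact: WA.
have E1 : gexp sd (fun x => \sum_s a * X s x * Phi1 psi sg s (W ^~ x)) = 0.
  rewrite gexp_sum; last by move=> s; apply: tameM => //; exact: tameZ.
  rewrite big1 // => s _; under eq_fun do rewrite -mulrA.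
  rewrite gexpZ; last exact: tameM.
  rewrite (gexpM sd (tX s) (t1 s) (XS s) (dW _)) ?EX ?mul0r ?mulr0 //.
  by move=> t St At; exact: AS At St.
have t22 s t : tame (fun x => a * X s x * (a * X t x) * Phi2 psi sg s t (W ^~ x)).
  by apply: tameM => //; apply: tameM; exact: tameZ.
have E2 : gexp sd (fun x => \sum_s \sum_t a * X s x * (a * X t x) * Phi2 psi sg s t (W ^~ x)) =
    a ^+ 2 * \sum_s v s * gexp sd (fun x => Phi2 psi sg s s (W ^~ x)).
  rewrite gexp_sum; last by move=> s; exact: tame_sum.
  rewrite mulr_sumr; apply: eq_bigr => s _; rewrite gexp_sum //.
  have e t : gexp sd (fun x => a * X s x * (a * X t x) * Phi2 psi sg s t (W ^~ x)) =
      a ^+ 2 * ((s == t)%:R * v s * gexp sd (fun x => Phi2 psi sg s t (W ^~ x))).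
    rewrite -EXX.
    transitivity (gexp sd (fun x => a ^+ 2 * (X s x * X t x * Phi2 psi sg s t (W ^~ x)))).
      by congr gexp; apply/funext => x; ring.
    rewrite gexpZ; last by apply: tameM => //; exact: tameM.
    rewrite (gexpM sd (tameM (tX s) (tX t)) (t2 s t) (dependsM (XS s) (XS t)) (dW (Phi2 psi sg s t))) ?mulrA //.
    by move=> u Su Au; exact: AS Au Su.
  rewrite (bigD1 s) //= e eqxx mul1r big1 ?addr0 // => t ts.
  by rewrite e eq_sym (negbTE ts) !mul0r mulr0.
have tS1 : tame (fun x => \sum_s a * X s x * Phi1 psi sg s (W ^~ x)).
  by apply: tame_sum => s; apply: tameM => //; exact: tameZ.
have tS2 : tame (fun x => \sum_s \sum_t a * X s x * (a * X t x) * Phi2 psi sg s t (W ^~ x)).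
  by apply: tame_sum => s; exact: tame_sum.
pose P x := Phi psi sg (W ^~ x) + \sum_s a * X s x * Phi1 psi sg s (W ^~ x) +
  \sum_s \sum_t a * X s x * (a * X t x) * Phi2 psi sg s t (W ^~ x).
have tP : tame P by apply: tameD => //; exact: tameD.
have EP : gexp sd P = gexp sd (fun x => Phi psi sg (W ^~ x)) +
    a ^+ 2 * \sum_s v s * gexp sd (fun x => Phi2 psi sg s s (W ^~ x)).
  by rewrite /P gexpD //; [rewrite gexpD // E1 E2 addr0|exact: tameD].
rewrite -EP -gexpB //.
have tN : tame (fun x => N1 (X ^~ x) ^+ 3) by apply: tameX; exact: tame_N1comp.
have tN2 : tame (fun x => (1 + N1 (W ^~ x)) ^+ 2) by exact: tame_N1poly_comp.
have dN : depends S (fun x => N1 (X ^~ x) ^+ 3).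
  by move=> x y xy; congr (_ ^+ _); apply: eq_bigr => s _; rewrite (XS s x y xy).
rewrite -mulrA -(gexpM sd tN2 tN (dW (fun w => (1 + N1 w) ^+ 2)) dN AS).
rewrite -gexpZ; last exact: tameM.
apply: gexp_norm_le.
- exact: tameB.
- by apply: tameZ; exact: tameM.
move=> x; have := Phi_taylor psiP ep0 (W ^~ x) (fun s => a * X s x) sgP.
move=> /le_trans; apply; rewrite N1Z // exprMn.
by rewrite le_eqVlt; apply/orP; left; apply/eqP; ring.
Qed.

Variable M : R.
Hypothesis M0 : 0 <= M.
(** Bounds the third moment of the Gaussian increment that takes the place of a summand, since all
    variances are at most [M]. *)
Definition G3 : R := gexp (fun=> Num.sqrt M) (fun y : I -> R => N1 y ^+ 3).

Lemma tame_N1X n : tame (fun y : I -> R => N1 y ^+ n).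
Proof. by apply: tameX; exact: tame_N1. Qed.

Lemma G3_ge0 : 0 <= G3.
Proof. by apply: gexp_ge0 => [|y]; [exact: tame_N1X|nneg]. Qed.

Lemma lindeberg_step (T : finType) (sd : T -> R) (W X : I -> (T -> R) -> R) (A S : T -> Prop)
    (v : I -> R) (a : R) sg sg' : 0 <= a -> (forall s, ep <= sg s <= B) ->
  (forall s, 0 < sg' s) -> (forall s, sg' s ^+ 2 = sg s ^+ 2 + a ^+ 2 * v s) ->
  (forall s, tame (W s)) -> (forall s, tame (X s)) ->
  (forall s, depends A (W s)) -> (forall s, depends S (X s)) -> (forall t, A t -> ~ S t) ->
  (forall s, gexp sd (X s) = 0) ->
  (forall s t, gexp sd (fun x => X s x * X t x) = (s == t)%:R * v s) ->
  (forall s, 0 <= v s <= M) -> gexp sd (fun x => N1 (X ^~ x) ^+ 3) <= M ->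
  `|gexp sd (fun x => Phi psi sg (fun s => W s x + a * X s x)) -
    gexp sd (fun x => Phi psi sg' (W ^~ x))| <=
  tc * a ^+ 3 * gexp sd (fun x => (1 + N1 (W ^~ x)) ^+ 2) * (M + G3).
Proof.
move=> a0 sgP sg'0 sg'E tW tX WA XS AS EX EXX vM XM.
have := one_step a0 sgP tW tX WA XS AS EX EXX.
set P := fun x => Phi psi sg (W ^~ x) + a ^+ 2 * \sum_s v s * Phi2 psi sg s s (W ^~ x).
have t2 s t : tame (fun x => Phi2 psi sg s t (W ^~ x)).
  by apply: tame_smooth_comp => //; exact: tame_Phi2p.
have tS : tame (fun x => \sum_s v s * Phi2 psi sg s s (W ^~ x)).
  by apply: tame_sum => s; exact: tameZ.
have tP : tame P by apply: tameD; [exact: tame_Phi_comp|exact: tameZ].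
rewrite (_ : _ + _ * \sum_s _ = gexp sd P); last first.
  rewrite /P gexpD; [|exact: tame_Phi_comp|exact: tameZ].
  congr (_ + _); rewrite gexpZ // gexp_sum; last by move=> s; exact: tameZ.
  by congr (_ * _); apply: eq_bigr => s _; rewrite gexpZ.
move=> h1.
have tN2 : tame (fun x => (1 + N1 (W ^~ x)) ^+ 2) by exact: tame_N1poly_comp.
have tcg : 0 <= tc * a ^+ 3 * gexp sd (fun x => (1 + N1 (W ^~ x)) ^+ 2).
  have := tc_ge0; have : 0 <= gexp sd (fun x => (1 + N1 (W ^~ x)) ^+ 2).
    by apply: gexp_ge0 => // x; nneg.
  by move=> ? ?; nneg.
(* The Gaussian side of the replacement is [one_step] itself: [W] is the constant [w], the summand
   is the Gaussian vector of deviations [ta], and [gexp_conv] merges this vector with the noise [sg]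
   into [sg']. *)
have h2 w : `|Phi psi sg' w - (Phi psi sg w + a ^+ 2 * \sum_s v s * Phi2 psi sg s s w)| <=
    tc * (1 + N1 w) ^+ 2 * (a ^+ 3 * G3).
  pose ta s := a * Num.sqrt (v s).
  have v0 s : 0 <= v s by have /andP[] := vM s.
  have ta2 s : ta s ^+ 2 = a ^+ 2 * v s by rewrite exprMn sqr_sqrtr.
  have := @one_step I ta (fun s _ => w s) (fun s y => y s) (fun=> False) (fun=> True)
    (fun s => a ^+ 2 * v s) 1 sg ler01 sgP.
  move=> /(_ (fun s => tame_cst _ _) (fun s => tame_var _ s) (fun s => depends_cst (w s))
    (fun s => depends_var (v := s) Logic.I) (fun _ => False_ind _)).
  move=> /(_ (gexp_var_mean ta)).
  have cov s t : gexp ta (fun y : I -> R => y s * y t) = (s == t)%:R * (a ^+ 2 * v s).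
    case: eqVneq => [->|st].
      by rewrite mul1r -ta2 -gexp_var_sqr; congr gexp; apply/funext => y; rewrite expr2.
    rewrite mul0r (gexpM ta (tame_var _ s) (tame_var _ t)
       (depends_var (A := fun u => u = s) (v := s) erefl) (depends_var (A := fun u => u = t) (v := t) erefl)).
      by rewrite gexp_var_mean mul0r.
    by move=> u -> /eqP; rewrite (negbTE st).
  move=> /(_ cov); rewrite !gexp_cst !expr1n mulr1 mul1r.
  rewrite (_ : gexp ta (fun x => Phi psi sg _) = Phi psi sg' w); last first.
    rewrite /Phi.
    rewrite -(@gexp_conv _ _ sg ta sg' (fun y => psi (fun s => y s + w s))) //.
    - by congr gexp; apply/funext => y'; congr gexp; apply/funext => y;
        congr psi; apply/funext => s; rewrite mul1r (addrC (w s)) addrA.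
    - by move=> s; have /andP[h _] := sgP s; exact: lt_le_trans h.
    - by move=> s; rewrite /ta mulr_ge0 ?sqrtr_ge0.
    - by move=> s; rewrite ta2.
    - exact: tame_psiT psiP w.
  rewrite (_ : \sum_s _ = a ^+ 2 * \sum_s v s * Phi2 psi sg s s w); last first.
    by rewrite mulr_sumr; apply: eq_bigr => s _; rewrite gexp_cst mulrA.
  move=> /le_trans; apply; rewrite ler_wpM2l //.
    by have := tc_ge0; move=> ?; nneg.
  rewrite /ta (gexp_scale (fun=> a)).
  rewrite (_ : (fun y : I -> R => _) = (fun y => a ^+ 3 * N1 y ^+ 3)); last first.
    by apply/funext => y; rewrite N1Z // exprMn.
  rewrite gexpZ; last exact: tame_N1X.
  rewrite ler_wpM2l ?exprn_ge0 // /G3; apply: le_gexp_sd; first exact: tame_N1X.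
    move=> x y xy; rewrite lerXn2r ?nnegrE ?N1_ge0 //; exact: ler_sum.
  move=> s; rewrite !ger0_norm ?sqrtr_ge0 // ler_sqrt //.
  by have /andP[] := vM s.
have h2' : `|gexp sd (fun x => Phi psi sg' (W ^~ x)) - gexp sd P| <=
    tc * a ^+ 3 * gexp sd (fun x => (1 + N1 (W ^~ x)) ^+ 2) * G3.
  rewrite -gexpB //; last exact: tame_Phi_comp.
  rewrite (_ : _ * G3 = gexp sd (fun x => tc * a ^+ 3 * G3 * (1 + N1 (W ^~ x)) ^+ 2)); last first.
    by rewrite gexpZ //; ring.
  apply: gexp_norm_le; first by apply: tameB => //; exact: tame_Phi_comp.
    exact: tameZ.
  move=> x; rewrite (le_trans (h2 _)) // le_eqVlt; apply/orP; left; apply/eqP; ring.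
rewrite (_ : _ - _ = (gexp sd (fun x => Phi psi sg (fun s => W s x + a * X s x)) - gexp sd P) -
   (gexp sd (fun x => Phi psi sg' (W ^~ x)) - gexp sd P)); last by ring.
rewrite (le_trans (ler_normB _ _)) // mulrDr lerD // (le_trans h1) //.
by rewrite ler_wpM2l.
Qed.

End Lindeberg.

(** * Elementary inequalities for finite sums and products *)

Section FiniteSums.
Variables (R : realType).

Lemma sqr_sum_le (I : finType) (a : I -> R) : (\sum_i a i) ^+ 2 <= #|I|%:R * \sum_i a i ^+ 2.
Proof.
rewrite expr2 mulr_suml (_ : #|I|%:R = \sum_(s : I) (1 : R)); last by rewrite sumr_const.
apply: (@le_trans _ _ (\sum_s \sum_t (a s ^+ 2 + a t ^+ 2) / 2)).
  apply: ler_sum => s _; rewrite mulr_sumr; apply: ler_sum => t _.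
  by have := sqr_ge0 (a s - a t); rewrite sqrrB; lra.
rewrite le_eqVlt; apply/orP; left; apply/eqP.
under eq_bigr do rewrite -mulr_suml big_split /= sumr_const.
rewrite -mulr_suml big_split /= sumr_const sumrMnl sumr_const mulr_natl.
by move: (_ *+ _) => Z; field.
Qed.

Lemma sum_pow4_le (I : finType) (a : I -> R) :
  (\sum_i a i) ^+ 4 <= #|I|%:R ^+ 3 * \sum_i a i ^+ 4.
Proof.
have e4 (x : R) : x ^+ 4 = (x ^+ 2) ^+ 2 by rewrite -exprM.
rewrite e4; apply: (@le_trans _ _ ((#|I|%:R * \sum_i a i ^+ 2) ^+ 2)).
  by rewrite lerXn2r ?nnegrE ?sqr_ge0 ?mulr_ge0 ?sumr_ge0 ?sqr_sum_le // => i _; exact: sqr_ge0.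
rewrite exprMn (exprSr _ 2) -mulrA ler_wpM2l ?sqr_ge0 //.
rewrite (le_trans (sqr_sum_le _)) // (eq_bigr (fun i => a i ^+ 4)) //.
Qed.

(** The factors are exchanged for [c] one at a time; [1 <= B] lets the powers of [B] that arise be
    bounded by the largest one. *)
Lemma prod_dist (I : Type) (s : seq I) (a : I -> R) (c B t : R) : 1 <= B -> 0 <= t ->
  (forall i, `|a i| <= B) -> `|c| <= B -> (forall i, `|a i - c| <= t) ->
  `|\prod_(i <- s) a i - c ^+ size s| <= (size s)%:R * B ^+ size s * t.
Proof.
move=> B1 t0 aB cB ac; have B0 : 0 <= B by exact: le_trans B1.
elim: s => [|i s IH]; first by rewrite big_nil expr0 subrr normr0 !mul0r.
rewrite big_cons /= exprS.
rewrite (_ : _ - _ = a i * (\prod_(j <- s) a j - c ^+ size s) + (a i - c) * c ^+ size s); last by ring.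
rewrite (le_trans (ler_normD _ _)) // -natr1 !mulrDl mul1r lerD //.
  rewrite normrM exprS (_ : _ * (B * _) * t = B * ((size s)%:R * B ^+ size s * t)); last by ring.
  by rewrite ler_pM.
rewrite -mulrDl normrM mulrC ler_pM // normrX exprS.
apply: (@le_trans _ _ (B ^+ size s)); first by rewrite lerXn2r ?nnegrE.
by rewrite ler_peMl // exprn_ge0.
Qed.

End FiniteSums.

(** * Variance of a sum of independent centred variables *)

Section SumMoments.
Variables (R : realType) (T : finType) (sd : T -> R) (E : eqType).
Variables (supp : E -> T -> Prop) (J : seq E).
Hypothesis supp_disj : forall b c, b \in J -> c \in J -> b != c -> forall t, supp b t -> ~ supp c t.

Lemma gexp_sum_indep_sqr (X : E -> (T -> R) -> R) : uniq J ->
  (forall b, tame (X b)) -> (forall b, depends (supp b) (X b)) ->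
  (forall b, b \in J -> gexp sd (X b) = 0) ->
  gexp sd (fun x => (\sum_(b <- J) X b x) ^+ 2) = \sum_(b <- J) gexp sd (fun x => X b x ^+ 2).
Proof.
move=> uJ tX dX X0.
transitivity (gexp sd (fun x => \sum_(b <- J) \sum_(c <- J) X b x * X c x)).
  by congr gexp; apply/funext => x; rewrite expr2 mulr_suml; apply: eq_bigr => b _; rewrite mulr_sumr.
rewrite gexp_sum; last by move=> b; apply: tame_sum => c; exact: tameM.
rewrite big_seq [RHS]big_seq; apply: eq_bigr => b bJ.
rewrite gexp_sum; last by move=> c; exact: tameM.
rewrite (bigD1_seq b) //= big_seq_cond big1 ?addr0.
  by congr gexp; apply/funext => x; rewrite expr2.
move=> c /andP[cJ cb]; rewrite (gexpM sd (tX b) (tX c) (dX b) (dX c)).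
  by rewrite X0 // mul0r.
by apply: supp_disj => //; rewrite eq_sym.
Qed.

End SumMoments.

(** * Replacing all summands *)

Section CLT.
Variables (R : realType) (I : finType) (C : R) (psi : (I -> R) -> R).
Hypothesis psiP : plip C psi.
Implicit Types (w sg : I -> R).
Local Notation k := (#|I|%:R : R).

Lemma N1_sqr_le w : (1 + N1 w) ^+ 2 <= (k + 1) * (1 + \sum_s w s ^+ 2).
Proof.
suff : N1 w ^+ 2 <= k * \sum_s w s ^+ 2.
  have : 2 * N1 w <= k + \sum_s w s ^+ 2.
    rewrite (_ : k = \sum_(s : I) 1); last by rewrite sumr_const.
    rewrite -big_split /= /N1 mulr_sumr; apply: ler_sum => s _.
    rewrite -(@real_normK _ (w s)) ?num_real //.
    by have := sqr_ge0 (1 - `|w s|); rewrite sqrrB expr1n mul1r; lra.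
  rewrite sqrrD expr1n mul1r mulrDl mul1r mulrDr mulr1 -mulr_natl.
  by move: (k * _) => Z; lra.
apply: le_trans (sqr_sum_le (fun s => `|w s|)) _; apply: ler_wpM2l => //.
by apply: ler_sum => s _; rewrite real_normK ?num_real.
Qed.

Lemma gexp_N1_sqr_le (T : finType) (sd : T -> R) (W : I -> (T -> R) -> R) (V : R) :
  (forall s, tame (W s)) -> (forall s, gexp sd (fun x => W s x ^+ 2) <= V) ->
  gexp sd (fun x => (1 + N1 (W ^~ x)) ^+ 2) <= (k + 1) * (1 + k * V).
Proof.
move=> tW WV.
have tS : tame (fun x => \sum_s W s x ^+ 2) by apply: tame_sum => s; exact: tameX.
apply: (@le_trans _ _ (gexp sd (fun x => (k + 1) * (1 + \sum_s W s x ^+ 2)))).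
  apply: le_gexp; first exact: tame_N1poly_comp.
    by apply: tameZ; apply: tameD => //; exact: tame_cst.
  by move=> x; exact: N1_sqr_le.
rewrite gexpZ; last by apply: tameD => //; exact: tame_cst.
rewrite gexpD //; last exact: tame_cst.
rewrite gexp_cst ler_wpM2l ?addr_ge0 // lerD2l gexp_sum; last by move=> s; exact: tameX.
by rewrite (le_trans (ler_sum _ (fun s _ => WV s))) // sumr_const mulr_natl.
Qed.

Section Swap.
Variables (ep B M : R).
Hypotheses (ep0 : 0 < ep) (M0 : 0 <= M).
Variables (T : finType) (sd : T -> R) (E : eqType).
Variables (supp : E -> T -> Prop) (X : E -> I -> (T -> R) -> R) (v : E -> I -> R).
Hypotheses (tX : forall b s, tame (X b s)) (dX : forall b s, depends (supp b) (X b s)).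

Definition summand_ok b := [/\ (forall s, gexp sd (X b s) = 0),
  (forall s t, gexp sd (fun x => X b s x * X b t x) = (s == t)%:R * v b s),
  (forall s, 0 <= v b s <= M) & gexp sd (fun x => N1 (X b ^~ x) ^+ 3) <= M].

(** The induction lets [sg] vary and keeps [sg'] fixed: the variance of each removed summand passes
    to the noise, and the total remains [sg' ^+ 2]. As this total is at most [B ^+ 2], so are the
    second moments of the remaining sum, which makes the cost of a step uniform. *)
Lemma lindeberg_sum (J : seq E) (a : R) sg sg' : 0 <= a -> uniq J ->
  (forall b c, b \in J -> c \in J -> b != c -> forall t, supp b t -> ~ supp c t) ->
  (forall b, b \in J -> summand_ok b) ->
  (forall s, ep <= sg s) -> (forall s, 0 < sg' s <= B) ->
  (forall s, sg' s ^+ 2 = sg s ^+ 2 + a ^+ 2 * \sum_(b <- J) v b s) ->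
  `|gexp sd (fun x => Phi psi sg (fun s => a * \sum_(b <- J) X b s x)) - Phi psi sg' (fun=> 0)| <=
  (size J)%:R * (taylor_cst C psi ep B * a ^+ 3 * ((k + 1) * (1 + k * B ^+ 2)) * (M + G3 I M)).
Proof.
move=> a0; set K := taylor_cst _ _ _ _ * _ * _ * _.
elim: J sg => [|b J IH] sg.
  move=> _ _ _ sgP sg'P sgE.
  have -> : (fun x => Phi psi sg (fun s => a * \sum_(b <- [::]) X b s x)) = fun=> Phi psi sg (fun=> 0).
    by apply/funext => x; congr Phi; apply/funext => s; rewrite big_nil mulr0.
  rewrite gexp_cst (_ : sg' = sg) ?subrr ?normr0 ?mul0r //.
  apply/funext => s; have /andP[h _] := sg'P s.
  apply/eqP; rewrite -(@eqrXn2 _ 2) // ?ltW // ?(lt_le_trans ep0) //.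
  by rewrite sgE big_nil mulr0 addr0.
move=> /= /andP[bJ uJ] disj ok sgP sg'P sgE.
have okJ c : c \in J -> summand_ok c by move=> cJ; apply: ok; rewrite inE cJ orbT.
have disjJ c e : c \in J -> e \in J -> c != e -> forall t, supp c t -> ~ supp e t.
  by move=> cJ eJ; apply: disj; rewrite inE ?cJ ?eJ orbT.
have [Eb Ebb vb Xb] := ok b (mem_head _ _).
have v0 c s : c \in b :: J -> 0 <= v c s by move=> /ok[_ _ /(_ s) /andP[]].
have sg0 s : 0 < sg s by exact: lt_le_trans (sgP s).
pose sg1 s := Num.sqrt (sg s ^+ 2 + a ^+ 2 * v b s).
have sg1E s : sg1 s ^+ 2 = sg s ^+ 2 + a ^+ 2 * v b s.
  by rewrite sqr_sqrtr // addr_ge0 ?sqr_ge0 // mulr_ge0 ?sqr_ge0 // v0 // mem_head.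
have sgle s : sg s <= sg1 s.
  rewrite -(@ler_pXn2r _ 2) // ?nnegrE ?sqrtr_ge0 ?(ltW (sg0 s)) // sg1E lerDl.
  by rewrite mulr_ge0 ?sqr_ge0 // v0 // mem_head.
have sumJ0 s : 0 <= \sum_(c <- J) v c s.
  by rewrite big_seq; apply: sumr_ge0 => c cJ; apply: v0; rewrite inE cJ orbT.
have sgB s : sg s <= B.
  have /andP[h1 h2] := sg'P s; apply: le_trans h2.
  rewrite -(@ler_pXn2r _ 2) ?nnegrE ?(ltW h1) ?(ltW (sg0 s)) // sgE lerDl mulr_ge0 ?sqr_ge0 //.
  by rewrite big_cons addr_ge0 // v0 // mem_head.
have B0 (s : I) : 0 < B by have /andP[h1 h2] := sg'P s; exact: lt_le_trans h2.
pose W s x := a * \sum_(c <- J) X c s x.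
have tW s : tame (W s) by apply: tameZ; exact: tame_sum.
pose A t := exists2 c, c \in J & supp c t.
have dW s : depends A (W s).
  move=> x y xy; rewrite /W big_seq [in RHS]big_seq; congr (_ * _); apply: eq_bigr => c cJ.
  by apply: dX => t ct; apply: xy; exists c.
have AS t : A t -> ~ supp b t.
  move=> [c cJ ct]; apply: (disj c b) => //; rewrite ?mem_head // ?inE ?cJ ?orbT //.
  by apply: contraNneq bJ => <-.
have W2 s : gexp sd (fun x => W s x ^+ 2) <= B ^+ 2.
  under eq_fun do rewrite exprMn.
  rewrite gexpZ; last by apply: tameX; exact: tame_sum.
  rewrite (gexp_sum_indep_sqr disjJ uJ (fun c => @tX c s) (fun c => @dX c s)); last by move=> c /okJ[].
  have /andP[h1 h2] := sg'P s; apply: (@le_trans _ _ (sg' s ^+ 2)); last first.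
    by rewrite lerXn2r ?nnegrE ?(ltW h1) ?(ltW (B0 s)).
  rewrite sgE big_cons mulrDr addrA -[leLHS]add0r lerD //.
    by rewrite addr_ge0 ?sqr_ge0 // mulr_ge0 ?sqr_ge0 // v0 // mem_head.
  rewrite ler_wpM2l ?sqr_ge0 // [leLHS]big_seq [leRHS]big_seq; apply: ler_sum => c /okJ[_ EE _ _].
  by rewrite (_ : (fun x => _) = fun x => X c s x * X c s x) ?EE ?eqxx ?mul1r //;
    apply/funext => x; rewrite expr2.
have step := @lindeberg_step R I C psi psiP ep B ep0 M M0 T sd W (X b) A (supp b) (v b) a sg sg1 a0.
have {}step := step (fun s => introT andP (conj (sgP s) (sgB s)))
  (fun s => lt_le_trans (sg0 s) (sgle s)) sg1E tW (@tX b) dW (@dX b) AS Eb Ebb vb Xb.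
have {}IH := IH sg1 uJ disjJ okJ (fun s => le_trans (sgP s) (sgle s)) sg'P.
have {}IH := IH (fun s => ltac:(by rewrite sgE big_cons mulrDr addrA sg1E)).
have -> : (fun x => Phi psi sg (fun s => a * \sum_(c <- b :: J) X c s x)) =
  (fun x => Phi psi sg (fun s => W s x + a * X b s x)).
  by apply/funext => x; congr Phi; apply/funext => s; rewrite /W big_cons mulrDr addrC.
rewrite (le_trans (ler_distD (gexp sd (fun x => Phi psi sg1 (W ^~ x))) _ _)) //.
rewrite -natr1 mulrDl mul1r [leRHS]addrC lerD //.
rewrite (le_trans step) // /K ler_wpM2r //.
  by rewrite addr_ge0 // G3_ge0.
rewrite ler_wpM2l //; first by rewrite mulr_ge0 ?exprn_ge0 // tc_ge0.
exact: gexp_N1_sqr_le.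
Qed.

End Swap.
End CLT.

(** * Quantitative central limit theorem for pseudo-Lipschitz functions *)

Section CentralLimit.
Variables (R : realType) (I : finType) (C : R) (psi : (I -> R) -> R).
Hypothesis psiP : plip C psi.
Implicit Types (w sg : I -> R).
Local Notation k := (#|I|%:R : R).
Local Notation g1 := (gexp (fun=> 1) (fun y : I -> R => (1 + N1 y) ^+ 2)).

Let C_ge0 : 0 <= C. Proof. by case: psiP. Qed.
Let g1_ge0 : 0 <= g1 :> R.
Proof. by apply: gexp_ge0 => [|y]; [exact: tame_N1poly|nneg]. Qed.

Lemma smooth_dist (ep : R) w : 0 <= ep <= 1 ->
  `|Phi psi (fun=> ep) w - psi w| <= 2 * C * ep * g1 * (1 + N1 w) ^+ 2.
Proof.
move=> /andP[e0 e1].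
have tS : tame (fun y : I -> R => psi (fun s => ep * y s + w s)).
  have := tame_subst (X := fun s (y : I -> R) => ep * y s) (a := 1) (tame_psiT psiP w).
  apply => //; first by move=> u; exact: (tameZ ep (tame_var _ u)).1.
  move=> u y; rewrite mul1r normrM (ger0_norm e0).
  by rewrite (@le_trans _ _ `|y u|) ?ler_piMl // (le_trans (le_N1 y u)) // lerDr.
rewrite /Phi (_ : (fun=> ep) = (fun v : I => ep * 1)); last by apply/funext => v; rewrite mulr1.
rewrite (gexp_scale (fun=> ep)) -[X in _ - X](@gexp_cst R I (fun=> 1) (psi w)) -gexpB //; last exact: tame_cst.
rewrite (_ : _ * g1 * _ = gexp (fun=> 1) (fun y : I -> R => 2 * C * ep * (1 + N1 w) ^+ 2 * (1 + N1 y) ^+ 2)).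
  apply: gexp_norm_le; first by apply: tameB => //; exact: tame_cst.
    by apply: tameZ; exact: tame_N1poly.
  move=> y; have [_ hC] := psiP; rewrite (le_trans (hC _ _)) //.
  rewrite (_ : (fun s => _ - w s) = (fun s => ep * y s)); last first.
    by apply/funext => s; rewrite addrK.
  rewrite N1Z //; have ny := N1_ge0 y; have nw := N1_ge0 w.
  have h1 : 1 + N1 (fun s => ep * y s + w s) + N1 w <= 2 * (1 + N1 y) * (1 + N1 w).
    have := N1D (fun s => ep * y s) w; rewrite N1Z //.
    have : ep * N1 y <= N1 y by rewrite ler_piMl.
    have := mulr_ge0 ny nw.
    rewrite (_ : 2 * (1 + N1 y) * (1 + N1 w) = 2 + 2 * N1 y + 2 * N1 w + 2 * (N1 y * N1 w)); last by ring.
    by move: (N1 y * N1 w) (ep * N1 y) => *; lra.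
  have h2 : ep * N1 y <= ep * (1 + N1 y) by rewrite ler_wpM2l // lerDr.
  apply: (@le_trans _ _ (C * (2 * (1 + N1 y) * (1 + N1 w)) * (ep * (1 + N1 y)))).
    rewrite ler_pM //; [|by nneg|by rewrite ler_wpM2l].
    by rewrite mulr_ge0 // !addr_ge0 // N1_ge0.
  rewrite (_ : C * _ * _ = 2 * C * ep * (1 + N1 w) * (1 + N1 y) ^+ 2); last by ring.
  rewrite ler_wpM2r ?exprn_ge0 ?addr_ge0 // ler_wpM2l; [by []|by nneg|].
  by rewrite expr2 ler_peMr ?addr_ge0 // lerDl.
by rewrite gexpZ; [ring|exact: tame_N1poly].
Qed.

(** Both Gaussian vectors are obtained by scaling the same standard one, so their distance is
    controlled by that of the deviations. *)
Lemma sd_dist (D B : R) sg sg' : (forall s, 0 <= sg s <= B) -> (forall s, 0 <= sg' s <= B) ->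
  (forall s, `|sg s - sg' s| <= D) -> 0 <= B -> 0 <= D ->
  `|gexp sg psi - gexp sg' psi| <= C * (1 + 2 * B) * D * g1.
Proof.
move=> sB sB' sD B0 D0.
have tS (t : I -> R) : (forall s, 0 <= t s <= B) -> tame (fun y : I -> R => psi (fun s => t s * y s)).
  move=> tB; have := tame_subst (X := fun s (y : I -> R) => t s * y s) (a := B) (plip_tame psiP).
  apply => //; first by move=> u; exact: (tameZ (t u) (tame_var _ u)).1.
  move=> u y; have /andP[t0 t1] := tB u; rewrite normrM (ger0_norm t0).
  by rewrite (@le_trans _ _ (B * N1 y)) ?lerDr // ler_pM // le_N1.
have gE (t : I -> R) : gexp t psi = gexp (fun=> 1) (fun y => psi (fun s => t s * y s)).
  by rewrite -gexp_scale; congr gexp; apply/funext => s; rewrite mulr1.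
rewrite !gE -gexpB; [|exact: tS|exact: tS].
rewrite -gexpZ; last exact: tame_N1poly.
apply: gexp_norm_le; first by apply: tameB; exact: tS.
  by apply: tameZ; exact: tame_N1poly.
have nB (t : I -> R) y : (forall s, `|t s| <= B) -> N1 (fun s => t s * y s) <= B * N1 y.
  move=> tB; rewrite /N1 mulr_sumr; apply: ler_sum => s _.
  by rewrite normrM ler_wpM2r.
move=> y; have [_ hC] := psiP; rewrite (le_trans (hC _ _)) //.
have ny := N1_ge0 y.
have h0 : N1 (fun s => sg s * y s - sg' s * y s) <= D * N1 y.
  rewrite /N1 mulr_sumr; apply: ler_sum => s _.
  by rewrite -mulrBl normrM ler_wpM2r.
have h1 : N1 (fun s => sg s * y s) <= B * N1 y.
  by apply: nB => s; have /andP[h ?] := sB s; rewrite ger0_norm.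
have h2 : N1 (fun s => sg' s * y s) <= B * N1 y.
  by apply: nB => s; have /andP[h ?] := sB' s; rewrite ger0_norm.
apply: (@le_trans _ _ (C * ((1 + 2 * B) * (1 + N1 y)) * (D * (1 + N1 y)))); last first.
  by rewrite le_eqVlt; apply/orP; left; apply/eqP; ring.
have d1 : D * N1 y <= D * (1 + N1 y) by rewrite ler_wpM2l // lerDr.
rewrite ler_pM ?N1_ge0 ?(le_trans h0) //.
  by rewrite mulr_ge0 // !addr_ge0 // N1_ge0.
rewrite ler_wpM2l //.
rewrite (_ : _ * _ = 1 + 2 * B + N1 y + 2 * (B * N1 y)); last by ring.
by move: h1 h2; move: (B * N1 y) => Z *; lra.
Qed.

Theorem clt (M e : R) (nu : I -> R) : 0 <= M -> 0 < e -> (forall s, 0 <= nu s <= M) ->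
  exists (eta : R) (N : nat), 0 < eta /\
  forall (T : finType) (sd : T -> R) (E : eqType) (J : seq E) (supp : E -> T -> Prop)
    (X : E -> I -> (T -> R) -> R) (v : E -> I -> R),
  (forall b s, tame (X b s)) -> (forall b s, depends (supp b) (X b s)) ->
  uniq J -> (N <= size J)%N ->
  (forall b c, b \in J -> c \in J -> b != c -> forall t, supp b t -> ~ supp c t) ->
  (forall b, b \in J -> summand_ok M sd X v b) ->
  (forall s, `|(size J)%:R^-1 * \sum_(b <- J) v b s - nu s| <= eta) ->
  `|gexp sd (fun x => psi (fun s => (Num.sqrt (size J)%:R)^-1 * \sum_(b <- J) X b s x)) -
    gexp (fun s => Num.sqrt (nu s)) psi| <= e.
Proof.
move=> M0 e0 nuM.
pose B := Num.sqrt (1 + M); have B0 : 0 <= B by exact: sqrtr_ge0.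
have B2 : B ^+ 2 = 1 + M by rewrite sqr_sqrtr // addr_ge0.
pose K2 := (k + 1) * (1 + k * M).
have K20 : 0 <= K2 by rewrite /K2; nneg.
(* Coefficient of [ep] in the two errors that do not decrease with the number of summands: smoothing
   [psi], and passing from the deviations [sg'] to [Num.sqrt (nu s)]. *)
pose K := 2 * C * g1 * K2 + C * (1 + 2 * B) * 2 * g1.
have K0 : 0 <= K by rewrite /K; nneg.
pose ep := Num.min 1 (e / 2 / (K + 1)).
have ep0 : 0 < ep by rewrite lt_min ltr01 !divr_gt0 // ltr_wpDl.
have ep1 : ep <= 1 by rewrite ge_min lexx.
have epK : K * ep <= e / 2.
  apply: (@le_trans _ _ (K * (e / 2 / (K + 1)))).
    by rewrite ler_wpM2l // ge_min lexx orbT.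
  by rewrite mulrA ler_pdivrMr ?ltr_wpDl // mulrC ler_pM2l ?divr_gt0 // lerDl.
pose K3 := taylor_cst C psi ep B * ((k + 1) * (1 + k * B ^+ 2)) * (M + G3 I M).
have K30 : 0 <= K3.
  by have := tc_ge0 psiP B ep0; have := G3_ge0 I M; rewrite /K3 => ? ?; nneg.
(* Replacing [n] summands, each at cost [K3 * n^(-3/2)], costs [K3 / sqrt n]; this is at most
   [e / 2] once [n] exceeds [c]. *)
pose c := (2 * K3 / e) ^+ 2.
have c0 : 0 <= c by exact: sqr_ge0.
(* With this tolerance [sg' ^+ 2] differs from [nu] by at most [2 * ep ^+ 2]: one [ep ^+ 2] from the
   smoothing noise, one from the averaged variances. *)
exists (ep ^+ 2), (Num.bound c).+1; split; first by rewrite exprn_gt0.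
move=> T sd E J supp X v tX dX uJ NJ disj ok vnu.
set n := size J in NJ vnu *; have n0 : (0 < n)%N by exact: leq_trans NJ.
have nR0 : 0 < n%:R :> R by rewrite ltr0n.
set a := (Num.sqrt n%:R)^-1.
have a0 : 0 < a by rewrite invr_gt0 sqrtr_gt0.
have a2 : a ^+ 2 = n%:R^-1 by rewrite exprVn sqr_sqrtr ?ltW.
have v0 b s : b \in J -> 0 <= v b s <= M by move=> /ok[_ _ + _]; exact.
have avg0 s : 0 <= n%:R^-1 * \sum_(b <- J) v b s.
  rewrite mulr_ge0 // big_seq; apply: sumr_ge0 => b bJ; by have /andP[] := v0 b s bJ.
have avgM s : n%:R^-1 * \sum_(b <- J) v b s <= M.
  rewrite mulrC ler_pdivrMr // big_seq.
  apply: (@le_trans _ _ (\sum_(b <- J | b \in J) M)).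
    by apply: ler_sum => b bJ; have /andP[] := v0 b s bJ.
  by rewrite -big_seq big_const_seq count_predT iter_addr_0 mulr_natr.
pose sg' s := Num.sqrt (ep ^+ 2 + n%:R^-1 * \sum_(b <- J) v b s).
have sg'E s : sg' s ^+ 2 = ep ^+ 2 + a ^+ 2 * \sum_(b <- J) v b s.
  by rewrite a2 sqr_sqrtr // addr_ge0 ?sqr_ge0.
have sg'B s : 0 < sg' s <= B.
  rewrite sqrtr_gt0 ltr_pwDl ?exprn_gt0 //= ler_sqrt ?lerD // ?addr_ge0 //.
  by rewrite expr_le1 // ltW.
have := lindeberg_sum psiP ep0 M0 tX dX (ltW a0) uJ disj ok (fun=> lexx ep) sg'B sg'E.
rewrite -/n; set S := fun x => _ => step2.
pose W s x := a * \sum_(b <- J) X b s x.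
have tW s : tame (W s) by apply: tameZ; exact: tame_sum.
have W2 s : gexp sd (fun x => W s x ^+ 2) <= M.
  under eq_fun do rewrite exprMn.
  rewrite gexpZ; last by apply: tameX; exact: tame_sum.
  rewrite (gexp_sum_indep_sqr disj uJ (fun c => @tX c s) (fun c => @dX c s)); last by move=> b /ok[].
  rewrite a2; apply: le_trans (avgM s); rewrite ler_wpM2l ?invr_ge0 ?(ltW nR0) //.
  rewrite [leLHS]big_seq [leRHS]big_seq; apply: ler_sum => b /ok[_ EE _ _].
  by rewrite (_ : (fun x => _) = fun x => X b s x * X b s x) ?EE ?eqxx ?mul1r //;
    apply/funext => x; rewrite expr2.
have tpsiW : tame (fun x => psi (W ^~ x)).
  by apply: (tame_comp_poly (plip_mble psiP) (plip_growth psiP)).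
have step1 : `|gexp sd (fun x => psi (W ^~ x)) - gexp sd S| <= 2 * C * g1 * K2 * ep.
  rewrite -gexpB //; last exact: (tame_Phi_comp psiP (fun=> ep) tW).
  apply: (@le_trans _ _ (gexp sd (fun x => 2 * C * ep * g1 * (1 + N1 (W ^~ x)) ^+ 2))).
    apply: gexp_norm_le.
    - by apply: tameB => //; exact: (tame_Phi_comp psiP (fun=> ep) tW).
    - by apply: tameZ; exact: tame_N1poly_comp.
    - by move=> x; rewrite distrC; apply: smooth_dist; rewrite ep1 ltW.
  rewrite gexpZ; last exact: tame_N1poly_comp.
  rewrite (_ : 2 * C * g1 * K2 * ep = 2 * C * ep * g1 * K2); last by ring.
  rewrite ler_wpM2l; [by []|by nneg|exact: gexp_N1_sqr_le].
have step3 : `|Phi psi sg' (fun=> 0) - gexp (fun s => Num.sqrt (nu s)) psi| <= C * (1 + 2 * B) * (2 * ep) * g1.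
  rewrite (_ : Phi psi sg' (fun=> 0) = gexp sg' psi); last first.
    by congr gexp; apply/funext => y; congr psi; apply/funext => s; rewrite addr0.
  apply: sd_dist => //.
  - by move=> s; have /andP[h ->] := sg'B s; rewrite ltW.
  - move=> s; have /andP[h1 h2] := nuM s; rewrite sqrtr_ge0 ler_sqrt ?addr_ge0 //.
    by rewrite (le_trans h2) // lerDr.
  - move=> s; have := vnu s; rewrite -/n => vs.
    have /andP[g0 _] := sg'B s; have /andP[nu0 _] := nuM s.
    set y := Num.sqrt (nu s); have y0 : 0 <= y by exact: sqrtr_ge0.
    (* For nonnegative [x] and [y], [(x - y) ^+ 2] is at most [|x ^+ 2 - y ^+ 2|]. No division by
       [Num.sqrt (nu s)] occurs, and [nu s] may be zero. *)
    rewrite -(@ler_pXn2r _ 2) // ?nnegrE ?mulr_ge0 ?(ltW ep0) //.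
    apply: (@le_trans _ _ (`|sg' s ^+ 2 - y ^+ 2|)).
      rewrite subr_sqr normrM expr2 ler_wpM2l //.
      rewrite (ger0_norm (addr_ge0 (ltW g0) y0)) (le_trans (ler_normB _ _)) //.
      by rewrite (gtr0_norm g0) (ger0_norm y0).
    rewrite sg'E a2 sqr_sqrtr // -addrA (le_trans (ler_normD _ _)) //.
    rewrite (ger0_norm (sqr_ge0 ep)) (le_trans (lerD (lexx _) vs)) // exprMn.
    by have := sqr_ge0 ep; move: (ep ^+ 2) => Z *; lra.
  - by nneg.
have step2' : n%:R * (taylor_cst C psi ep B * a ^+ 3 * ((k + 1) * (1 + k * B ^+ 2)) * (M + G3 I M)) <= e / 2.
  have -> : n%:R * (taylor_cst C psi ep B * a ^+ 3 * ((k + 1) * (1 + k * B ^+ 2)) * (M + G3 I M)) = n%:R * a ^+ 2 * (K3 * a).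
    by rewrite /K3; ring.
  rewrite a2 mulfV ?gt_eqF // mul1r /a ler_pdivrMr ?sqrtr_gt0 //.
  rewrite -ler_pdivrMl ?divr_gt0 //.
  have -> : (e / 2)^-1 * K3 = 2 * K3 / e by field; rewrite gt_eqF.
  have k0 : 0 <= 2 * K3 / e by nneg.
  rewrite -(@ler_pXn2r _ 2) // ?nnegrE ?sqrtr_ge0 // sqr_sqrtr ?(ltW nR0) // -/c.
  by rewrite (le_trans (ltW (archi_boundP c0))) // ler_nat (leq_trans _ NJ).
rewrite (_ : _ - _ = (gexp sd (fun x => psi (W ^~ x)) - gexp sd S) + (gexp sd S - Phi psi sg' (fun=> 0)) +
  (Phi psi sg' (fun=> 0) - gexp (fun s => Num.sqrt (nu s)) psi)); last by rewrite /W; ring.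
rewrite (le_trans (ler_normD _ _)) // (le_trans (lerD (ler_normD _ _) (lexx _))) //.
have epK' : 2 * C * g1 * K2 * ep + C * (1 + 2 * B) * (2 * ep) * g1 <= e / 2.
  by rewrite (_ : _ + _ = K * ep) // /K; ring.
have := le_trans step2 step2'; move: step1 step3 epK'.
move: (2 * C * g1 * K2 * ep) (C * (1 + 2 * B) * (2 * ep) * g1) => Z1 Z2.
by move=> *; lra.
Qed.
End CentralLimit.

(** * Disjoint supports from the girth of the factor graph *)

Section Geometry.
Variables (r : nat) (V E : finType) (edge : E -> 'I_r -> V) (L : nat).
Hypothesis girth : no_short_cycle edge (4 * L + 4).
Implicit Types (x y a : V + E) (i j v : V) (b c : E).
Local Notation adj := (incid edge).

(** Walks that may repeat vertices, so that they concatenate freely. Avoiding [a] is what lets a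
    walk between two neighbours of [a] be closed into a cycle through [a]. *)
Definition reach n a x y := exists p : seq (V + E),
  [/\ path adj x p, last x p = y, (size p <= n)%N & a \notin x :: p].

Lemma incid_sym : symmetric adj.
Proof. by case=> ? []. Qed.

Lemma reach_le n m a x y : (n <= m)%N -> reach n a x y -> reach m a x y.
Proof. by move=> nm [p [? ? pn ?]]; exists p; split => //; exact: leq_trans nm. Qed.

Lemma reach_trans n m a x y z : reach n a x y -> reach m a y z -> reach (n + m) a x z.
Proof.
move=> [p [pp lp sp ap]] [q [pq lq sq aq]]; exists (p ++ q); split.
- by rewrite cat_path pp lp.
- by rewrite last_cat lp.
- by rewrite size_cat leq_add.
- by move: ap aq; rewrite !inE mem_cat !negb_or => /andP[-> ->] /andP[_ ->].
Qed.

Lemma reach_sym n a x y : reach n a x y -> reach n a y x.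
Proof.
move=> [p [pp lp sp ap]]; exists (rev (belast x p)); split.
- by rewrite -lp -(eq_path (e := fun u w => adj w u)) ?rev_path // => u w; rewrite incid_sym.
- by case: p {pp sp ap} lp => [|u p] //= _; rewrite rev_cons last_rcons.
- by rewrite size_rev size_belast.
- by rewrite -lp -rev_rcons -lastI mem_rev.
Qed.

Lemma reach_step a x y : adj x y -> x != a -> y != a -> reach 1 a x y.
Proof.
move=> xy xa ya; exists [:: y]; split => //=; first by rewrite xy.
by rewrite !inE negb_or (eq_sym a x) (eq_sym a y) xa ya.
Qed.

(** Shortening the walk to a simple path and closing it through [a] gives a cycle of at most [n + 2]
    vertices, against the girth. *)
Lemma no_cycle n a x y : adj a x -> adj a y -> x != y -> reach n a x y ->
  (n + 2 < 4 * L + 4)%N -> False.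
Proof.
move=> ax ay xy [p [pp lp sp ap]].
move: lp xy ap sp; case: (shortenP pp) => p' pp' up' sub lp xy ap sp ng.
have : (4 * L + 4 <= size (a :: x :: p'))%N.
  apply: girth => /=.
  - by case: p' {pp' up' sub} lp xy => //= ->; rewrite eqxx.
  - by rewrite ax rcons_path pp' lp incid_sym.
  - move: up' => /= ->; rewrite andbT; move: ap; rewrite !inE !negb_or => /andP[-> /=].
    by apply: contra => /sub.
have : (size (x :: p') <= size (x :: p))%N.
  apply: uniq_leq_size => // u; rewrite !inE => /orP[->//|/sub ->].
  by rewrite orbT.
by move=> /= h1 h2; lia.
Qed.

(* The vertices whose initial value the message z^l from j to b depends on. *)
Fixpoint ball l j b v : Prop :=
  if l is l'.+1 then ball l' j b v \/
    exists c k, [/\ inb edge j c, c != b, edge c k != j & ball l' (edge c k) c v]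
  else v = j.

(** The part of the tree seen from [i] through the factor [b]: the support of what [b] contributes
    to [i]. *)
Definition branch l i b v := exists k, edge b k != i /\ ball l (edge b k) b v.

Lemma ball_root l j b : ball l j b j.
Proof. by elim: l => //= l IH; left. Qed.

Lemma ball_mono l m j b v : (l <= m)%N -> ball l j b v -> ball m j b v.
Proof.
move=> /subnKC <-; elim: (m - l)%N => [|n IH] h; first by rewrite addn0.
by rewrite addnS; left; exact: IH.
Qed.

Lemma branch_mono l m i b v : (l <= m)%N -> branch l i b v -> branch m i b v.
Proof. by move=> lm [k [ki h]]; exists k; split => //; exact: ball_mono h. Qed.

Lemma ball_case l j b v : ball l j b v -> v = j \/
  exists s c, [/\ (s < l)%N, inb edge j c, c != b & branch s j c v].
Proof.
elim: l => [|l IH] /=; first by left.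
move=> [/IH[->|[s [c [sl jc cb h]]]]|[c [k [jc cb kj h]]]].
- by left.
- by right; exists s, c; split => //; exact: ltnW.
- by right; exists l, c; split => //; exists k.
Qed.

Lemma branch_ball l j b c v : inb edge j c -> c != b -> branch l j c v -> ball l.+1 j b v.
Proof. by move=> jc cb [k [kj h]]; right; exists c, k. Qed.

Lemma inb_edge c k : inb edge (edge c k) c.
Proof. by apply/existsP; exists k. Qed.

Lemma reach_split n a x y z : reach n a x y ->
  reach n z x y \/ reach n a x z.
Proof.
move=> [p [pp lp sp ap]]; case: (boolP (z \in x :: p)) => [|zp]; last by left; exists p.
move=> /splitPl zp; right; case: zp pp sp ap lp => p1 p2 lz.
rewrite cat_path size_cat => /andP[pp _] sp ap _; exists p1; split => //.
  exact: leq_trans (leq_addr _ _) sp.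
by move: ap; rewrite !inE mem_cat !negb_or => /and3P[-> ->].
Qed.

Lemma ball_reach l j b v : (l <= L)%N -> inb edge j b -> ball l j b v ->
  reach (2 * l) (inr b) (inl j) (inl v).
Proof.
elim: l j b v => [|l IH] j b v lL jb /=.
  by move=> ->; exists [::].
move=> [h|[c [k [jc cb kj h]]]].
  by apply: (reach_le _ (IH _ _ _ (ltnW lL) jb h)); rewrite leq_mul2l leqnSn orbT.
have := IH _ _ _ (ltnW lL) (inb_edge c k) h.
(* A walk beyond [c] that met [b] could be prolonged to [j], and would join two distinct neighbours
   of [c] without using [c]. *)
move=> /(reach_split (inr b))[h1|h1]; last first.
  exfalso; have h2 : reach 1 (inr c) (inr b) (inl j).
    by apply: reach_step => //; rewrite eq_sym.
  apply: (@no_cycle (2 * l + 1) (inr c) (inl (edge c k)) (inl j)) => //=.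
  - exact: inb_edge.
  - exact: (reach_trans h1 h2).
  - by rewrite -addnA; lia.
rewrite mulnS; apply: reach_trans h1; rewrite -[2%N]/(1 + 1)%N.
apply: (@reach_trans _ _ _ _ (inr c)); apply: reach_step => //=.
exact: inb_edge.
Qed.

(** A common vertex would join two neighbours of [b] by a walk of length at most [4 * L] avoiding
    [b], hence give a cycle of length at most [4 * L + 2]. The girth condition is calibrated on this
    case. *)
Lemma ball_disjoint l l' j j' b v : (l <= L)%N -> (l' <= L)%N ->
  inb edge j b -> inb edge j' b -> ball l j b v -> ball l' j' b v -> j = j'.
Proof.
move=> lL lL' jb jb' h h'; apply/eqP; apply/negP => /negP jj'.
have h1 := reach_trans (ball_reach lL jb h) (reach_sym (ball_reach lL' jb' h')).
by apply: (no_cycle (a := inr b) _ _ _ h1) => //; lia.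
Qed.

Lemma branch_root l i b : (l <= L)%N -> inb edge i b -> ~ branch l i b i.
Proof.
move=> lL ib [k [ki h]].
by have := ball_disjoint lL (leq0n L) (inb_edge b k) ib h (ball_root 0 i b); exact/eqP.
Qed.

(** The same argument with the cycle passing through the variable [i] and the two factors. *)
Lemma branch_disjoint l l' i b b' v : (l < L)%N -> (l' < L)%N ->
  inb edge i b -> inb edge i b' -> branch l i b v -> branch l' i b' v -> b = b'.
Proof.
have step m c w : (m < L)%N -> inb edge i c -> branch m i c w ->
    reach (1 + 2 * m) (inl i) (inr c) (inl w).
  move=> mL ic [k [ki h]].
  have := ball_reach (ltnW mL) (inb_edge c k) h.
  move=> /(reach_split (inl i))[h1|h1]; last first.
    exfalso; apply: (no_cycle _ _ _ h1) => //=; [exact: inb_edge|lia].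
  by apply: reach_trans h1; apply: reach_step => //=; exact: inb_edge.
move=> lL lL' ib ib' /(step _ _ _ lL ib) h /(step _ _ _ lL' ib') h'.
apply/eqP; apply/negP => /negP bb'.
by apply: (no_cycle (a := inl i) _ _ _ (reach_trans h (reach_sym h'))) => //; lia.
Qed.

End Geometry.

(** * Fourier coefficients, derivatives of [f] and the variances [nu] *)

Section Fourier.
Variables (R : realType) (r : nat) (f : {ffun 'I_r -> bool} -> bool).
Implicit Types (S : {set 'I_r}) (k : 'I_r) (y : 'I_r -> R).
Local Notation fh S := (fhat f S : R).

Lemma fhat_le1 S : `|fh S| <= 1.
Proof.
rewrite /fhat normrM normfV normrX normr_nat mulrC ler_pdivrMr ?exprn_gt0 // mul1r.
rewrite (le_trans (ler_norm_sum _ _ _)) //.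
rewrite (_ : 2 ^+ r = \sum_(x : {ffun 'I_r -> bool}) (1 : R)); last first.
  by rewrite sumr_const card_ffun card_bool card_ord natrX.
apply: ler_sum => x _; rewrite normrM normr_prod.
rewrite (_ : \prod_(k in S) _ = 1) ?mulr1; first by case: (f x); rewrite ?normr1 ?normr0.
by rewrite big1 // => k _; rewrite /pm; case: (x k); rewrite ?normrN normr1.
Qed.

Lemma dfmlE k y : dfml f k y = \sum_(S : {set 'I_r} | k \in S) fh S * \prod_(j in S :\ k) y j.
Proof.
pose A := \sum_(S : {set 'I_r} | k \in S) fh S * \prod_(j in S :\ k) y j.
pose B := \sum_(S : {set 'I_r} | k \notin S) fh S * \prod_(j in S) y j.
rewrite /dfml (_ : (fun t => _) = (fun t : R => A * t + B)); last first.
  apply/funext => t; rewrite /fml (bigID (fun S => k \in S)) /=; congr (_ + _).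
    rewrite mulr_suml; apply: eq_bigr => S kS.
    rewrite (big_setD1 k) //= eqxx mulrA mulrAC; congr (_ * _ * _).
    by apply: eq_bigr => j; rewrite !inE => /andP[/negbTE ->].
  apply: eq_bigr => S kS; congr (_ * _); apply: eq_bigr => j jS.
  by case: eqP => // jk; move: kS; rewrite -jk jS.
rewrite derive1E.
have -> : (fun t : R => A * t + B) = (A *: id) + cst B by apply/funext => t.
rewrite deriveD // derive_cst addr0 deriveZ // derive_id.
by rewrite /A [RHS](_ : _ = A) // -[RHS]mulr1.
Qed.

Variable delta : R.

(** Ideal variance of a contribution at position [k]: the value it takes if the second moments of
    [z^l] and [z^(l-1)] are exactly [l.+1 * delta] and [l * delta]. *)
Definition qinc l k : R := \sum_(S : {set 'I_r} | k \in S)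
  fh S ^+ 2 * ((l.+1%:R * delta) ^+ #|S|.-1 - (l%:R * delta) ^+ #|S|.-1).

Lemma xi_deriv (t : R) : (xi R f)^`().[t] = \sum_(S : {set 'I_r}) #|S|%:R * (fh S ^+ 2 * t ^+ #|S|.-1).
Proof.
rewrite /xi raddf_sum /= horner_sum.
transitivity (\sum_(1 <= j < r.+1) \sum_(S : {set 'I_r} | #|S| == j) #|S|%:R * (fh S ^+ 2 * t ^+ #|S|.-1)).
  apply: eq_bigr => j _; rewrite derivZ hornerZ derivXn hornerMn hornerXn mulr_suml.
  apply: eq_bigr => S /eqP ->; by rewrite mulr_natl mulrnAr.
rewrite (exchange_big_dep xpredT) //=; apply: eq_bigr => S _.
under eq_bigl do rewrite eq_sym.
have Sr : (#|S| <= r)%N by rewrite -[leqRHS](card_ord r) max_card.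
rewrite big_nat1_eq ltnS Sr andbT lt0n; case: eqP => // ->.
by rewrite mul0r.
Qed.

Lemma sum_position (h : {set 'I_r} -> R) :
  \sum_k \sum_(S : {set 'I_r} | k \in S) h S = \sum_(S : {set 'I_r}) #|S|%:R * h S.
Proof.
rewrite (exchange_big_dep xpredT) //=; apply: eq_bigr => S _.
by rewrite sumr_const mulr_natl.
Qed.

(** Summing over positions counts each [S] once for every element, which is the factor [#|S|]
    produced by differentiating [xi]. *)
Lemma nuE l : nu f delta l.+1 = r%:R^-1 * \sum_k qinc l k.
Proof.
rewrite /nu !xi_deriv /qinc sum_position -sumrB mulrC; congr (_ * _).
by apply: eq_bigr => S _; rewrite -mulrBr -mulrBr.
Qed.

Hypothesis delta0 : 0 < delta.

Lemma qinc_ge0 l k : 0 <= qinc l k.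
Proof.
apply: sumr_ge0 => S _; rewrite mulr_ge0 ?sqr_ge0 // subr_ge0.
by rewrite lerXn2r ?nnegrE ?mulr_ge0 ?(ltW delta0) // ler_wpM2r ?(ltW delta0) // ler_nat.
Qed.

Lemma nu_ge0 l : 0 <= nu f delta l.+1.
Proof. by rewrite nuE mulr_ge0 ?invr_ge0 // sumr_ge0 // => k _; exact: qinc_ge0. Qed.

Lemma nu_gt0 l S : (1 < #|S|)%N -> fh S != 0 -> 0 < nu f delta l.+1.
Proof.
move=> S1 fS; have [k kS] : exists k, k \in S by apply/card_gt0P; exact: ltnW.
rewrite nuE mulr_gt0 ?invr_gt0 ?ltr0n //; first exact: leq_ltn_trans (ltn_ord k).
rewrite (bigD1 k) //= ltr_wpDr ?sumr_ge0 // => [k' _|]; first exact: qinc_ge0.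
rewrite /qinc (bigD1 S) //= ltr_wpDr ?sumr_ge0 // => [S' _|].
  rewrite mulr_ge0 ?sqr_ge0 // subr_ge0.
  by rewrite lerXn2r ?nnegrE ?mulr_ge0 ?(ltW delta0) // ler_wpM2r ?(ltW delta0) // ler_nat.
rewrite mulr_gt0 ?exprn_even_gt0 //= subr_gt0 ltrXn2r ?mulr_ge0 ?(ltW delta0) //.
  by rewrite -lt0n -subn1 subn_gt0.
by rewrite ltr_pM2r // ltr_nat.
Qed.

(** The quotient [delta / nu] in (P2) is meaningful only for [nu] nonzero. Without degree-one
    coefficients, a surviving nonempty [S] has at least two elements, and its term in [nu] is then
    strictly positive. *)
Lemma fhat_degenerate : (forall S, #|S| = 1%N -> fh S = 0) ->
  (forall S, S != finset.set0 -> fh S = 0) \/ (forall l, 0 < nu f delta l.+1).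
Proof.
move=> f1; have [[S [S0 fS]]|no] := pselect (exists S, S != finset.set0 /\ fh S != 0).
  right=> l; apply: (@nu_gt0 l S) => //; rewrite ltn_neqAle card_gt0 S0 andbT eq_sym.
  by apply: contraNneq fS => /f1 ->.
by left=> S S0; apply/eqP; apply/negP => /negP fS; apply: no; exists S.
Qed.

End Fourier.

(** * Products, fourth moments and squares of independent variables *)

Section Independence.
Variables (R : realType) (T : finType) (sd : T -> R) (E : eqType).
Variables (supp : E -> T -> Prop).
Local Notation disjoint_on J := (forall b c, b \in J -> c \in J -> b != c ->
  forall t, supp b t -> ~ supp c t).

Lemma disjoint_cons b (J : seq E) : uniq (b :: J) -> disjoint_on (b :: J) ->
  disjoint_on J /\ forall t, supp b t -> ~ (exists2 c, c \in J & supp c t).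
Proof.
move=> /= /andP[bJ _] dis; split.
  by move=> c e cJ eJ; apply: dis; rewrite inE ?cJ ?eJ orbT.
move=> t bt [c cJ ct]; apply: (dis b c _ _ _ t bt ct); rewrite ?inE ?eqxx ?cJ ?orbT //.
by apply: contraNneq bJ => ->.
Qed.

Lemma gexp_prod (J : seq E) (G : E -> (T -> R) -> R) : uniq J -> disjoint_on J ->
  (forall b, tame (G b)) -> (forall b, depends (supp b) (G b)) ->
  gexp sd (fun x => \prod_(b <- J) G b x) = \prod_(b <- J) gexp sd (G b).
Proof.
elim: J => [|b J IH] uJ dis tG dG.
  by rewrite big_nil; under eq_fun do rewrite big_nil; rewrite gexp_cst.
have [disJ disb] := disjoint_cons uJ dis.
rewrite big_cons -IH //; last by case/andP: uJ.
under eq_fun do rewrite big_cons.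
apply: (gexpM sd _ _ (dG b) _ disb) => //; first exact: tame_prod.
move=> x y xy; rewrite big_seq [RHS]big_seq; apply: eq_bigr => c cJ.
by apply: dG => t ct; apply: xy; exists c.
Qed.

Lemma gexp_sqr_var (X : (T -> R) -> R) (q : R) : tame X -> q = gexp sd (fun x => X x ^+ 2) ->
  gexp sd (fun x => (X x ^+ 2 - q) ^+ 2) = gexp sd (fun x => X x ^+ 4) - q ^+ 2.
Proof.
move=> tX qE; transitivity (gexp sd (fun x => X x ^+ 4 + (- (2 * q) * X x ^+ 2 + q ^+ 2))).
  by congr gexp; apply/funext => x; ring.
have t2 : tame (fun x => - (2 * q) * X x ^+ 2) by apply: tameZ; exact: tameX.
rewrite gexpD; [|exact: tameX|by apply: tameD => //; exact: tame_cst].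
rewrite gexpD //; last exact: tame_cst.
by rewrite gexpZ ?gexp_cst -?qE; [ring|exact: tameX].
Qed.

Lemma gexp_sqr_le (X : (T -> R) -> R) : tame X ->
  gexp sd (fun x => X x ^+ 2) ^+ 2 <= gexp sd (fun x => X x ^+ 4).
Proof.
move=> tX; rewrite -subr_ge0 -(gexp_sqr_var tX erefl).
apply: gexp_ge0 => [|x]; last exact: sqr_ge0.
by apply: tameX; apply: tameB; [exact: tameX|exact: tame_cst].
Qed.

Variables (J : seq E) (X : E -> (T -> R) -> R) (M : R).
Hypotheses (uJ : uniq J) (dis : disjoint_on J).
Hypotheses (tX : forall b, tame (X b)) (dX : forall b, depends (supp b) (X b)).
Hypothesis XM : forall b, b \in J -> gexp sd (fun x => X b x ^+ 4) <= M.

(** Expanding [(X + S) ^+ 4], the terms in [X ^+ 3 * S] and [X * S ^+ 3] vanish by centring, and the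
    middle one costs at most [6 * n * M]. The total fits since [3 * (n + 1) ^+ 2] exceeds
    [3 * n ^+ 2] by [6 * n + 3]. *)
Lemma gexp_sum_pow4_le : (forall b, b \in J -> gexp sd (X b) = 0) ->
  gexp sd (fun x => (\sum_(b <- J) X b x) ^+ 4) <= 3 * (size J)%:R ^+ 2 * M.
Proof.
elim: J uJ dis XM => [|b s IH] us ds Xs X0.
  by under eq_fun do rewrite big_nil expr0n; rewrite gexp_cst /= expr0n mulr0 mul0r.
have [dJ db] := disjoint_cons us ds.
have us' : uniq s by case/andP: us.
have sb c : c \in s -> c \in b :: s by move=> cs; rewrite inE cs orbT.
have M0 : 0 <= M.
  apply: (le_trans _ (Xs b (mem_head _ _))); apply: gexp_ge0; first exact: tameX.
  by move=> x; rewrite exprn_even_ge0.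
pose S x := \sum_(c <- s) X c x.
have tS : tame S by exact: tame_sum.
have dS : depends (fun t => exists2 c, c \in s & supp c t) S.
  move=> x y xy; rewrite /S big_seq [RHS]big_seq; apply: eq_bigr => c cs.
  by apply: dX => t ct; apply: xy; exists c.
have dp (g : (T -> R) -> R) A n : depends A g -> depends A (fun x => g x ^+ n).
  by move=> gA; exact: (depends_comp (fun u => u ^+ n)).
have EM m n : gexp sd (fun x => X b x ^+ m * S x ^+ n) =
    gexp sd (fun x => X b x ^+ m) * gexp sd (fun x => S x ^+ n).
  exact: (gexpM sd (tameX m (tX b)) (tameX n tS) (dp _ _ m (@dX b)) (dp _ _ n dS) db).
have ES : gexp sd (fun x => S x ^+ 1) = 0.
  by rewrite /S gexp_sum // big_seq big1 // => c /sb /X0.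
have Eb : gexp sd (fun x => X b x ^+ 1) = 0 by exact: (X0 b (mem_head _ _)).
have sqM c : c \in b :: s -> gexp sd (fun x => X c x ^+ 2) ^+ 2 <= M.
  by move=> cs; exact: le_trans (gexp_sqr_le (tX c)) (Xs c cs).
have E2 : gexp sd (fun x => X b x ^+ 2) * gexp sd (fun x => S x ^+ 2) <= (size s)%:R * M.
  rewrite (gexp_sum_indep_sqr dJ us' tX dX) => [|c /sb /X0 //].
  rewrite mulr_sumr mulr_natl -iter_addr_0 -[X in iter X](count_predT s) -big_const_seq.
  rewrite big_seq [leRHS]big_seq; apply: ler_sum => c cs.
  have := sqM b (mem_head _ _); have := sqM c (sb c cs).
  move: (gexp _ _) (gexp _ _) => u w hu hw.
  by have := sqr_ge0 (u - w); rewrite sqrrB; lra.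
apply: (@le_trans _ _ (gexp sd (fun x => X b x ^+ 4 + 4 * (X b x ^+ 3 * S x ^+ 1) +
    6 * (X b x ^+ 2 * S x ^+ 2) + 4 * (X b x ^+ 1 * S x ^+ 3) + S x ^+ 4))).
  by rewrite le_eqVlt; apply/orP; left; apply/eqP; congr gexp; apply/funext => x; rewrite big_cons -/(S x); ring.
have tm m n k : tame (fun x => k * (X b x ^+ m * S x ^+ n)).
  by apply: tameZ; apply: tameM; exact: tameX.
have t4 : tame (fun x => X b x ^+ 4) by exact: tameX.
rewrite gexpD; [|by do 3 apply: tameD => //|exact: tameX].
rewrite gexpD //; last by do 2 apply: tameD => //.
rewrite gexpD //; last exact: tameD.
rewrite gexpD //.
rewrite !gexpZ; try (by apply: tameM; exact: tameX).
rewrite !EM ES Eb mulr0 mul0r !mulr0 !addr0.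
have h1 : gexp sd (fun x => S x ^+ 4) <= 3 * (size s)%:R ^+ 2 * M := IH us' dJ (fun c cs => Xs c (sb c cs)) (fun c cs => X0 c (sb c cs)).
have h2 := Xs b (mem_head _ _).
rewrite /= -[(size s).+1%:R]natr1; move: E2 h1 h2.
move: (gexp _ _ * _) => u2.
rewrite (_ : 3 * (_ + 1) ^+ 2 * M = 3 * (size s)%:R ^+ 2 * M + 6 * ((size s)%:R * M) + 3 * M); last by ring.
by move: (3 * (size s)%:R ^+ 2 * M) ((size s)%:R * M) => *; lra.
Qed.

(* Weak law of large numbers for the squares, in L^1. *)
Lemma gexp_avg_sqr_dist : (0 < size J)%N ->
  gexp sd (fun x => `|(size J)%:R^-1 * \sum_(b <- J) X b x ^+ 2 -
     (size J)%:R^-1 * \sum_(b <- J) gexp sd (fun x => X b x ^+ 2)|) <=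
  (M + 1) / 2 * (Num.sqrt (size J)%:R)^-1.
Proof.
move=> n0; set n := size J in n0 *; have nR : 0 < n%:R :> R by rewrite ltr0n.
pose s : R := Num.sqrt n%:R; have s0 : 0 < s by rewrite sqrtr_gt0.
have s2 : s ^+ 2 = n%:R by rewrite sqr_sqrtr // ltW.
pose q b := gexp sd (fun x => X b x ^+ 2).
pose Z b x := X b x ^+ 2 - q b.
have tZ b : tame (Z b) by apply: tameB; [exact: tameX|exact: tame_cst].
have dZ b : depends (supp b) (Z b).
  by apply: dependsB => //; exact: (depends_comp (fun u => u ^+ 2)).
have EZ b : gexp sd (Z b) = 0.
  by rewrite gexpB ?gexp_cst ?subrr //; [exact: tameX|exact: tame_cst].
have EZ2 b : b \in J -> gexp sd (fun x => Z b x ^+ 2) <= M.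
  move=> bJ; apply: le_trans (XM bJ); rewrite (gexp_sqr_var (@tX b) erefl).
  by rewrite gerBl sqr_ge0.
have ES : gexp sd (fun x => (\sum_(b <- J) Z b x) ^+ 2) <= n%:R * M.
  rewrite (gexp_sum_indep_sqr dis uJ tZ dZ) => [|b _]; last exact: EZ.
  rewrite mulr_natl -iter_addr_0 /n -[X in iter X](count_predT J) -big_const_seq.
  by rewrite big_seq [leRHS]big_seq; apply: ler_sum.
have tS : tame (fun x => \sum_(b <- J) Z b x) by exact: tame_sum.
(* Young's inequality at the scale [s], the square root of [n], takes the place of Cauchy--Schwarz:
   the second moment of the sum is at most [n * M], so both terms are of order [1 / s]. *)
apply: (@le_trans _ _ (gexp sd (fun x => (2 * s)^-1 + (2 * s * n%:R)^-1 * (\sum_(b <- J) Z b x) ^+ 2))).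
  apply: le_gexp.
  - apply: tame_norm; apply: tameB; last exact: tame_cst.
    by apply: tameZ; apply: tame_sum => b; exact: tameX.
  - by apply: tameD; [exact: tame_cst|apply: tameZ; exact: tameX].
  move=> x; rewrite -mulrBr -sumrB -/(Z _ x) (eq_bigr (Z ^~ x)) //.
  move: (\sum_(b <- J) Z b x) => z; rewrite normrM ger0_norm ?invr_ge0 ?(ltW nR) //.
  rewrite -s2 -(@real_normK _ z) ?num_real //.
  have -> : (2 * s)^-1 + (2 * s * s ^+ 2)^-1 * `|z| ^+ 2 =
    (2 * s)^-1 * (1 - s^-1 * `|z|) ^+ 2 + (s ^+ 2)^-1 * `|z| by field; rewrite gt_eqF.
  by rewrite lerDr mulr_ge0 ?sqr_ge0 // invr_ge0 mulr_ge0 // ltW.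
rewrite gexpD ?gexp_cst; [|exact: tame_cst|by apply: tameZ; exact: tameX].
rewrite gexpZ; last exact: tameX.
apply: (@le_trans _ _ ((2 * s)^-1 + (2 * s * n%:R)^-1 * (n%:R * M))).
  rewrite lerD2l ler_wpM2l // invr_ge0 !mulr_ge0 // ltW //.
by rewrite le_eqVlt; apply/orP; left; apply/eqP; rewrite -/s; field; rewrite !gt_eqF.
Qed.

End Independence.

(** * The messages as functions of the initial Gaussians *)

Section Messages.
Variables (R : realType) (r : nat) (f : {ffun 'I_r -> bool} -> bool).
Variables (V E : finType) (edge : E -> 'I_r -> V) (d L : nat) (K : R).
Variable Fto : forall l : nat, l.-tuple R -> R.
Arguments Fto : clear implicits.
Implicit Types (x : V -> R) (i j v : V) (b c : E) (k : 'I_r) (B : V -> Prop).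
Hypothesis edge_inj : forall b, injective (edge b).
Hypothesis girth : no_short_cycle edge (4 * L + 4).
Hypothesis fhat1 : forall S : {set 'I_r}, #|S| = 1%N -> (fhat f S : R) = 0.
Hypothesis FtoP : forall l, (l < L)%N ->
  measurable_fun setT (Fto l) /\ forall y, `|Fto l y| <= K.

(* With x = z^0: [wm], [um], [Am], [zm] at (l, i, b) are the messages w^l, u^l,
   A^l, z^l from i to b. The process z^l has increments [inc] (where z^(-1) = 0),
   and [Ym] is what b contributes to the increment u^(l+1) of its vertex i. *)
Definition wm l i b x : R := W f edge d Fto x l l i b.
Definition um l i b x : R := wm l i b x - wm l.-1 i b x.
Definition Am l i b x : R := Fto l [tuple um k.+1 i b x | k < l].
Definition zm l j b x : R := x j + \sum_(0 <= s < l) Am s j b x * um s.+1 j b x.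
Definition zp l j b x : R := if l is l'.+1 then zm l' j b x else 0.
Definition inc l j b x : R := if l is l'.+1 then Am l' j b x * um l j b x else x j.
Definition Ym l i b x : R :=
  Dif f edge i b (fun k => zm l (edge b k) b x) - Dif f edge i b (fun k => zp l (edge b k) b x).

Lemma W_le s l x : (s <= l)%N -> W f edge d Fto x l s = W f edge d Fto x s s.
Proof.
move=> /subnKC <-; elim: (l - s)%N => [|n IH]; first by rewrite addn0.
apply/funext => i; apply/funext => b; rewrite addnS /= leq_addr.
by rewrite IH.
Qed.

Lemma umsg_um s l i b x : (s <= l)%N -> umsg (W f edge d Fto x l) s i b = um s i b x.
Proof. by move=> sl; rewrite /umsg /um /wm !W_le // (leq_trans (leq_pred s)). Qed.

Lemma zmsgE l j b x : zmsg Fto x (W f edge d Fto x l) l j b = zm l j b x.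
Proof.
rewrite /zmsg /zm; congr (_ + _); rewrite !big_nat; apply: eq_bigr => s /andP[_ sl].
rewrite umsg_um //; congr (_ * _); congr (Fto s _); apply: eq_mktuple => k.
by rewrite umsg_um // (leq_trans (ltn_ord k)) // ltnW.
Qed.

Lemma wmS l i a x : wm l.+1 i a x = (Num.sqrt d.-1%:R)^-1 *
  \sum_(b | inb edge i b && (b != a)) Dif f edge i b (fun k => zm l (edge b k) b x).
Proof.
rewrite /wm /= ltnn /wnew; congr (_ * _); apply: eq_bigr => b _; congr Dif.
by apply/funext => k; rewrite zmsgE.
Qed.

Lemma Dif_pos b k (y : 'I_r -> R) : Dif f edge (edge b k) b y = dfml f k y.
Proof. by rewrite /Dif (big_pred1 k) // => k'; rewrite (inj_eq (@edge_inj b)). Qed.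

(** At the origin the derivative reduces to a degree-one coefficient. Its vanishing makes [w^0 = 0]
    agree with the convention [z^(-1) = 0], so that [umS] holds from [l = 0] on. *)
Lemma Dif0 i b : Dif f edge i b (fun=> 0) = 0 :> R.
Proof.
rewrite /Dif big1 // => k _; rewrite dfmlE big1 // => S kS.
have [S1|S1] := eqVneq #|S| 1%N; first by rewrite fhat1 // mul0r.
have [j jS] : exists j : 'I_r, j \in S :\ k.
  apply/card_gt0P; move: S1; rewrite (cardsD1 k) kS.
  by case: (#|_|).
by rewrite (bigD1 j) //= mul0r mulr0.
Qed.

Lemma umS l i a x : um l.+1 i a x = (Num.sqrt d.-1%:R)^-1 *
  \sum_(b | inb edge i b && (b != a)) Ym l i b x.
Proof.
rewrite /um wmS /= /Ym sumrB mulrBr; congr (_ - _); case: l => [|l]; last by rewrite wmS.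
by rewrite /wm /= big1 ?mulr0 // => b _; exact: Dif0.
Qed.

Lemma u_msgE l s i a x : (s <= l)%N -> u_msg f edge d Fto x l s i a = um s i a x.
Proof. exact: umsg_um. Qed.

Lemma u_nodeE l s i x : (s < l)%N -> u_node f edge d Fto x l s.+1 i =
  (Num.sqrt d%:R)^-1 * \sum_(b | inb edge i b) Ym s i b x.
Proof.
move=> sl; have e t : (t <= l)%N -> \sum_(b | inb edge i b)
    Dif f edge i b (fun k => zmsg Fto x (W f edge d Fto x l) t (edge b k) b) =
    \sum_(b | inb edge i b) Dif f edge i b (fun k => zm t (edge b k) b x).
  move=> tl; apply: eq_bigr => b _; congr Dif; apply/funext => k.
  rewrite -zmsgE /zmsg; congr (_ + _); rewrite !big_nat; apply: eq_bigr => u /andP[_ ut].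
  have ul : (u < l)%N by exact: leq_trans tl.
  rewrite !umsg_um //; congr (_ * _); congr (Fto u _); apply: eq_mktuple => m.
  by rewrite !umsg_um // (ltn_trans (ltn_ord m)).
rewrite /u_node /w_node /= e; last exact: ltnW.
rewrite /Ym sumrB mulrBr; congr (_ - _); case: s sl => [|s] sl /=; last first.
  by rewrite e // ltnW // ltnW.
by rewrite big1 ?mulr0 // => b _; exact: Dif0.
Qed.

Lemma A_msgE l i a x : A_msg f edge d Fto x l i a = Am l i a x.
Proof.
rewrite /A_msg /Am; congr (Fto l _); apply: eq_mktuple => k.
by rewrite u_msgE // ltn_ord.
Qed.

Lemma zmS l j b x : zm l.+1 j b x = zm l j b x + Am l j b x * um l.+1 j b x.
Proof. by rewrite /zm big_nat_recr //= addrA. Qed.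

Lemma zm_inc l j b x : zm l j b x = zp l j b x + inc l j b x.
Proof.
case: l => [|l] /=; last exact: zmS.
by rewrite /zm big_geq // addr0 add0r.
Qed.

Lemma YmE l b k x : Ym l (edge b k) b x = \sum_(S : {set 'I_r} | k \in S)
  fhat f S * (\prod_(j in S :\ k) zm l (edge b j) b x - \prod_(j in S :\ k) zp l (edge b j) b x).
Proof.
rewrite /Ym !Dif_pos !dfmlE -sumrB; apply: eq_bigr => S _; by rewrite mulrBr.
Qed.

Lemma tame_Am0 l i b : (l < L)%N -> (forall s, (s <= l)%N -> tame (um s i b)) -> tame (Am l i b).
Proof.
move=> lL tu; have [mF bF] := FtoP lL.
apply: (tame_dom _ (tame_cst _ K)); last by move=> x; exact: bF.
move=> dd Om X mX; apply: (measurableT_comp mF).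
apply/measurable_fun_tnthP => k.
rewrite (_ : _ \o _ = (fun o => um k.+1 i b (X o))); last first.
  by apply/funext => o /=; rewrite tnth_mktuple.
by apply: (tu _ _).1 => //; exact: ltn_ord.
Qed.

Lemma tame_Dif i b (z : 'I_r -> (V -> R) -> R) : (forall k, tame (z k)) ->
  tame (fun x => Dif f edge i b (fun k => z k x)).
Proof.
move=> tz; apply: tame_sum => k; under eq_fun do rewrite dfmlE.
by apply: tame_sum => S; apply: tameZ; exact: tame_prod.
Qed.

Lemma tame_wm_zm l : (l <= L)%N ->
  (forall s i b, (s <= l)%N -> tame (wm s i b)) /\ (forall j b, tame (zm l j b)).
Proof.
elim: l => [|l IH] lL.
  split=> [s i b|j b].
    by rewrite leqn0 => /eqP ->; exact: (tame_cst _ 0).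
  have -> : zm 0 j b = fun x => x j by apply/funext => x; rewrite /zm big_geq // addr0.
  exact: tame_var.
have [tw tz] := IH (ltnW lL).
have tw' s i b : (s <= l.+1)%N -> tame (wm s i b).
  rewrite leq_eqVlt => /orP[/eqP ->|]; last exact: tw.
  have -> : wm l.+1 i b = fun x => (Num.sqrt d.-1%:R)^-1 * \sum_(c | inb edge i c && (c != b))
      Dif f edge i c (fun k => zm l (edge c k) c x) by apply/funext => x; exact: wmS.
  by apply: tameZ; apply: tame_sum => c; exact: tame_Dif.
split=> // j b.
have -> : zm l.+1 j b = fun x => zm l j b x + Am l j b x * um l.+1 j b x.
  by apply/funext => x; exact: zmS.
have tu s : (s <= l.+1)%N -> tame (um s j b).
  by move=> sl; apply: tameB; apply: tw' => //; exact: leq_trans (leq_pred s) sl.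
apply: tameD => //; apply: tameM; last exact: tu.
by apply: tame_Am0 => // s sl; apply: tu; exact: leqW.
Qed.

Lemma tame_zm l j b : (l <= L)%N -> tame (zm l j b).
Proof. by move=> /tame_wm_zm[_]; exact. Qed.

Lemma tame_zp l j b : (l <= L)%N -> tame (zp l j b).
Proof. by case: l => [|l] lL; [exact: tame_cst|apply: tame_zm; exact: ltnW]. Qed.

Lemma tame_um l i b : (l <= L)%N -> tame (um l i b).
Proof.
move=> lL; have [tw _] := tame_wm_zm lL.
by apply: tameB; apply: tw => //; exact: leq_pred.
Qed.

Lemma tame_Am l i b : (l < L)%N -> tame (Am l i b).
Proof.
move=> lL; apply: tame_Am0 => // s sl; apply: tame_um.
exact: leq_trans sl (ltnW lL).
Qed.

Lemma tame_inc l j b : (l <= L)%N -> tame (inc l j b).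
Proof.
case: l => [|l] lL; first exact: tame_var.
by apply: tameM; [exact: tame_Am|exact: tame_um].
Qed.

Lemma tame_Ym l i b : (l <= L)%N -> tame (Ym l i b).
Proof.
by move=> lL; apply: tameB; apply: tame_Dif => k; [exact: tame_zm|exact: tame_zp].
Qed.

(** By multilinearity the derivative ignores the coordinate of [i]. Hence the message from [i]
    itself to [b] does not enter [Ym l i b], whose support avoids the rest of the tree at [i]. *)
Lemma Dif_ext i b (y y' : 'I_r -> R) : (forall k, edge b k != i -> y k = y' k) ->
  Dif f edge i b y = Dif f edge i b y'.
Proof.
move=> yy; apply: eq_bigr => k /eqP ki; rewrite !dfmlE; apply: eq_bigr => S kS.
congr (_ * _); apply: eq_bigr => j; rewrite !inE => /andP[jk _].
by apply: yy; rewrite -ki (inj_eq (@edge_inj b)).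
Qed.

Lemma depends_wm_zm l j b : (forall s, (s <= l)%N -> depends (ball edge l j b) (wm s j b)) /\
  depends (ball edge l j b) (zm l j b).
Proof.
elim: l j b => [|l IH] j b.
  split=> [s|]; first by rewrite leqn0 => /eqP ->.
  by move=> x y xy; rewrite /zm !big_geq // !addr0; exact: xy.
have [dw dz] := IH j b.
have dw' s : (s <= l.+1)%N -> depends (ball edge l.+1 j b) (wm s j b).
  rewrite leq_eqVlt => /orP[/eqP ->|sl]; last first.
    by apply: depends_sub (dw s sl) => v; left.
  move=> x y xy; rewrite (wmS l j b x) (wmS l j b y); apply: f_equal.
  apply: eq_bigr => c /andP[jc cb].
  apply: Dif_ext => k kj; apply: (IH (edge c k) c).2 => v h; apply: xy.
  by right; exists c, k.
split=> // x y xy; rewrite !zmS (dz x y); last by move=> v h; apply: xy; left.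
have du s : (s <= l.+1)%N -> um s j b x = um s j b y.
  move=> sl; rewrite /um (dw' s sl x y xy) (dw' s.-1 _ x y xy) //.
  exact: leq_trans (leq_pred s) sl.
congr (_ + _ * _); last exact: du.
congr (Fto l _); apply: eq_mktuple => k; apply: du.
by rewrite ltnS ltnW.
Qed.

Lemma depends_zm l j b : depends (ball edge l j b) (zm l j b).
Proof. exact: (depends_wm_zm l j b).2. Qed.

Definition pball l j b v : Prop := if l is l'.+1 then ball edge l' j b v else False.

Lemma pball_ball l j b v : pball l j b v -> ball edge l j b v.
Proof. by case: l => //= l; left. Qed.

Lemma depends_zp l j b : depends (pball l j b) (zp l j b).
Proof. by case: l => [|l] //=; exact: depends_zm. Qed.

Lemma depends_um l j b : depends (ball edge l j b) (um l j b).
Proof.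
have [dw _] := depends_wm_zm l j b.
by apply: dependsB; apply: dw => //; exact: leq_pred.
Qed.

Lemma depends_Am l j b : depends (ball edge l j b) (Am l j b).
Proof.
move=> x y xy; congr (Fto l _); apply: eq_mktuple => k.
apply: depends_um => v h; apply: xy; exact: ball_mono h.
Qed.

Lemma depends_Ym l i b : depends (branch edge l i b) (Ym l i b).
Proof.
move=> x y xy; rewrite /Ym.
have -> : Dif f edge i b (fun k => zm l (edge b k) b x) = Dif f edge i b (fun k => zm l (edge b k) b y).
  by apply: Dif_ext => k ki; apply: depends_zm => v h; apply: xy; exists k.
apply: f_equal; apply: f_equal.
by apply: Dif_ext => k ki; apply: depends_zp => v /pball_ball h; apply: xy; exists k.
Qed.

Definition pbranch l i b v : Prop := exists k, edge b k != i /\ pball l (edge b k) b v.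

(** * Orthogonality of the increments *)

Variable delta : R.
Local Notation ball := (ball edge).
Local Notation branch := (branch edge).
Local Notation Ex := (gexp (fun _ : V => Num.sqrt delta)).

Lemma edge_ball_inj l l' b k k' v : (l <= L)%N -> (l' <= L)%N ->
  ball l (edge b k) b v -> ball l' (edge b k') b v -> k = k'.
Proof.
move=> lL lL' h h'; apply: (@edge_inj b).
exact: (ball_disjoint girth lL lL' (inb_edge _ _ _) (inb_edge _ _ _) h h').
Qed.

(** A martingale-difference property expressed by test functions instead of conditional
    expectations. Allowing every such [g] closes the induction, since [g] can absorb [A^l] and the
    other factors of a product. *)
Definition inc_orth l := forall j b (g : (V -> R) -> R) B, inb edge j b -> tame g ->
  depends B g -> (forall v, B v -> ball l j b v -> pball l j b v) ->
  Ex (fun x => g x * inc l j b x) = 0.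

Definition Ym_orth l := forall i b (g : (V -> R) -> R) B, inb edge i b -> tame g ->
  depends B g -> (forall v, B v -> branch l i b v -> pbranch l i b v) ->
  Ex (fun x => g x * Ym l i b x) = 0.

(* Telescoping: the product of the [z]'s minus that of the [zp]'s is a sum of
   terms carrying exactly one increment, at a vertex met by no other factor. *)
Lemma prod_orth l b (s : seq 'I_r) (g : (V -> R) -> R) B : (l <= L)%N -> inc_orth l ->
  uniq s -> tame g -> depends B g ->
  (forall k v, k \in s -> B v -> ball l (edge b k) b v -> pball l (edge b k) b v) ->
  Ex (fun x => g x * (\prod_(k <- s) zm l (edge b k) b x - \prod_(k <- s) zp l (edge b k) b x)) = 0.
Proof.
move=> lL Pl; elim: s g B => [|k s IH] g B.
  move=> _ _ _ _; transitivity (Ex (fun=> 0)); last exact: gexp_cst.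
  by congr gexp; apply/funext => x; rewrite !big_nil subrr mulr0.
move=> /= /andP[ks us] tg gB Bs.
pose D x := \prod_(m <- s) zm l (edge b m) b x - \prod_(m <- s) zp l (edge b m) b x.
pose P x := \prod_(m <- s) zp l (edge b m) b x.
have tP : tame P by apply: tame_prod => m; exact: tame_zp.
have tD : tame D by apply: tameB => //; apply: tame_prod => m; exact: tame_zm.
transitivity (Ex (fun x => g x * zm l (edge b k) b x * D x + g x * P x * inc l (edge b k) b x)).
  congr gexp; apply/funext => x; rewrite !big_cons /D /P.
  rewrite [zm l (edge b k) b x]zm_inc; ring.
have t1 : tame (fun x => g x * zm l (edge b k) b x) by apply: tameM => //; exact: tame_zm.
have t2 : tame (fun x => g x * P x) by exact: tameM.
rewrite gexpD; [|exact: tameM|apply: tameM => //; exact: tame_inc].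
rewrite (IH _ (fun v => B v \/ ball l (edge b k) b v)) //; last 2 first.
- apply: dependsM; first by apply: depends_sub gB => v; left.
  by apply: depends_sub (@depends_zm l (edge b k) b) => v; right.
- move=> m v ms [Bv|kv] mv; first by apply: Bs => //; rewrite inE ms orbT.
  by move: ks; rewrite (edge_ball_inj lL lL kv mv) ms.
rewrite add0r; apply: (Pl _ _ _ (fun v => B v \/ exists2 m, m \in s & pball l (edge b m) b v)) => //.
- exact: inb_edge.
- apply: dependsM; first by apply: depends_sub gB => v; left.
  move=> x y xy; rewrite /P big_seq [RHS]big_seq; apply: eq_bigr => m ms.
  by apply: depends_zp => v h; apply: xy; right; exists m.
move=> v [Bv kv|[m ms /pball_ball mv] kv]; first by apply: Bs => //; exact: mem_head.
by move: ks; rewrite (edge_ball_inj lL lL kv mv) ms.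
Qed.

Lemma Ym_orth_of l : (l <= L)%N -> inc_orth l -> Ym_orth l.
Proof.
move=> lL Pl i b g B /existsP[k0 /eqP <-] tg gB Bb.
pose F S x := g x * (\prod_(j in S :\ k0) zm l (edge b j) b x - \prod_(j in S :\ k0) zp l (edge b j) b x).
have tF S : tame (F S).
  by apply: tameM => //; apply: tameB; apply: tame_prod => k; [exact: tame_zm|exact: tame_zp].
transitivity (Ex (fun x => \sum_(S : {set 'I_r} | k0 \in S) fhat f S * F S x)).
  congr gexp; apply/funext => x; rewrite YmE // mulr_sumr.
  by apply: eq_bigr => S _; rewrite mulrCA.
rewrite gexp_sum; last by move=> S; exact: tameZ.
rewrite big1 // => S kS; rewrite gexpZ //.
rewrite (_ : Ex (F S) = 0) ?mulr0 //.
rewrite -(@prod_orth l b (enum (S :\ k0)) g B lL Pl (enum_uniq _) tg gB).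
  by congr gexp; apply/funext => x; rewrite !big_enum.
move=> k v; rewrite mem_enum !inE => /andP[kk0 _] Bv kv.
have [|k' [k'i k'v]] := Bb v Bv; first by exists k; rewrite (inj_eq (@edge_inj b)).
by rewrite (edge_ball_inj lL lL kv (pball_ball k'v)).
Qed.

(** The message from [j] at level [l] has explored each branch at [j] only to lower levels. This is
    why [A^l] may be put into the test function against the contribution of [c]. *)
Lemma ball_pbranch l j b c v : (l < L)%N -> inb edge j c ->
  ball l j b v -> branch l j c v -> pbranch l j c v.
Proof.
move=> lL jc bv cv; have [vj|[s [c' [sl jc' _ c'v]]]] := ball_case bv.
  by exfalso; apply: (branch_root girth (ltnW lL) jc); rewrite -{2}vj.
have cc := branch_disjoint girth lL (ltn_trans sl lL) jc jc' cv c'v.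
rewrite -cc in c'v; case: c'v => k [kj kv]; exists k; split => //.
by clear -sl kv; case: l sl => // l sl; exact: ball_mono kv.
Qed.

Lemma inc_orth0 : inc_orth 0.
Proof.
move=> j b g B jb tg gB Bv /=.
rewrite (gexpM _ tg (tame_var _ j) gB (depends_var (A := fun v => v = j) erefl)).
  by rewrite gexp_var_mean mulr0.
by move=> v /Bv h vj; exact: (h vj).
Qed.

Lemma inc_orthS l : (l < L)%N -> Ym_orth l -> inc_orth l.+1.
Proof.
move=> lL Rl j b g B jb tg gB Bv.
have tA : tame (Am l j b) by exact: (tame_Am j b lL).
pose h x := g x * Am l j b x * (Num.sqrt d.-1%:R)^-1.
have th : tame h by apply: tameM; [exact: tameM|exact: tame_cst].
have dh : depends (fun v => B v \/ ball l j b v) h.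
  apply: dependsM => //; apply: dependsM; first by apply: depends_sub gB => v; left.
  by apply: depends_sub (@depends_Am l j b) => v; right.
transitivity (Ex (fun x => \sum_(c | inb edge j c && (c != b)) h x * Ym l j c x)).
  congr gexp; apply/funext => x; rewrite -mulr_sumr /h /=.
  by rewrite umS //; ring.
rewrite gexp_sum; last by move=> c; apply: tameM => //; apply: tame_Ym; exact: ltnW.
rewrite big1 // => c /andP[jc cb]; apply: Rl dh _ => // v Bbv cv.
have {Bbv} bv : ball l j b v.
  by case: Bbv => // Bv'; apply: (Bv v Bv'); exact: branch_ball cb cv.
exact: (ball_pbranch lL jc bv cv).
Qed.

Lemma inc_orthP l : (l <= L)%N -> inc_orth l.
Proof.
elim: l => [|l IH] lL; first exact: inc_orth0.
by apply: inc_orthS => //; apply: Ym_orth_of (ltnW lL) (IH (ltnW lL)).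
Qed.

Lemma Ym_orthP l : (l <= L)%N -> Ym_orth l.
Proof. by move=> lL; apply: Ym_orth_of => //; exact: inc_orthP. Qed.

Lemma Ym_mean0 l i b : (l <= L)%N -> inb edge i b -> Ex (Ym l i b) = 0.
Proof.
move=> lL ib; rewrite -(Ym_orthP lL ib (tame_cst _ 1) (depends_cst (A := fun=> False) 1)) //.
by congr gexp; apply/funext => x; rewrite mul1r.
Qed.

Lemma inc_mean0 l j b : (l <= L)%N -> inb edge j b -> Ex (inc l j b) = 0.
Proof.
move=> lL jb; rewrite -(inc_orthP lL jb (tame_cst _ 1) (depends_cst (A := fun=> False) 1)) //.
by congr gexp; apply/funext => x; rewrite mul1r.
Qed.

Lemma zm_mean0 l j b : (l <= L)%N -> inb edge j b -> Ex (zm l j b) = 0.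
Proof.
move=> + jb; elim: l => [|l IH] lL.
  rewrite -(inc_mean0 lL jb); congr gexp; apply/funext => x.
  by rewrite [LHS]zm_inc add0r.
have -> : zm l.+1 j b = fun x => zm l j b x + inc l.+1 j b x.
  by apply/funext => x; rewrite zm_inc.
rewrite gexpD ?inc_mean0 ?IH ?addr0 ?(ltnW lL) //; last exact: tame_inc.
by apply: tame_zm; exact: ltnW.
Qed.

(** For [s < t] the earlier contribution lives on the balls of level [t - 1], so it is an admissible
    test function for the later one. *)
Lemma Ym_uncorrelated s t i b : (s < t)%N -> (t <= L)%N -> inb edge i b ->
  Ex (fun x => Ym s i b x * Ym t i b x) = 0.
Proof.
move=> st tL ib; have sL : (s <= L)%N by rewrite ltnW // (leq_trans st).
apply: (Ym_orthP tL ib (tame_Ym _ _ sL) (B := branch s i b)).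
  exact: depends_Ym.
move=> v [k [ki kv]] _; exists k; split => //.
by clear -st kv; case: t st => // t st; exact: ball_mono kv.
Qed.

Lemma zm_zp l j b : (l <= L)%N -> inb edge j b ->
  Ex (fun x => zm l j b x * zp l j b x) = Ex (fun x => zp l j b x ^+ 2).
Proof.
move=> lL jb; have h := inc_orthP lL jb (tame_zp j b lL) (@depends_zp l j b) (fun v h _ => h).
transitivity (Ex (fun x => zp l j b x ^+ 2 + zp l j b x * inc l j b x)).
  by congr gexp; apply/funext => x; rewrite [zm l j b x]zm_inc; ring.
rewrite gexpD ?h ?addr0 //; first by apply: tameX; exact: tame_zp.
by apply: tameM; [exact: tame_zp|exact: tame_inc].
Qed.

Lemma zm_sqr l j b : (l <= L)%N -> inb edge j b ->
  Ex (fun x => zm l j b x ^+ 2) = Ex (fun x => zp l j b x ^+ 2) + Ex (fun x => inc l j b x ^+ 2).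
Proof.
move=> lL jb; have h := inc_orthP lL jb (tame_zp j b lL) (@depends_zp l j b) (fun v h _ => h).
have t1 : tame (fun x => zp l j b x ^+ 2) by apply: tameX; exact: tame_zp.
have t2 : tame (fun x => inc l j b x ^+ 2) by apply: tameX; exact: tame_inc.
have t3 : tame (fun x => 2 * (zp l j b x * inc l j b x)).
  by apply: tameZ; apply: tameM; [exact: tame_zp|exact: tame_inc].
transitivity (Ex (fun x => zp l j b x ^+ 2 + inc l j b x ^+ 2 + 2 * (zp l j b x * inc l j b x))).
  by congr gexp; apply/funext => x; rewrite [zm l j b x]zm_inc; ring.
rewrite gexpD //; last exact: tameD.
rewrite gexpD // gexpZ ?h ?mulr0 ?addr0 //.
by apply: tameM; [exact: tame_zp|exact: tame_inc].
Qed.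

(** * Fourth moments, uniformly in the degree *)

Hypothesis deg : forall i, #|inb edge i| = d.
Hypothesis delta0 : 0 < delta.

(** With [N] the number of subsets, [N ^+ 3] comes from the power-mean inequality and one more [N]
    from the number of summands; [16 = 8 + 8] comes from the fourth power of a difference of two
    products, each of fourth moment at most [c ^+ r]. *)
Definition mom_Y (c : R) := #|{: {set 'I_r}}|%:R ^+ 4 * (16 * c ^+ r).

(** The factor 8 comes from [pow4D_le] and the factor 3 from [gexp_sum_pow4_le]. The initial [1 +]
    keeps all values at least one, as bounding products by [c ^+ r] requires. *)
Fixpoint mom_z (l : nat) : R := if l is l'.+1 then
  8 * (mom_z l' + K ^+ 4 * (3 * mom_Y (mom_z l')))
  else 1 + `|delta ^+ 2 * gauss_exp (fun t : R => t ^+ 4)|.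

Lemma mom_Y_ge0 (c : R) : 0 <= c -> 0 <= mom_Y c.
Proof. by move=> c0; rewrite !mulr_ge0 ?exprn_ge0. Qed.

Lemma mom_z_ge1 l : 1 <= mom_z l.
Proof.
elim: l => [|l IH] /=; first by rewrite lerDl.
have : 0 <= K ^+ 4 * (3 * mom_Y (mom_z l)).
  by rewrite mulr_ge0 ?exprn_even_ge0 // mulr_ge0 // mom_Y_ge0 // (le_trans _ IH).
lra.
Qed.

Lemma mom_z_le l : mom_z l <= mom_z l.+1.
Proof.
have h := mom_z_ge1 l => /=.
have : 0 <= K ^+ 4 * (3 * mom_Y (mom_z l)).
  by rewrite mulr_ge0 ?exprn_even_ge0 // mulr_ge0 // mom_Y_ge0 // (le_trans _ h).
lra.
Qed.

Definition others j b := enum [pred c | inb edge j c && (c != b)].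

Lemma mem_others j b c : (c \in others j b) = inb edge j c && (c != b).
Proof. by rewrite mem_enum. Qed.

Lemma size_others j b : inb edge j b -> size (others j b) = d.-1.
Proof.
move=> jb; rewrite -cardE -(deg j) [in RHS](cardD1 b) [b \in _]jb add1n /=.
by apply: eq_card => c; rewrite !inE andbC.
Qed.

Lemma sum_others j b (F : E -> R) :
  \sum_(c | inb edge j c && (c != b)) F c = \sum_(c <- others j b) F c.
Proof. by rewrite big_enum. Qed.

Lemma umSE l j b x :
  um l.+1 j b x = (Num.sqrt d.-1%:R)^-1 * \sum_(c <- others j b) Ym l j c x.
Proof. by rewrite umS // sum_others. Qed.

Lemma pow4D_le (a b : R) : (a + b) ^+ 4 <= 8 * (a ^+ 4 + b ^+ 4).
Proof.
have -> : 8 * (a ^+ 4 + b ^+ 4) = (a + b) ^+ 4 + (6 * ((a + b) ^+ 2 * (a - b) ^+ 2) + (a - b) ^+ 4) by ring.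
rewrite lerDl; apply: addr_ge0; last exact: exprn_even_ge0.
by apply: mulr_ge0 => //; apply: mulr_ge0; exact: sqr_ge0.
Qed.

Lemma prod_pow4_le l b (S : {set 'I_r}) (z : 'I_r -> (V -> R) -> R) (c : R) : (l <= L)%N -> 1 <= c ->
  (forall k, tame (z k)) -> (forall k, depends (ball l (edge b k) b) (z k)) ->
  (forall k, Ex (fun x => z k x ^+ 4) <= c) ->
  Ex (fun x => (\prod_(k in S) z k x) ^+ 4) <= c ^+ r.
Proof.
move=> lL c1 tz dz zc; have c0 : 0 <= c by exact: le_trans c1.
have t4 k : tame (fun x => z k x ^+ 4) by exact: tameX.
have -> : (fun x => (\prod_(k in S) z k x) ^+ 4) = fun x => \prod_(k <- enum S) z k x ^+ 4.
  by apply/funext => x; rewrite prodrXl big_enum.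
rewrite (@gexp_prod _ _ _ _ (fun k => ball l (edge b k) b) (enum S) (fun k x => z k x ^+ 4)) ?enum_uniq //.
- rewrite big_enum /=; apply: (@le_trans _ _ (\prod_(k in S) c)).
    apply: ler_prod => k _; rewrite zc andbT; apply: gexp_ge0 => // x.
    by rewrite exprn_even_ge0.
  rewrite prodr_const ler_weXn2l //; by rewrite -[leqRHS](card_ord r) max_card.
- by move=> k k' _ _ kk' v kv k'v; move: kk'; rewrite (edge_ball_inj lL lL kv k'v) eqxx.
- by move=> k x y xy; congr (_ ^+ 4); exact: (dz k x y xy).
Qed.

Lemma Ym_pow4_le l i b (c : R) : (l <= L)%N -> inb edge i b -> 1 <= c ->
  (forall j, inb edge j b -> Ex (fun x => zm l j b x ^+ 4) <= c) ->
  (forall j, inb edge j b -> Ex (fun x => zp l j b x ^+ 4) <= c) ->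
  Ex (fun x => Ym l i b x ^+ 4) <= mom_Y c.
Proof.
move=> lL /existsP[k0 /eqP <-] c1 zc zpc.
pose P (z : 'I_r -> (V -> R) -> R) (S : {set 'I_r}) x := \prod_(k in S :\ k0) z k x.
pose z k := zm l (edge b k) b; pose z' k := zp l (edge b k) b.
have tz k : tame (z k) by exact: tame_zm.
have tz' k : tame (z' k) by exact: tame_zp.
have tP S : tame (fun x => P z S x ^+ 4) by apply: tameX; exact: tame_prod.
have tP' S : tame (fun x => P z' S x ^+ 4) by apply: tameX; exact: tame_prod.
pose N : R := #|{: {set 'I_r}}|%:R.
have tF : tame (fun x => N ^+ 3 * \sum_(S : {set 'I_r}) (8 * (P z S x ^+ 4 + P z' S x ^+ 4))).
  by apply: tameZ; apply: tame_sum => S; apply: tameZ; exact: tameD.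
apply: (@le_trans _ _ (Ex (fun x => N ^+ 3 * \sum_(S : {set 'I_r}) (8 * (P z S x ^+ 4 + P z' S x ^+ 4))))).
  apply: le_gexp => //; first by apply: tameX; exact: tame_Ym.
  move=> x; rewrite YmE // big_mkcond; apply: le_trans (sum_pow4_le _) _.
  rewrite ler_wpM2l ?exprn_ge0 //; apply: ler_sum => S _.
  apply: (@le_trans _ _ ((P z S x - P z' S x) ^+ 4)).
    case: ifP => _; last by rewrite expr0n /= exprn_even_ge0.
    rewrite exprMn ler_piMl ?exprn_even_ge0 // -(ger0_norm (exprn_even_ge0 _ _)) //.
    by rewrite normrX exprn_ile1 // fhat_le1.
  by rewrite (le_trans (pow4D_le _ _)) // exprNn -signr_odd /= expr0 mul1r.
rewrite gexpZ; last by apply: tame_sum => S; apply: tameZ; exact: tameD.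
rewrite gexp_sum; last by move=> S; apply: tameZ; exact: tameD.
rewrite /mom_Y -/N (_ : N ^+ 4 * _ = N ^+ 3 * (N * (16 * c ^+ r))); last by ring.
apply: ler_wpM2l; first exact/exprn_ge0/ler0n.
rewrite /N mulr_natl -sumr_const.
apply: ler_sum => S _; rewrite gexpZ ?gexpD //; last exact: tameD.
rewrite (_ : 16 * _ = 8 * (c ^+ r + c ^+ r)); last by ring.
rewrite ler_wpM2l // lerD //.
  by apply: (prod_pow4_le (l := l) (b := b)) => // k; [exact: depends_zm|apply: zc; exact: inb_edge].
apply: (prod_pow4_le (l := l) (b := b)) => // k; last by apply: zpc; exact: inb_edge.
apply: depends_sub (@depends_zp l (edge b k) b); exact: pball_ball.
Qed.

Lemma branch_disjoint_on l j b : (l < L)%N -> forall c c', c \in others j b -> c' \in others j b ->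
  c != c' -> forall v, branch l j c v -> ~ branch l j c' v.
Proof.
move=> lL c c'; rewrite !mem_others => /andP[jc _] /andP[jc' _] cc' v cv c'v.
by move: cc'; rewrite (branch_disjoint girth lL lL jc jc' cv c'v) eqxx.
Qed.

Lemma um_pow4_le l j b M : (l < L)%N -> inb edge j b ->
  (forall c, inb edge j c -> Ex (fun x => Ym l j c x ^+ 4) <= M) ->
  Ex (fun x => um l.+1 j b x ^+ 4) <= 3 * M.
Proof.
move=> lL jb YM; have lL' := ltnW lL.
have M0 : 0 <= M.
  apply: le_trans (YM b jb); apply: gexp_ge0 => [|x]; last exact: exprn_even_ge0.
  by apply: tameX; exact: tame_Ym.
pose S x := \sum_(c <- others j b) Ym l j c x.
have tS : tame (fun x => S x ^+ 4) by apply: tameX; apply: tame_sum => c; exact: tame_Ym.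
have -> : (fun x => um l.+1 j b x ^+ 4) = fun x => (Num.sqrt d.-1%:R)^-1 ^+ 4 * S x ^+ 4.
  by apply/funext => x; rewrite umSE exprMn.
(* If [d.-1 = 0] the normalisation is the inverse of zero, which is zero. *)
rewrite gexpZ //; case: (posnP d.-1) => [->|d0].
  by rewrite sqrtr0 invr0 expr0n mul0r mulr_ge0.
have n0 : 0 < d.-1%:R :> R by rewrite ltr0n.
have e4 : (Num.sqrt d.-1%:R)^-1 ^+ 4 = (d.-1%:R ^+ 2)^-1 :> R.
  by rewrite exprVn (exprM _ 2 2) sqr_sqrtr // ltW.
rewrite e4 mulrC ler_pdivrMr ?exprn_gt0 //.
rewrite (_ : 3 * M * _ = 3 * d.-1%:R ^+ 2 * M); last by ring.
rewrite -(size_others jb).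
have dis := branch_disjoint_on (b := b) lL.
have tY c : tame (Ym l j c) by exact: tame_Ym.
have dY c : depends (branch l j c) (Ym l j c) by exact: depends_Ym.
have hM c : c \in others j b -> Ex (fun x => Ym l j c x ^+ 4) <= M.
  by rewrite mem_others => /andP[jc _]; exact: YM.
have h0 c : c \in others j b -> Ex (Ym l j c) = 0.
  by rewrite mem_others => /andP[jc _]; exact: (Ym_mean0 lL' jc).
exact: (gexp_sum_pow4_le (enum_uniq _) (dis j) tY dY hM h0).
Qed.

Lemma zp_pow4_le l j b : (forall s, (s < l)%N -> Ex (fun x => zm s j b x ^+ 4) <= mom_z s) ->
  Ex (fun x => zp l j b x ^+ 4) <= mom_z l.
Proof.
case: l => [|l] h /=; last exact: le_trans (h l (ltnSn l)) (mom_z_le l).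
rewrite (expr0n _ 4) gexp_cst; exact: le_trans (mom_z_ge1 0).
Qed.

Lemma zm_pow4_le l j b : (l <= L)%N -> inb edge j b -> Ex (fun x => zm l j b x ^+ 4) <= mom_z l.
Proof.
elim/ltn_ind: l j b => -[|l] IH j b lL jb.
  have -> : (fun x => zm 0 j b x ^+ 4) = fun x : V -> R => x j ^+ 4.
    by apply/funext => x; rewrite zm_inc add0r.
  rewrite gexp_var_pow (exprM _ 2 2) sqr_sqrtr ?(ltW delta0) //=.
  by rewrite ler_wpDl // ler_norm.
have lL' := ltnW lL.
have tA : tame (Am l j b) by exact: (tame_Am j b lL).
have tu : tame (um l.+1 j b) by exact: (tame_um j b lL).
have tz : tame (fun x => zm l j b x ^+ 4) by apply: tameX; exact: tame_zm.
have t4 : tame (fun x => um l.+1 j b x ^+ 4) by exact: tameX.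
apply: (@le_trans _ _ (Ex (fun x => 8 * (zm l j b x ^+ 4 + K ^+ 4 * um l.+1 j b x ^+ 4)))).
  apply: le_gexp; first by apply: tameX; exact: tame_zm.
    by apply: tameZ; apply: tameD => //; exact: tameZ.
  move=> x; rewrite zmS (le_trans (pow4D_le _ _)) // ler_wpM2l // lerD2l exprMn.
  rewrite ler_wpM2r ?exprn_even_ge0 // -(ger0_norm (exprn_even_ge0 _ _)) // normrX.
  have [_ /(_ [tuple um k.+1 j b x | k < l])] := FtoP lL.
  by move=> h; rewrite lerXn2r ?nnegrE // (le_trans _ h).
rewrite gexpZ; last by apply: tameD => //; exact: tameZ.
rewrite gexpD //; last exact: tameZ.
rewrite gexpZ //= ler_wpM2l // lerD ?IH // ler_wpM2l ?exprn_even_ge0 //.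
apply: um_pow4_le => // c jc; apply: Ym_pow4_le => //; first exact: mom_z_ge1.
  by move=> i ib; apply: IH.
move=> i ib; apply: zp_pow4_le => s sl; apply: IH => //; first exact: ltnW.
by rewrite ltnW // (leq_trans sl).
Qed.

Lemma zp_pow4_bound l j b : (l <= L)%N -> inb edge j b -> Ex (fun x => zp l j b x ^+ 4) <= mom_z l.
Proof.
move=> lL jb; apply: zp_pow4_le => s sl; apply: zm_pow4_le => //.
by rewrite ltnW // (leq_trans sl).
Qed.

Lemma Ym_pow4_bound l i b : (l <= L)%N -> inb edge i b -> Ex (fun x => Ym l i b x ^+ 4) <= mom_Y (mom_z l).
Proof.
move=> lL ib; apply: Ym_pow4_le => //; first exact: mom_z_ge1.
  by move=> j jb; exact: zm_pow4_le.
by move=> j jb; exact: zp_pow4_bound.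
Qed.

(** * Exact second moments of the contributions *)

Local Notation m2 l j b := (Ex (fun x => zm l j b x ^+ 2)).
Local Notation m2p l j b := (Ex (fun x => zp l j b x ^+ 2)).

(** Orthogonality of monomials in independent centred variables: if [A] and [B] differ, some
    coordinate occurs in only one product and contributes a zero mean. *)
Lemma gexp_prod2 l b (A B : {set 'I_r}) (u w : 'I_r -> (V -> R) -> R) : (l <= L)%N ->
  (forall k, tame (u k)) -> (forall k, tame (w k)) ->
  (forall k, depends (ball l (edge b k) b) (u k)) -> (forall k, depends (ball l (edge b k) b) (w k)) ->
  (forall k, Ex (u k) = 0) -> (forall k, Ex (w k) = 0) ->
  Ex (fun x => (\prod_(k in A) u k x) * \prod_(k in B) w k x) =
  (A == B)%:R * \prod_(k in A) Ex (fun x => u k x * w k x).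
Proof.
move=> lL tu tw du dw Eu Ew.
pose G k x := (if k \in A then u k x else 1) * (if k \in B then w k x else 1).
have tG k : tame (G k).
  by apply: tameM; [case: (k \in A)|case: (k \in B)] => //; exact: tame_cst.
have dG k : depends (ball l (edge b k) b) (G k).
  by apply: dependsM; [case: (k \in A)|case: (k \in B)]; exact: depends_cst || apply: du || apply: dw.
have dis k k' : k \in index_enum 'I_r -> k' \in index_enum 'I_r -> k != k' ->
    forall v, ball l (edge b k) b v -> ~ ball l (edge b k') b v.
  by move=> _ _ kk' v kv k'v; move: kk'; rewrite (edge_ball_inj lL lL kv k'v) eqxx.
transitivity (Ex (fun x => \prod_k G k x)).
  by congr gexp; apply/funext => x; rewrite big_split /= -!big_mkcond.
rewrite (gexp_prod _ (index_enum_uniq _) dis tG dG).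
case: (eqVneq A B) => [AB|AB].
  rewrite mul1r [RHS]big_mkcond; apply: eq_bigr => k _; rewrite /G -AB.
  by case: ifP => // _; rewrite mul1r gexp_cst.
have [k kAB] : exists k, (k \in A) != (k \in B).
  apply/existsP; rewrite -negb_forall; apply: contra AB => /forallP h.
  by apply/eqP/finset.setP => k; exact/eqP.
rewrite mul0r (bigD1 k) //= (_ : Ex (G k) = 0) ?mul0r //.
move: kAB; rewrite /G; case: (k \in A); case: (k \in B) => // _.
- by rewrite -(Eu k); congr gexp; apply/funext => x; rewrite mulr1.
- by rewrite -(Ew k); congr gexp; apply/funext => x; rewrite mul1r.
Qed.

Lemma zp_mean0 l j b : (l <= L)%N -> inb edge j b -> Ex (zp l j b) = 0.
Proof.
case: l => [|l] lL jb; first exact: gexp_cst.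
exact: (zm_mean0 (ltnW lL) jb).
Qed.

(** Distinct subsets are orthogonal. For equal ones, [zm_zp] makes three of the four products have
    the same expectation, and a single difference remains. *)
Lemma Ym_sqr l b k0 : (l <= L)%N -> Ex (fun x => Ym l (edge b k0) b x ^+ 2) =
  \sum_(S : {set 'I_r} | k0 \in S) fhat f S ^+ 2 *
    (\prod_(k in S :\ k0) m2 l (edge b k) b - \prod_(k in S :\ k0) m2p l (edge b k) b).
Proof.
move=> lL.
pose z k := zm l (edge b k) b; pose z' k := zp l (edge b k) b.
pose P (z : 'I_r -> (V -> R) -> R) (S : {set 'I_r}) x := \prod_(k in S :\ k0) z k x.
have tz k : tame (z k) by exact: tame_zm.
have tz' k : tame (z' k) by exact: tame_zp.
have tP S : tame (P z S) by exact: tame_prod.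
have tP' S : tame (P z' S) by exact: tame_prod.
have dz k : depends (ball l (edge b k) b) (z k) by exact: depends_zm.
have dz' k : depends (ball l (edge b k) b) (z' k).
  by apply: depends_sub (@depends_zp l (edge b k) b); exact: pball_ball.
have Ez k : Ex (z k) = 0 by exact: (zm_mean0 lL (inb_edge _ _ _)).
have Ez' k : Ex (z' k) = 0 by exact: (zp_mean0 lL (inb_edge _ _ _)).
have Ezz k : Ex (fun x => z k x * z k x) = m2 l (edge b k) b.
  by congr gexp; apply/funext => x; rewrite expr2.
have Ez'z' k : Ex (fun x => z' k x * z' k x) = m2p l (edge b k) b.
  by congr gexp; apply/funext => x; rewrite expr2.
have Ezz' k : Ex (fun x => z k x * z' k x) = m2p l (edge b k) b.
  exact: (zm_zp lL (inb_edge _ _ _)).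
have Ez'z k : Ex (fun x => z' k x * z k x) = m2p l (edge b k) b.
  by rewrite -Ezz'; congr gexp; apply/funext => x; rewrite mulrC.
pose D S x := P z S x - P z' S x.
have tD S : tame (D S) by exact: tameB.
have ED (S S' : {set 'I_r}) : k0 \in S -> k0 \in S' -> Ex (fun x => D S x * D S' x) = (S == S')%:R *
    (\prod_(k in S :\ k0) m2 l (edge b k) b - \prod_(k in S :\ k0) m2p l (edge b k) b).
  move=> kS kS'.
  have eS : (S :\ k0 == S' :\ k0) = (S == S').
    by apply/eqP/eqP => [e|-> //]; rewrite -(finset.setD1K kS) e finset.setD1K.
  transitivity (Ex (fun x => (P z S x * P z S' x - P z S x * P z' S' x) -
                             (P z' S x * P z S' x - P z' S x * P z' S' x))).
    by congr gexp; apply/funext => x; rewrite /D; ring.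
  have tM g h : tame g -> tame h -> tame (fun x : V -> R => g x * h x) by exact: tameM.
  rewrite gexpB; [|apply: tameB; exact: tM|apply: tameB; exact: tM].
  rewrite gexpB; [|exact: tM|exact: tM].
  rewrite gexpB; [|exact: tM|exact: tM].
  rewrite /P !(gexp_prod2 (l := l) (b := b)) // eS.
  rewrite (eq_bigr _ (fun k _ => Ezz k)) (eq_bigr _ (fun k _ => Ezz' k)).
  rewrite (eq_bigr _ (fun k _ => Ez'z k)) (eq_bigr _ (fun k _ => Ez'z' k)).
  by rewrite -!mulrBr subrr subr0.
transitivity (Ex (fun x => \sum_(S : {set 'I_r} | k0 \in S) \sum_(S' : {set 'I_r} | k0 \in S')
    (fhat f S * fhat f S') * (D S x * D S' x))).
  congr gexp; apply/funext => x; rewrite YmE // expr2 big_distrl /=; apply: eq_bigr => S _.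
  by rewrite big_distrr /=; apply: eq_bigr => S' _; rewrite mulrACA.
have tF S S' : tame (fun x => fhat f S * fhat f S' * (D S x * D S' x)) by apply: tameZ; exact: tameM.
rewrite gexp_sum; last by move=> S; exact: tame_sum.
apply: eq_bigr => S kS; rewrite gexp_sum // (bigD1 S) //= big1 => [|S' /andP[kS' SS']].
  by rewrite addr0 gexpZ ?ED // ?eqxx ?mul1r // -?expr2 //; exact: tameM.
rewrite gexpZ ?ED // 1?eq_sym ?(negbTE SS') ?mul0r ?mulr0 //; exact: tameM.
Qed.

(** A single constant [M] for the central limit theorem: its three parts cover the third moment, the
    variances and the limit variances. *)
Definition summand_cap l : R := 1 + l%:R ^+ 3 * \sum_(s < l) mom_Y (mom_z s) +
  \sum_(s < l) (1 + mom_Y (mom_z s)) + \sum_(s < l) nu f delta s.+1.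

Let my0 s : 0 <= mom_Y (mom_z s).
Proof. by apply: mom_Y_ge0; exact: le_trans (mom_z_ge1 _). Qed.

Lemma summand_cap_ge l : [/\ 0 <= summand_cap l,
  1 + l%:R ^+ 3 * \sum_(s < l) mom_Y (mom_z s) <= summand_cap l,
  forall s : 'I_l, 1 + mom_Y (mom_z s) <= summand_cap l &
  forall s : 'I_l, nu f delta s.+1 <= summand_cap l].
Proof.
set a := 1 + _; set b := \sum_(s < l) (1 + mom_Y (mom_z s)); set c := \sum_(s < l) nu f delta s.+1.
have a0 : 0 <= a.
  apply: addr_ge0 => //; apply: mulr_ge0; first exact: exprn_ge0.
  by apply: sumr_ge0 => s _; exact: my0.
have my1 s : 0 <= 1 + mom_Y (mom_z s) by exact: addr_ge0.
have nu0 s : 0 <= nu f delta s.+1 by exact: nu_ge0.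
have b0 : 0 <= b by apply: sumr_ge0 => s _.
have c0 : 0 <= c by apply: sumr_ge0 => s _.
have -> : summand_cap l = a + b + c by [].
split=> [||s|s]; [lra|lra| |].
- have : 1 + mom_Y (mom_z s) <= b by rewrite /b (bigD1 s) //= lerDl sumr_ge0.
  lra.
- have : nu f delta s.+1 <= c by rewrite /c (bigD1 s) //= lerDl sumr_ge0.
  lra.
Qed.

Lemma Ym_summand_ok l i b : (l <= L)%N -> inb edge i b ->
  summand_ok (summand_cap l) (fun _ : V => Num.sqrt delta) (fun c (s : 'I_l) => Ym s i c)
    (fun c s => Ex (fun x => Ym s i c x ^+ 2)) b.
Proof.
move=> lL ib; have [cap0 cap1 cap2 _] := summand_cap_ge l.
have sL (s : 'I_l) : (s <= L)%N by exact: leq_trans (ltnW (ltn_ord s)) lL.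
have tY (s : 'I_l) : tame (Ym s i b) by exact: tame_Ym.
have t4 (s : 'I_l) : tame (fun x => Ym s i b x ^+ 4) by exact: tameX.
have Y4 (s : 'I_l) := Ym_pow4_bound (sL s) ib.
split=> [s|s t|s|].
- exact: (Ym_mean0 (sL s) ib).
- have [<-|st] := eqVneq s t.
    by rewrite mul1r; congr gexp; apply/funext => x; rewrite expr2.
  rewrite mul0r; have [lt|gt|/val_inj e] := ltngtP s t; last by rewrite e eqxx in st.
    exact: (Ym_uncorrelated lt (sL t) ib).
  rewrite -(Ym_uncorrelated gt (sL s) ib).
  by congr gexp; apply/funext => x; rewrite mulrC.
- apply/andP; split; first by apply: gexp_ge0 => [|x]; [exact: tameX|exact: sqr_ge0].
  apply: le_trans (cap2 s); have := le_trans (gexp_sqr_le _ (tY s)) (Y4 s).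
  set q := gexp _ _; set m := mom_Y _ => qm.
  have := sqr_ge0 (q - 1); rewrite sqrrB expr1n mulr1; have := sqr_ge0 q; lra.
(* The recursion controls fourth moments only; the third moment asked for by the replacement is
   deduced from them. *)
have pow3 (a : R) : 0 <= a -> a ^+ 3 <= 1 + a ^+ 4.
  move=> a0; have [a1|a1] := leP a 1.
    by apply: (@le_trans _ _ 1); [exact: exprn_ile1|rewrite lerDl exprn_ge0].
  by apply: (@le_trans _ _ (a ^+ 4)); [rewrite ler_weXn2l // ltW|rewrite lerDr].
have tS : tame (fun x => \sum_(s < l) Ym s i b x ^+ 4) by exact: tame_sum.
have tN : tame (fun x => N1 ((fun s : 'I_l => Ym s i b) ^~ x)).
  by apply: tame_sum => s; apply: tame_norm.
apply: (@le_trans _ _ (Ex (fun x => 1 + l%:R ^+ 3 * \sum_(s < l) Ym s i b x ^+ 4))).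
  apply: le_gexp; first exact: tameX.
    by apply: tameD; [exact: tame_cst|exact: tameZ].
  move=> x; apply: le_trans (pow3 _ (N1_ge0 _)) _; rewrite lerD2l.
  apply: le_trans (sum_pow4_le _) _; rewrite card_ord; apply: ler_wpM2l; first exact: exprn_ge0.
  apply: ler_sum => s _; rewrite -normrX ger0_norm //; exact: exprn_even_ge0.
rewrite gexpD; [|exact: tame_cst|exact: tameZ].
rewrite gexp_cst gexpZ //; apply: le_trans cap1; rewrite lerD2l.
apply: ler_wpM2l; first exact: exprn_ge0.
by rewrite gexp_sum //; apply: ler_sum => s _; exact: Y4.
Qed.

Lemma Ym_degenerate l i b : (forall S : {set 'I_r}, S != finset.set0 -> (fhat f S : R) = 0) ->
  inb edge i b -> Ym l i b = fun=> 0.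
Proof.
move=> f0 /existsP[k /eqP <-]; apply/funext => x; rewrite YmE // big1 // => S kS.
by rewrite f0 ?mul0r //; apply/finset.set0Pn; exists k.
Qed.

Lemma nu_degenerate l : (forall S : {set 'I_r}, S != finset.set0 -> (fhat f S : R) = 0) ->
  nu f delta l.+1 = 0.
Proof.
move=> f0; rewrite nuE big1 ?mulr0 // => k _; rewrite /qinc big1 // => S kS.
by rewrite f0 ?expr0n ?mul0r //; apply/finset.set0Pn; exists k.
Qed.

(** * Variance recursion and averaging over the positions *)

Hypothesis r0 : (0 < r)%N.
Hypothesis rd : (r %| d)%N.
Hypothesis pos_deg : forall i k, #|[pred c | edge c k == i]| = (d %/ r)%N.
Hypothesis d1 : (1 < d)%N.

Definition moment_cap l : R := mom_z l + l.+1%:R * delta.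
(** Lipschitz constant of the polynomial in [Ym_sqr] on second moments bounded by [moment_cap l], a
    bound shared by the true moments and their targets. The factor 2 accounts for the two
    products. *)
Definition lip_Y l : R := #|{: {set 'I_r}}|%:R * (2 * (r%:R * moment_cap l ^+ r)).
Definition qinc_tot l : R := \sum_k qinc f delta l k.
(* Bounds sqrt(d-1) times the distance of E[(z^l)^2] from (l + 1) * delta. *)
Fixpoint dev l : R := if l is l'.+1 then
  dev l' + K ^+ 2 * ((mom_Y (mom_z l') + 1) / 2 + (lip_Y l' * dev l' + qinc_tot l')) else 0.

Lemma moment_cap_ge1 l : 1 <= moment_cap l.
Proof. by rewrite ler_wpDr ?mom_z_ge1 // mulr_ge0 // ltW. Qed.

Lemma lip_Y_ge0 l : 0 <= lip_Y l.
Proof.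
apply: mulr_ge0 => //; apply: mulr_ge0 => //; apply: mulr_ge0 => //; apply: exprn_ge0.
exact: le_trans (moment_cap_ge1 l).
Qed.

Lemma qinc_tot_ge0 l : 0 <= qinc_tot l.
Proof. by apply: sumr_ge0 => k _; exact: qinc_ge0. Qed.

Lemma dev_ge0 l : 0 <= dev l.
Proof.
elim: l => //= l IH; have := lip_Y_ge0 l; have := qinc_tot_ge0 l.
have := mom_Y_ge0 (le_trans ler01 (mom_z_ge1 l)) => h1 h2 h3.
apply: addr_ge0 => //; apply: mulr_ge0; first exact: sqr_ge0.
apply: addr_ge0; first by apply: divr_ge0 => //; exact: addr_ge0.
by apply: addr_ge0 => //; exact: mulr_ge0.
Qed.

Lemma dev_le l : dev l <= dev l.+1.
Proof.
have := lip_Y_ge0 l; have := qinc_tot_ge0 l; have := dev_ge0 l.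
have := mom_Y_ge0 (le_trans ler01 (mom_z_ge1 l)) => h1 h2 h3 h4 /=.
rewrite lerDl; apply: mulr_ge0; first exact: sqr_ge0.
apply: addr_ge0; first by apply: divr_ge0 => //; exact: addr_ge0.
by apply: addr_ge0 => //; exact: mulr_ge0.
Qed.

Lemma sqr_le_cap (X : (V -> R) -> R) (M : R) : 1 <= M -> tame X -> Ex (fun x => X x ^+ 4) <= M ->
  0 <= Ex (fun x => X x ^+ 2) <= M.
Proof.
move=> M1 tX XM; have M0 : 0 <= M by exact: le_trans M1.
have q0 : 0 <= Ex (fun x => X x ^+ 2).
  by apply: gexp_ge0 => [|x]; [exact: tameX|exact: sqr_ge0].
rewrite q0 /= -(@ler_pXn2r _ 2) // ?nnegrE //.
apply: le_trans (gexp_sqr_le _ tX) (le_trans XM _).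
by rewrite expr2 ler_peMl.
Qed.

Lemma prod_sub_dist l k (S : {set 'I_r}) (a : 'I_r -> R) (c t : R) : k \in S -> 0 <= t ->
  (forall k', `|a k'| <= moment_cap l) -> `|c| <= moment_cap l -> (forall k', `|a k' - c| <= t) ->
  `|\prod_(k' in S :\ k) a k' - c ^+ #|S|.-1| <= r%:R * moment_cap l ^+ r * t.
Proof.
move=> kS t0 aB cB ac; have B1 := moment_cap_ge1 l.
have B0 : 0 <= moment_cap l by exact: le_trans B1.
have e : #|S|.-1 = size (enum (S :\ k)) by rewrite -cardE (cardsD1 k S) kS.
have Sr : (size (enum (S :\ k)) <= r)%N by rewrite -cardE -[leqRHS](card_ord r) max_card.
rewrite -big_enum /= e; apply: le_trans (prod_dist _ B1 t0 aB cB ac) _.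
apply: ler_wpM2r => //; apply: ler_pM => //; first exact: exprn_ge0.
  by rewrite ler_nat.
exact: ler_weXn2l.
Qed.

Lemma Ym_sqr_dist l b k (t : R) : (l <= L)%N -> 0 <= t ->
  (forall j, inb edge j b -> `|m2 l j b - l.+1%:R * delta| <= t) ->
  (forall j, inb edge j b -> `|m2p l j b - l%:R * delta| <= t) ->
  `|Ex (fun x => Ym l (edge b k) b x ^+ 2) - qinc f delta l k| <= lip_Y l * t.
Proof.
move=> lL t0 h h'; have ib k' := inb_edge edge b k'.
have z1 := mom_z_ge1 l.
have ld (n : nat) : (n <= l.+1)%N -> `|n%:R * delta| <= moment_cap l.
  move=> nl; rewrite ger0_norm ?mulr_ge0 ?(ltW delta0) // ler_wpDl ?(le_trans ler01) //.
  by rewrite ler_wpM2r ?(ltW delta0) // ler_nat.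
have cap (q : R) : 0 <= q <= mom_z l -> `|q| <= moment_cap l.
  move=> /andP[q0 qz]; rewrite ger0_norm // ler_wpDr // mulr_ge0 //; exact: ltW.
have hz k' : `|m2 l (edge b k') b| <= moment_cap l.
  apply: cap; apply: sqr_le_cap => //; first exact: tame_zm.
  exact: (zm_pow4_le lL (ib k')).
have hzp k' : `|m2p l (edge b k') b| <= moment_cap l.
  apply: cap; apply: sqr_le_cap => //; first exact: tame_zp.
  exact: (zp_pow4_bound lL (ib k')).
rewrite (Ym_sqr b k lL) /qinc -sumrB; apply: le_trans (ler_norm_sum _ _ _) _.
apply: (@le_trans _ _ (\sum_(S : {set 'I_r}) 2 * (r%:R * moment_cap l ^+ r) * t)); last first.
  by rewrite sumr_const -[leLHS]mulr_natl /lip_Y !mulrA.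
have T0 : 0 <= r%:R * moment_cap l ^+ r * t.
  apply: mulr_ge0 => //; apply: mulr_ge0 => //; apply: exprn_ge0; exact: le_trans (moment_cap_ge1 l).
rewrite big_mkcond; apply: ler_sum => S _; rewrite -mulrA; case: ifP => kS; last exact: mulr_ge0.
rewrite -mulrBr normrM ger0_norm ?sqr_ge0 //.
apply: (@le_trans _ _ (1 * (r%:R * moment_cap l ^+ r * t + r%:R * moment_cap l ^+ r * t))); last first.
  by rewrite mul1r; lra.
apply: ler_pM => //; first exact: sqr_ge0.
  by rewrite -(ger0_norm (sqr_ge0 _)) normrX exprn_ile1 // fhat_le1.
rewrite (_ : _ - _ = (\prod_(k' in S :\ k) m2 l (edge b k') b - (l.+1%:R * delta) ^+ #|S|.-1) -
  (\prod_(k' in S :\ k) m2p l (edge b k') b - (l%:R * delta) ^+ #|S|.-1)); last by ring.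
apply: le_trans (ler_normB _ _) _; apply: lerD.
  apply: prod_sub_dist => //; first exact: ld.
  by move=> k'; exact: h.
apply: prod_sub_dist => //; first by apply: ld; exact: leqnSn.
by move=> k'; exact: h'.
Qed.

(** The counting hypothesis says that [j] occupies each position in [size J / r] factors of [J], up
    to one. It holds for the factors at [j], with or without one of them removed. *)
Lemma avg_qinc l j (J : seq E) : (0 < size J)%N ->
  (forall k, `|r%:R * (count (fun c => edge c k == j) J)%:R - (size J)%:R| <= r%:R :> R) ->
  `|(size J)%:R^-1 * \sum_(c <- J) \sum_(k | edge c k == j) qinc f delta l k - nu f delta l.+1| <=
  qinc_tot l / (size J)%:R.
Proof.
move=> n0 cnt; rewrite (exchange_big_dep xpredT) //= nuE.
have nR : 0 < (size J)%:R :> R by rewrite ltr0n.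
have rR : 0 < r%:R :> R by rewrite ltr0n.
rewrite !mulr_sumr -sumrB; apply: le_trans (ler_norm_sum _ _ _) _.
rewrite /qinc_tot mulr_suml; apply: ler_sum => k _.
rewrite big_const_seq iter_addr_0 -[_ *+ count _ _]mulr_natl.
set q := qinc _ _ _ _; have q0 : 0 <= q by exact: qinc_ge0.
set c := count _ _.
rewrite (_ : _ - _ = q / (size J)%:R * (r%:R^-1 * (r%:R * c%:R - (size J)%:R))); last first.
  by field; rewrite !gt_eqF.
rewrite normrM ger0_norm ?divr_ge0 // ler_piMr ?divr_ge0 // normrM [`|r%:R^-1|]ger0_norm ?invr_ge0 //.
by rewrite mulrC ler_pdivrMr // mul1r; exact: cnt.
Qed.

Lemma count_enum (P : pred E) (A : pred E) : count P (enum A) = #|[pred c | A c && P c]|.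
Proof. by rewrite -sum1_count big_enum_cond sum1_card. Qed.

(** Removing [b] lowers the size by one and the count of one position by one: the discrepancy is
    [1 - r] at the position of [j] in [b] and [1] elsewhere. *)
Lemma count_others j b k : inb edge j b ->
  `|r%:R * (count (fun c => edge c k == j) (others j b))%:R - (size (others j b))%:R| <= r%:R :> R.
Proof.
move=> jb; rewrite (size_others jb) count_enum.
have -> : #|[pred c | (inb edge j c && (c != b)) && (edge c k == j)]| = (d %/ r - (edge b k == j))%N.
  rewrite -(pos_deg j k) [in RHS](cardD1 b) [b \in _]/= addKn.
  apply: eq_card => c; rewrite !inE andbAC andbC; congr (_ && _).
  by case: (eqVneq (edge c k) j) => [<-|]; rewrite ?andbF // inb_edge.
have dr : (r * (d %/ r))%N = d by rewrite mulnC divnK.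
have q0 : (0 < d %/ r)%N by rewrite divn_gt0 // dvdn_leq // (ltn_trans _ d1).
rewrite natrB; last by case: (_ == _).
have dR : r%:R * (d %/ r)%:R = d%:R :> R by rewrite -natrM dr.
have r1 : 1 <= r%:R :> R by rewrite ler1n.
have -> : d.-1%:R = d%:R - 1 :> R by rewrite -subn1 natrB // (ltn_trans _ d1).
rewrite mulrBr dR; case: (_ == _); rewrite /= ?mulr1 ?mulr0 ler_norml; lra.
Qed.

Definition incident j := enum [pred c | inb edge j c].

Lemma size_incident j : size (incident j) = d.
Proof. by rewrite -cardE -(deg j); apply: eq_card. Qed.

Lemma count_incident j k :
  `|r%:R * (count (fun c => edge c k == j) (incident j))%:R - (size (incident j))%:R| <= r%:R :> R.
Proof.
rewrite size_incident count_enum.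
have -> : #|[pred c | inb edge j c && (edge c k == j)]| = (d %/ r)%N.
  rewrite -(pos_deg j k); apply: eq_card => c; rewrite !inE.
  by case: eqP => [<-|]; rewrite ?andbF // inb_edge.
by rewrite -natrM mulnC divnK // subrr normr0.
Qed.

Lemma avg_Ym l j (J : seq E) (t : R) : (l <= L)%N -> 0 <= t -> (0 < size J)%N ->
  (forall c, c \in J -> inb edge j c) ->
  (forall k, `|r%:R * (count (fun c => edge c k == j) J)%:R - (size J)%:R| <= r%:R :> R) ->
  (forall i b, inb edge i b -> `|m2 l i b - l.+1%:R * delta| <= t) ->
  (forall i b, inb edge i b -> `|m2p l i b - l%:R * delta| <= t) ->
  `|(size J)%:R^-1 * \sum_(c <- J) Ex (fun x => Ym l j c x ^+ 2) - nu f delta l.+1| <=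
  lip_Y l * t + qinc_tot l / (size J)%:R.
Proof.
move=> lL t0 n0 Jj cnt h h'; have nR : 0 < (size J)%:R :> R by rewrite ltr0n.
set a := (X in `|X - _|); set q := nu _ _ _.
pose a' := (size J)%:R^-1 * \sum_(c <- J) \sum_(k | edge c k == j) qinc f delta l k.
rewrite (_ : a - q = (a - a') + (a' - q)); last by ring.
apply: le_trans (ler_normD _ _) _; apply: lerD; last exact: avg_qinc.
rewrite /a /a' -mulrBr -sumrB normrM ger0_norm ?invr_ge0 // mulrC ler_pdivrMr //.
apply: le_trans (ler_norm_sum _ _ _) _.
rewrite mulr_natr -iter_addr_0 -[X in iter X](count_predT J) -big_const_seq.
rewrite big_seq [leRHS]big_seq; apply: ler_sum => c /Jj /existsP[k /eqP kj].
rewrite -kj (big_pred1 k) => [|k']; last by rewrite /= (inj_eq (@edge_inj c)).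
by apply: Ym_sqr_dist => // i; [exact: h|exact: h'].
Qed.
Hypothesis AmP : forall l, (l < L)%N -> forall j b, inb edge j b ->
  Ex (fun x => Am l j b x ^+ 2) = delta / nu f delta l.+1.

Local Notation n := (d.-1%:R : R).
Local Notation sn := (Num.sqrt n)^-1.

Let nR : 0 < n. Proof. by rewrite ltr0n -subn1 subn_gt0. Qed.

(** [A^l] depends on all branches, but on that of [c'] only at lower levels, so the product of its
    square with [Ym l j c] is a valid test function against [Ym l j c']. *)
Lemma Am_Ym_uncorrelated l j b c c' : (l < L)%N -> inb edge j c -> inb edge j c' -> c != c' ->
  Ex (fun x => Am l j b x ^+ 2 * Ym l j c x * Ym l j c' x) = 0.
Proof.
move=> lL jc jc' cc'; have lL' := ltnW lL.
have tA : tame (Am l j b) by exact: (tame_Am j b lL).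
apply: (Ym_orthP lL' jc' (B := fun v => ball l j b v \/ branch l j c v)).
- by apply: tameM; [exact: tameX|exact: tame_Ym].
- apply: dependsM; last first.
    by apply: depends_sub (@depends_Ym l j c) => v; right.
  move=> x y xy; congr (_ ^+ 2).
  by apply: (@depends_Am l j b) => v jv; apply: xy; left.
move=> v [bv|cv] c'v; first exact: (ball_pbranch lL jc' bv c'v).
by move: cc'; rewrite (branch_disjoint girth lL lL jc jc' cv c'v) eqxx.
Qed.

Lemma inc_sqr l j b : (l < L)%N -> inb edge j b -> Ex (fun x => inc l.+1 j b x ^+ 2) =
  Ex (fun x => Am l j b x ^+ 2 * (n^-1 * \sum_(c <- others j b) Ym l j c x ^+ 2)).
Proof.
move=> lL jb; have lL' := ltnW lL.
have tA : tame (Am l j b) by exact: (tame_Am j b lL).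
have tY c : tame (Ym l j c) by exact: tame_Ym.
have tAYY c c' : tame (fun x => Am l j b x ^+ 2 * Ym l j c x * Ym l j c' x).
  by apply: tameM => //; apply: tameM => //; exact: tameX.
have tAY c : tame (fun x => Am l j b x ^+ 2 * Ym l j c x ^+ 2).
  by apply: tameM; exact: tameX.
transitivity (Ex (fun x => n^-1 * \sum_(c <- others j b) \sum_(c' <- others j b)
    Am l j b x ^+ 2 * Ym l j c x * Ym l j c' x)).
  congr gexp; apply/funext => x; rewrite /= (umSE l j b x).
  set S := \sum_(_ <- _) _; rewrite !exprMn exprVn sqr_sqrtr ?(ltW nR) // mulrCA; congr (_ * _).
  transitivity (\sum_(c <- others j b) Am l j b x ^+ 2 * Ym l j c x * S).
    by rewrite -mulr_suml -mulr_sumr -/S -mulrA -[S * S]expr2.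
  apply: eq_bigr => c _.
  by rewrite mulr_sumr.
transitivity (Ex (fun x => n^-1 * \sum_(c <- others j b) Am l j b x ^+ 2 * Ym l j c x ^+ 2)); last first.
  by congr gexp; apply/funext => x; rewrite -mulr_sumr mulrCA.
rewrite !gexpZ; [|by apply: tame_sum|by apply: tame_sum => c; exact: tame_sum].
congr (_ * _); rewrite gexp_sum; last by move=> c; exact: tame_sum.
rewrite gexp_sum // big_seq [RHS]big_seq; apply: eq_bigr => c cJ.
rewrite gexp_sum // (bigD1_seq c) ?enum_uniq //= big_seq_cond big1 => [|c' /andP[c'J c'c]].
  by rewrite addr0; congr gexp; apply/funext => x; rewrite expr2 mulrA.
move: cJ c'J; rewrite !mem_others => /andP[jc _] /andP[jc' _].
by apply: Am_Ym_uncorrelated => //; rewrite eq_sym.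
Qed.

(** The square of [A^l] and the averaged squares are dependent. Since the former is at most
    [K ^+ 2], the average may be replaced by its mean and then by [nu] at a small cost, after which
    (P2) gives exactly [delta]. *)
Lemma inc_sqr_dist l j b (t : R) : (l < L)%N -> inb edge j b -> 0 < nu f delta l.+1 ->
  `|n^-1 * \sum_(c <- others j b) Ex (fun x => Ym l j c x ^+ 2) - nu f delta l.+1| <= t ->
  `|Ex (fun x => inc l.+1 j b x ^+ 2) - delta| <= K ^+ 2 * ((mom_Y (mom_z l) + 1) / 2 * sn + t).
Proof.
move=> lL jb nu0 ht; have lL' := ltnW lL.
have tA : tame (Am l j b) by exact: (tame_Am j b lL).
have tY c : tame (Ym l j c) by exact: tame_Ym.
set q := nu f delta l.+1 in nu0 ht *.
set e := n^-1 * _ in ht.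
pose avg x := n^-1 * \sum_(c <- others j b) Ym l j c x ^+ 2.
have tavg : tame avg by apply: tameZ; apply: tame_sum => c; exact: tameX.
have A2 x : Am l j b x ^+ 2 <= K ^+ 2.
  have [_ /(_ [tuple um k.+1 j b x | k < l])] := FtoP lL.
  by move=> h; rewrite -real_normK ?num_real // lerXn2r ?nnegrE // (le_trans _ h).
have tAq : tame (fun x => Am l j b x ^+ 2 * q) by apply: tameM; [exact: tameX|exact: tame_cst].
have tAv : tame (fun x => Am l j b x ^+ 2 * avg x) by apply: tameM => //; exact: tameX.
have tn : tame (fun x => `|avg x - e|) by apply: tame_norm; apply: tameB => //; exact: tame_cst.
rewrite inc_sqr // -[X in _ - X](_ : Ex (fun x => Am l j b x ^+ 2 * q) = delta); last first.
  transitivity (Ex (fun x => q * Am l j b x ^+ 2)).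
    by congr gexp; apply/funext => x; rewrite mulrC.
  rewrite gexpZ; last exact: tameX.
  by rewrite (AmP lL jb) mulrC divfK // gt_eqF.
rewrite -gexpB //.
apply: (@le_trans _ _ (Ex (fun x => K ^+ 2 * (`|avg x - e| + t)))).
  apply: gexp_norm_le; first exact: tameB.
    by apply: tameZ; apply: tameD => //; exact: tame_cst.
  move=> x; rewrite -mulrBr normrM ger0_norm ?sqr_ge0 //.
  apply: ler_pM => //; first exact: sqr_ge0.
  rewrite (_ : _ - q = (avg x - e) + (e - q)); last by rewrite /avg; ring.
  by apply: le_trans (ler_normD _ _) _; rewrite lerD2l.
rewrite gexpZ; last by apply: tameD => //; exact: tame_cst.
rewrite gexpD ?gexp_cst //; last exact: tame_cst.
apply: ler_wpM2l; first exact: sqr_ge0.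
rewrite lerD2r.
have dis := branch_disjoint_on (b := b) lL.
have dY c : depends (branch l j c) (Ym l j c) by exact: depends_Ym.
have hM c : c \in others j b -> Ex (fun x => Ym l j c x ^+ 4) <= mom_Y (mom_z l).
  rewrite mem_others => /andP[jc _].
  exact: (Ym_pow4_bound lL' jc).
have := gexp_avg_sqr_dist (enum_uniq _) (dis j) tY dY hM.
by rewrite (size_others jb); apply; rewrite -subn1 subn_gt0.
Qed.

Lemma invn_le m : (d.-1 <= m)%N -> (m%:R)^-1 <= sn.
Proof.
move=> dm; have n1 : 1 <= n by rewrite ler1n -subn1 subn_gt0.
have s0 : 0 < Num.sqrt n by rewrite sqrtr_gt0.
have mn : n <= m%:R by rewrite ler_nat.
have mR : 0 < m%:R :> R := lt_le_trans nR mn.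
rewrite lef_pV2 ?posrE //; apply: (le_trans _ mn).
have s1 : 1 <= Num.sqrt n by rewrite -[leLHS]sqrtr1 ler_sqrt.
by rewrite -[leRHS](sqr_sqrtr (ltW nR)) expr2 ler_peMl // ltW.
Qed.

Lemma avg_Ym_sn l j (J : seq E) (t : R) : (l <= L)%N -> 0 <= t -> (d.-1 <= size J)%N ->
  (forall c, c \in J -> inb edge j c) ->
  (forall k, `|r%:R * (count (fun c => edge c k == j) J)%:R - (size J)%:R| <= r%:R :> R) ->
  (forall i b, inb edge i b -> `|m2 l i b - l.+1%:R * delta| <= t * sn) ->
  (forall i b, inb edge i b -> `|m2p l i b - l%:R * delta| <= t * sn) ->
  `|(size J)%:R^-1 * \sum_(c <- J) Ex (fun x => Ym l j c x ^+ 2) - nu f delta l.+1| <=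
  (lip_Y l * t + qinc_tot l) * sn.
Proof.
move=> lL t0 dJ Jj cnt h h'.
have J0 : (0 < size J)%N by apply: leq_trans dJ; rewrite -subn1 subn_gt0.
have s0 : 0 <= sn by rewrite invr_ge0 sqrtr_ge0.
have := avg_Ym lL (mulr_ge0 t0 s0) J0 Jj cnt h h'.
move=> /le_trans; apply; rewrite mulrDl mulrA lerD2l.
by apply: ler_wpM2l; [exact: qinc_tot_ge0|exact: invn_le].
Qed.

Hypothesis nu_pos : forall l, 0 < nu f delta l.+1.

(** Both claims travel together: [zp] at one level is [zm] at the previous one, and the variance of
    a contribution involves the two. *)
Lemma zm_sqr_dist l : (l <= L)%N -> forall j b, inb edge j b ->
  `|m2 l j b - l.+1%:R * delta| <= dev l * sn /\ `|m2p l j b - l%:R * delta| <= dev l * sn.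
Proof.
elim: l => [|l IH] lL j b jb.
  split; last first.
    by rewrite (gexp_cst _ (0 ^+ 2)) expr0n mul0r subrr normr0 mul0r.
  have -> : m2 0 j b = Ex (fun x => x j ^+ 2).
    by congr gexp; apply/funext => x; rewrite zm_inc add0r.
  by rewrite gexp_var_sqr sqr_sqrtr ?(ltW delta0) // mul1r subrr normr0 mul0r.
have lL' := ltnW lL.
have s0 : 0 <= sn by rewrite invr_ge0 sqrtr_ge0.
have [z1 z2] := IH lL' j b jb; split; last first.
  by apply: le_trans z1 _; apply: ler_wpM2r => //; exact: dev_le.
have hJ : `|n^-1 * \sum_(c <- others j b) Ex (fun x => Ym l j c x ^+ 2) - nu f delta l.+1| <=
    (lip_Y l * dev l + qinc_tot l) * sn.
  have D0 : 0 <= dev l by exact: dev_ge0.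
  have hs : (d.-1 <= size (others j b))%N by rewrite (size_others jb).
  have hj c : c \in others j b -> inb edge j c by rewrite mem_others => /andP[].
  have hc k := count_others k jb.
  have := avg_Ym_sn lL' D0 hs hj hc (fun i c ic => (IH lL' i c ic).1) (fun i c ic => (IH lL' i c ic).2).
  by rewrite (size_others jb).
have hi := inc_sqr_dist lL jb (nu_pos l) hJ.
rewrite (zm_sqr lL jb).
rewrite (_ : _ - _ = (m2 l j b - l.+1%:R * delta) + (Ex (fun x => inc l.+1 j b x ^+ 2) - delta)); last first.
  by rewrite -[l.+2%:R]natr1 /=; ring.
apply: le_trans (ler_normD _ _) _; rewrite [dev _]/= mulrDl; apply: lerD => //.
by apply: le_trans hi _; rewrite -mulrDl mulrA.
Qed.

Lemma avg_Ym_dist l j (J : seq E) : (l < L)%N -> (d.-1 <= size J)%N ->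
  (forall c, c \in J -> inb edge j c) ->
  (forall k, `|r%:R * (count (fun c => edge c k == j) J)%:R - (size J)%:R| <= r%:R :> R) ->
  `|(size J)%:R^-1 * \sum_(c <- J) Ex (fun x => Ym l j c x ^+ 2) - nu f delta l.+1| <=
  (lip_Y l * dev l + qinc_tot l) * sn.
Proof.
move=> lL dJ Jj cnt; apply: avg_Ym_sn => //; first exact: ltnW.
- exact: dev_ge0.
- by move=> i c ic; exact: (zm_sqr_dist (ltnW lL) ic).1.
- by move=> i c ic; exact: (zm_sqr_dist (ltnW lL) ic).2.
Qed.

End Messages.

(** * Central limit theorem for the contributions at a vertex *)

Section Limit.
Variables (R : realType) (r : nat) (f : {ffun 'I_r -> bool} -> bool).
Variables (delta K : R) (L l : nat) (C : R) (psi : ('I_l -> R) -> R) (e : R).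
Hypothesis r0 : (0 < r)%N.
Hypothesis fhat1 : forall S : {set 'I_r}, #|S| = 1%N -> (fhat f S : R) = 0.
Hypothesis delta0 : 0 < delta.
Hypothesis lL : (0 < l <= L)%N.
Hypothesis psiP : plip C psi.
Hypothesis e0 : 0 < e.

(** A general list [J] treats messages and nodes at once: all factors at [i] but one for [u_{i->a}],
    all of them for [u_i]. The bound [D] is chosen before the hypergraph, as uniformity demands. *)
Theorem clt_Ym : exists D : nat, forall d, (D <= d)%N ->
  forall (V E : finType) (edge : E -> 'I_r -> V) (Fto : forall k : nat, k.-tuple R -> R),
  (forall b, injective (edge b)) -> no_short_cycle edge (4 * L + 4) ->
  (forall i, #|inb edge i| = d) -> (r %| d)%N ->
  (forall i k, #|[pred c | edge c k == i]| = (d %/ r)%N) ->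
  (forall k, (k < L)%N -> measurable_fun setT (Fto k) /\ forall y, `|Fto k y| <= K) ->
  (forall k, (k < L)%N -> forall j b, inb edge j b ->
    gexp (fun _ : V => Num.sqrt delta) (fun x => Am f edge d Fto k j b x ^+ 2) = delta / nu f delta k.+1) ->
  forall i (J : seq E), uniq J -> (d.-1 <= size J)%N -> (forall c, c \in J -> inb edge i c) ->
  (forall k, `|r%:R * (count (fun c => edge c k == i) J)%:R - (size J)%:R| <= r%:R :> R) ->
  `|gexp (fun _ : V => Num.sqrt delta)
      (fun x => psi (fun s => (Num.sqrt (size J)%:R)^-1 * \sum_(c <- J) Ym f edge d Fto s i c x)) -
    gexp (fun s : 'I_l => Num.sqrt (nu f delta s.+1)) psi| <= e.
Proof.
have [l0 lL'] := andP lL.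
have [cap0 _ _ capnu] := @summand_cap_ge R r f K delta delta0 l.
have nuM (s : 'I_l) : 0 <= nu f delta s.+1 <= summand_cap f K delta l by rewrite nu_ge0 ?capnu.
have [eta [N [eta0 H]]] := clt psiP cap0 e0 nuM.
pose t s := lip_Y r K delta s * dev f K delta s + qinc_tot f delta s.
have t0 s : 0 <= t s.
  by apply: addr_ge0; [apply: mulr_ge0; [exact: lip_Y_ge0|exact: dev_ge0]|exact: qinc_tot_ge0].
(* Once [d.-1] is at least [c ^+ 2], every variance error [t s / sqrt (d.-1)] is at most [eta]. *)
pose c := (\sum_(s < l) t s) / eta.
have c0 : 0 <= c by apply: divr_ge0; [exact: sumr_ge0|exact: ltW].
have [m cm] : exists m : nat, c ^+ 2 <= m%:R.
  by exists (Num.bound (c ^+ 2)); apply/ltW/archi_boundP; exact: sqr_ge0.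
exists (N.+2 + m)%N => d Dd V E edge Fto edge_inj girth deg rd pos_deg FtoP AmP i J uJ dJ Ji cnt.
have d1 : (1 < d)%N by lia.
have NJ : (N <= size J)%N by apply: leq_trans dJ; lia.
have nc : c ^+ 2 <= d.-1%:R.
  by apply: le_trans cm _; rewrite ler_nat; lia.
have tYm s b : (s <= L)%N -> tame (Ym f edge d Fto s i b) by exact: tame_Ym FtoP _ _ _.
have sL (s : 'I_l) : (s < L)%N by exact: leq_trans (ltn_ord s) lL'.
pose X b (s : 'I_l) := Ym f edge d Fto s i b.
pose v b (s : 'I_l) := gexp (fun _ : V => Num.sqrt delta) (fun x => Ym f edge d Fto s i b x ^+ 2).
have tX b (s : 'I_l) : tame (X b s) by apply: tYm; exact: ltnW.
(* All levels are placed on the largest branch, of level [l.-1], which is below [L] as disjointness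
   requires. *)
have dX b (s : 'I_l) : depends (branch edge l.-1 i b) (X b s).
  apply: depends_sub (@depends_Ym R r f V E edge d Fto edge_inj s i b) => w.
  by apply: branch_mono; rewrite -ltnS prednK.
have dis b b' : b \in J -> b' \in J -> b != b' -> forall w, branch edge l.-1 i b w -> ~ branch edge l.-1 i b' w.
  move=> bJ b'J bb' w bw b'w; have ll : (l.-1 < L)%N by rewrite prednK.
  by move: bb'; rewrite (branch_disjoint girth ll ll (Ji _ bJ) (Ji _ b'J) bw b'w) eqxx.
have ok b : b \in J -> summand_ok (summand_cap f K delta l) (fun _ : V => Num.sqrt delta) X v b.
  by move=> /Ji ib; exact: (Ym_summand_ok edge_inj girth fhat1 FtoP deg delta0 lL' ib).
refine (H V _ E J _ X v tX dX uJ NJ dis ok _).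
(* If only the constant coefficient survives, every contribution and every [nu] is zero; otherwise
   [nu] is positive and (P2) can be used. *)
move=> s; have [f0|nu0] := fhat_degenerate delta0 fhat1.
  rewrite nu_degenerate // subr0 big_seq big1 ?mulr0 ?normr0 ?ltW // => b /Ji ib.
  rewrite /v (Ym_degenerate d Fto edge_inj s f0 ib).
  by rewrite (gexp_cst _ (0 ^+ 2)) expr0n.
apply: (@le_trans _ _ (t s / Num.sqrt d.-1%:R)).
  exact: (avg_Ym_dist edge_inj girth fhat1 FtoP deg delta0 r0 rd pos_deg d1 AmP nu0 (sL s) dJ Ji cnt).
have n0 : 0 < d.-1%:R :> R by rewrite ltr0n; lia.
rewrite ler_pdivrMr ?sqrtr_gt0 //.
apply: (@le_trans _ _ (eta * c)).
  rewrite /c mulrC divfK ?gt_eqF //.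
  by rewrite (bigD1 s) //= lerDl; exact: sumr_ge0.
apply: ler_wpM2l; first exact: ltW.
by rewrite -[leLHS](ger0_norm c0) -sqrtr_sqr ler_sqrt.
Qed.

End Limit.

(** * From Euclidean norms on tuples to the sum norm, and conclusion *)

Section TupleNorms.
Variables (R : realType) (l : nat).
Implicit Types y : 'I_l -> R.

Lemma sqrt_sum_sqr_le y : Num.sqrt (\sum_s y s ^+ 2) <= N1 y.
Proof.
rewrite -[leRHS]ger0_norm ?N1_ge0 // -sqrtr_sqr ler_wsqrtr // expr2 mulr_suml.
apply: ler_sum => s _; rewrite -real_normK ?num_real // expr2.
by apply: ler_wpM2l => //; exact: le_N1.
Qed.

Lemma pseudo_lipschitz_plip (psi : l.-tuple R -> R) : pseudo_lipschitz psi ->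
  exists C, plip C (fun y => psi [tuple y s | s < l]).
Proof.
move=> [C [C0 h]]; exists C; split=> [|x y]; first exact: ltW.
have tn (w : 'I_l -> R) : tnorm [tuple w s | s < l] <= N1 w.
  rewrite /tnorm (eq_bigr (fun s => w s ^+ 2)) ?sqrt_sum_sqr_le // => s _.
  by rewrite tnth_mktuple.
have td : tdist [tuple x s | s < l] [tuple y s | s < l] <= N1 (fun s => x s - y s).
  rewrite /tdist (eq_bigr (fun s => (x s - y s) ^+ 2)) ?sqrt_sum_sqr_le // => s _.
  by rewrite !tnth_mktuple.
have n0 (z : l.-tuple R) : 0 <= tnorm z by exact: sqrtr_ge0.
apply: le_trans (h _ _) _; apply: ler_pM => //.
- by apply: mulr_ge0; [exact: ltW|apply: addr_ge0 => //; exact: addr_ge0].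
- exact: sqrtr_ge0.
- by apply: ler_wpM2l; [exact: ltW|rewrite !lerD].
Qed.

End TupleNorms.

Theorem mainTheorem3 (R : realType) (r : nat) (f : {ffun 'I_r -> bool} -> bool)
    (delta K : R) (L : nat) :
  (2 <= r)%N ->
  (forall S : {set 'I_r}, #|S| = 1%N -> (fhat f S : R) = 0) ->
  0 < delta ->
  (L%:R <= delta^-1 < L.+1%:R) ->
  0 < K ->
  forall l : nat, (1 <= l <= L)%N ->
  forall psi : l.-tuple R -> R, pseudo_lipschitz psi ->
  forall eps : R, 0 < eps ->
  exists D : nat, forall d : nat, (D <= d)%N ->
  forall (V E : finType) (edge : E -> 'I_r -> V),
    (forall a : E, injective (edge a)) ->
    index_regular edge d ->
    no_short_cycle edge (4 * L + 4) ->
  forall Fto Fnd : forall k : nat, k.-tuple R -> R,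
    (forall k : nat, (k < L)%N ->
       measurable_fun setT (Fto k) /\ measurable_fun setT (Fnd k) /\
       (forall y : k.-tuple R, `|Fto k y| <= K /\ `|Fnd k y| <= K)) ->
    (* Property (P2) *)
    (forall k : nat, (k < L)%N -> forall (i : V) (a : E), inb edge i a ->
       gexp (fun _ : V => Num.sqrt delta)
            (fun z0 => A_node f edge d Fto Fnd z0 k i ^+ 2) = delta / nu f delta k.+1 /\
       gexp (fun _ : V => Num.sqrt delta)
            (fun z0 => A_msg f edge d Fto z0 k i a ^+ 2) = delta / nu f delta k.+1) ->
  forall (i : V) (a : E), inb edge i a ->
    let EU := gexp (fun s : 'I_l => Num.sqrt (nu f delta s.+1))
                   (fun y => psi [tuple y s | s < l]) in
    `| gexp (fun _ : V => Num.sqrt delta)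
         (fun z0 => psi [tuple u_msg f edge d Fto z0 l s.+1 i a | s < l]) - EU | <= eps /\
    `| gexp (fun _ : V => Num.sqrt delta)
         (fun z0 => psi [tuple u_node f edge d Fto z0 l s.+1 i | s < l]) - EU | <= eps.
Proof.
move=> r2 fhat1 delta0 _ _ l lL psi psiL eps eps0.
have [C psiP] := pseudo_lipschitz_plip psiL.
have r0 : (0 < r)%N by exact: ltnW.
have [D HD] := clt_Ym K r0 fhat1 delta0 lL psiP eps0.
(* The shift by two ensures [1 < d], so that [d.-1] is a positive number of summands. *)
exists D.+2 => d Dd V E edge edge_inj [rd [deg' pos']] girth Fto Fnd FP P2 i a ia EU.
have deg j : #|inb edge j| = d.
  by rewrite -(deg' j); apply: eq_card => c; rewrite !inE.
have pos j k : #|[pred c | edge c k == j]| = (d %/ r)%N.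
  by rewrite -(pos' j k); apply: eq_card => c; rewrite !inE.
have FtoP k : (k < L)%N -> measurable_fun setT (Fto k) /\ forall y, `|Fto k y| <= K.
  by move=> /FP [m [_ h]]; split => // y; exact: (h y).1.
have AmP k : (k < L)%N -> forall j b, inb edge j b -> gexp (fun _ : V => Num.sqrt delta)
    (fun x => Am f edge d Fto k j b x ^+ 2) = delta / nu f delta k.+1.
  move=> kL j b jb; rewrite -(P2 k kL j b jb).2; congr gexp; apply/funext => x.
  by rewrite A_msgE.
have d1 : (1 < d)%N by lia.
have {}HD := HD d (ltnW (ltnW Dd)) V E edge Fto edge_inj girth deg rd pos FtoP AmP i.
split.
- have uJ : uniq (others edge i a) by exact: enum_uniq.
  have sJ : (d.-1 <= size (others edge i a))%N by rewrite (size_others deg ia).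
  have iJ c : c \in others edge i a -> inb edge i c by rewrite mem_others => /andP[].
  have := HD _ uJ sJ iJ (fun k => count_others R deg r0 rd pos d1 k ia).
  rewrite (size_others deg ia); congr (`|_ - _| <= _); congr gexp; apply/funext => x.
  congr psi; apply: eq_mktuple => s.
  by rewrite u_msgE ?(umSE edge d Fto fhat1).
have uJ : uniq (incident edge i) by exact: enum_uniq.
have sJ : (d.-1 <= size (incident edge i))%N by rewrite (size_incident deg) leq_pred.
have iJ c : c \in incident edge i -> inb edge i c by rewrite mem_enum.
have := HD _ uJ sJ iJ (count_incident R deg rd pos i).
rewrite (size_incident deg); congr (`|_ - _| <= _); congr gexp; apply/funext => x.
congr psi; apply: eq_mktuple => s.
by rewrite (u_nodeE edge d Fto fhat1) // big_enum.
Qed.
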